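(* Let $\xi=(X,p,B,G)$ be a principal $G$-fibration with paracompact base $B$ and connected topological group $G$, let $F$ be a $G$-space, and let $\xi[F]=(E,p,B,F,G)$ be the associated fiber bundle. Suppose all $H_i(G)$ and $H_i(F)$ are free $\Lambda$-modules. Let $\phi:C_*(B)\to C_*(G)$ be a twisting cochain of the fibration $\xi$ (in the sense of Brown). Let $(H_*(G),\{X_i\})$, with morphism $\{f_i\}:(H_*(G),\{X_i\})\to C_*(G)$, be the homology $A(\infty)$-algebra of $C_*(G)$, let $(H_*(F),\{Y_i\})$ be the corresponding homology $A(\infty)$-module of the $C_*(G)$-module $C_*(F)$, and let $\phi^*:C_*(B)\to H_*(G)$ be a $\sim$-twisting cochain such that $\sum_{i\ge1}f_i(\phi^*\otimes\cdots\otimes\phi^* )\Delta^i$ is equivalent to $\phi$. Then the homology of the $\sim$-twisted tensor product $C_*(B)\otimes_{\phi^*}H_*(F)$ is isomorphic to the homology of $E$.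
   Context: $\Lambda$ is an arbitrary associative ring with unit; modules, tensor products and homology coefficients are over $\Lambda$. Differential objects are graded by non-negative integers with differential of degree $-1$; coalgebras are coassociative. For homogeneous $a$, $\hat a=(-1)^{\deg a}a$, and $\widehat{id}(x)=\hat x$. Tensor products of homomorphisms are taken without extra signs: $(f\otimes g)(x\otimes y)=f(x)\otimes g(y)$. $C_*(B)$ is the singular chain coalgebra of $B$, $C_*(G)$ the singular chain algebra of $G$ (Pontryagin product), and $C_*(F)$ the differential $C_*(G)$-module given by the action of $G$ on $F$. An $A(\infty)$-algebra $(M,\{m_i\})$ is a graded module $M$ with homomorphisms $m_i:\otimes^iM\to M$, $i\ge1$, such that $m_i((\otimes^iM)_q)\subset M_{q+i-2}$ and for all $i\ge1$ $$\sum_{k=0}^{i-1}\sum_{j=1}^{i-k}(-1)^k m_{i-j+1}(\hat a_1\otimes\cdots\otimes\hat a_k\otimes m_j(a_{k+1}\otimes\cdots\otimes a_{k+j})\otimes\cdots\otimes a_i)=0 .$$ A morphism $\{f_i\}:(M,\{m_i\})\to(M',\{m'_i\})$ is a set of homomorphisms $f_i:\otimes^iM\to M'$, $i\ge1$, with $f_i((\otimes^iM)_q)\subset M'_{q+i-1}$ and for all $i\ge1$ $$\sum_{k=0}^{i-1}\sum_{j=1}^{i-k}(-1)^k f_{i-j+1}(\hat a_1\otimes\cdots\otimes\hat a_k\otimes m_j(a_{k+1}\otimes\cdots\otimes a_{k+j})\otimes\cdots\otimes a_i)=\sum_{t=1}^{i}\sum_{S(t,i)}m'_t(f_{k_1}(a_1\otimes\cdots\otimes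 a_{k_1})\otimes\cdots\otimes f_{k_t}(a_{i-k_t+1}\otimes\cdots\otimes a_i)),$$ where $S(t,i)$ is the set of tuples of positive integers $(k_1,\dots,k_t)$ with $\sum k_p=i$. An $A(\infty)$-module $(P,\{p_i\})$ over $(M,\{m_i\})$ is a graded module $P$ with homomorphisms $p_i:(\otimes^{i-1}M)\otimes P\to P$, $i\ge1$, such that $p_i(((\otimes^{i-1}M)\otimes P)_q)\subset P_{q+i-2}$ and for all $i\ge1$ $$\sum_{k=0}^{i-2}\sum_{j=1}^{i-k-1}(-1)^k p_{i-j+1}(\hat a_1\otimes\cdots\otimes\hat a_k\otimes m_j(a_{k+1}\otimes\cdots\otimes a_{k+j})\otimes\cdots\otimes a_{i-1}\otimes b)+\sum_{k=0}^{i-1}(-1)^k p_{k+1}(\hat a_1\otimes\cdots\otimes\hat a_k\otimes p_{i-k}(a_{k+1}\otimes\cdots\otimes a_{i-1}\otimes b))=0 .$$ Objects of the category $M(\infty)$ are pairs $((M,\{m_i\}),(P,\{p_i\}))$ of an $A(\infty)$-algebra and an $A(\infty)$-module over it. A morphism to $((M',\{m'_i\}),(P',\{p'_i\}))$ is a pair $(\{f_i\},\{g_i\})$ where $\{f_i\}$ is a morphism of $A(\infty)$-algebras and $g_i:(\otimes^{i-1}M)\otimes P\to P'$, $i\ge1$, satisfy $g_i(((\otimes^{i-1}M)\otimes P)_q)\subset P'_{q+i-1}$ and for all $i\ge1$ $$\sum_{k=0}^{i-2}\sum_{j=1}^{i-k-1}(-1)^k g_{i-j+1}(\hat a_1\otimes\cdots\otimes\hat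 a_k\otimes m_j(a_{k+1}\otimes\cdots\otimes a_{k+j})\otimes\cdots\otimes a_{i-1}\otimes b)+\sum_{k=0}^{i-1}(-1)^k g_{k+1}(\hat a_1\otimes\cdots\otimes\hat a_k\otimes p_{i-k}(a_{k+1}\otimes\cdots\otimes a_{i-1}\otimes b))$$ $$=\sum_{t=1}^{i}\sum_{S(t,i)}p'_t(f_{k_1}(a_1\otimes\cdots\otimes a_{k_1})\otimes\cdots\otimes f_{k_{t-1}}(a_{k_1+\cdots+k_{t-2}+1}\otimes\cdots\otimes a_{k_1+\cdots+k_{t-1}})\otimes g_{k_t}(a_{i-k_t+1}\otimes\cdots\otimes a_{i-1}\otimes b)).$$ A differential algebra $(C,\partial,\cdot)$ is regarded as the $A(\infty)$-algebra with $m_1=\partial$, $m_2(a_1\otimes a_2)=-\hat a_1\cdot a_2$, $m_i=0$ for $i>2$; a differential module $D$ over $C$ as the $A(\infty)$-module with $p_1=\partial$, $p_2(a\otimes b)=-\hat a\cdot b$, $p_i=0$ for $i>2$. If all $H_i(C)$ are free, the homology $A(\infty)$-algebra of $C$ is an $A(\infty)$-algebra structure $(H(C),\{X_i\})$ with $X_1=0$, $X_2(a_1\otimes a_2)=-\hat a_1\cdot a_2$, together with a morphism of $A(\infty)$-algebras $\{f_i\}:(H(C),\{X_i\})\to C$ such that $f_1$ induces the identity in homology. If also all $H_i(D)$ are free, the corresponding homology $A(\infty)$-module is an $A(\infty)$-module structure $(H(D),\{Y_i\})$ over $(H(C),\{X_i\})$ with $Y_1=0$, $Y_2(a\otimes b)=-\hat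 a\cdot b$, together with $\{g_i\}$ such that $(\{f_i\},\{g_i\}):((H(C),\{X_i\}),(H(D),\{Y_i\}))\to(C,D)$ is a morphism of $M(\infty)$ and $g_1$ induces the identity in homology. For a differential coalgebra $(K,d)$ let $\Delta^1=id_K$, $\Delta^2=\Delta$, $\Delta^i=(id_K\otimes\Delta^{i-1})\Delta$. A $\sim$-twisting cochain from $(K,d)$ to $(M,\{m_i\})$ is a homomorphism $\phi:K\to M$ of degree $-1$ with $\phi d=\sum_{i\ge1}m_i(\phi\otimes\cdots\otimes\phi)\Delta^i$; when $M=C$ is a differential algebra it is called a twisting cochain. Given an $A(\infty)$-module $(P,\{p_i\})$ over $(M,\{m_i\})$, the $\sim$-twisted tensor product $K\otimes_\phi P$ is $K\otimes P$ with the differential $$\partial_\phi=d\otimes id_P+\sum_{i=1}^\infty(\widehat{id}\otimes p_i)(id_K\otimes\phi\otimes\cdots\otimes\phi\otimes id_P)(\Delta^i\otimes id_P)$$ (with $i-1$ factors $\phi$ in the $i$-th term). For differential algebras and modules this is the usual twisted tensor product. For $\alpha,\beta:K\to C$ let $\alpha\cdot\beta$ be the composite of $(\alpha\otimes\beta)\Delta$ with the multiplication of $C$. Twisting cochains $\phi,\psi:K\to C$ are equivalent if there is a homomorphism $c:K\to C$ of degree $0$ with $c|_{K_0}=0$ and $$\psi=(1+\hat c)\cdot\phi\cdot(1+c)^{-1}-(cd+\partial c)\cdot(1+c)^{-1},$$ where $\hat c(k)=\widehat{c(k)}$, $1$ is the (formal) unit for $\cdot$, and $(1+c)^{-1}=\sum_{n\ge0}(-1)^nc^n$.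 A twisting cochain of the fibration $\xi$ is the twisting cochain $\phi:C_*(B)\to C_*(G)$ of E. H. Brown (Twisted tensor products, I, Ann. of Math. 69 (1959)), characterized for the present purpose by the property that, for the associated bundle $\xi[F]$ with total space $E$, the twisted tensor product $C_*(B)\otimes_\phi C_*(F)$ is chain equivalent to $C_*(E)$. *)

(* Defs.v *)
From HB Require Import structures.
From mathcomp Require Import all_boot all_order all_algebra.
From mathcomp Require Import all_classical all_reals all_analysis.
From mathcomp Require Import zify.

Set Implicit Arguments.
Unset Strict Implicit.
Unset Printing Implicit Defensive.

Import Order.TTheory GRing.Theory Num.Theory.
Import numFieldNormedType.Exports.

Local Open Scope classical_set_scope.
Local Open Scope ring_scope.
Local Open Scope quotient_scope.

(* -------------------------------------------------------------------------- *)
(*  The coefficient ring L is not assumed commutative, so the modules are     *)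
(*  L-L-bimodules, homomorphisms are two-sided and (x) is the tensor product  *)
(*  over L of bimodules.  Chains with coefficients in L and their homology    *)
(*  are bimodules; when L is commutative the two actions on them agree, and   *)
(*  one recovers L-modules, L-linear maps and the usual tensor product.       *)
(*                                                                            *)
(*  The grading is internal: [grade n] is the projection onto the submodule   *)
(*  M_n of elements of degree n, and M is the direct sum of the M_n, n >= 0.  *)
(* -------------------------------------------------------------------------- *)

HB.mixin Record Lmodule_isGradedBimodule (L : pzRingType) M
    of GRing.Lmodule L M := {
  rscale : M -> L -> M;
  rscaleDl : forall x y a, rscale (x + y) a = rscale x a + rscale y a;
  rscaleDr : forall x a b, rscale x (a + b) = rscale x a + rscale x b;
  rscaleA : forall x a b, rscale (rscale x a) b = rscale x (a * b);
  rscale1 : forall x, rscale x 1 = x;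
  scale_rscale : forall a x b, a *: rscale x b = rscale (a *: x) b;
  grade : nat -> M -> M;
  gradeD : forall n x y, grade n (x + y) = grade n x + grade n y;
  gradeZ : forall n a x, grade n (a *: x) = a *: grade n x;
  gradeR : forall n x a, grade n (rscale x a) = rscale (grade n x) a;
  grade_grade : forall p q x,
    grade p (grade q x) = if p == q then grade q x else 0;
  grade_sum : forall x, exists N, x = \sum_(n < N) grade n x
}.

#[short(type="gbimodType")]
HB.structure Definition GradedBimodule (L : pzRingType) :=
  { M of GRing.Lmodule L M & Lmodule_isGradedBimodule L M }.

Section Graded.
Variable L : pzRingType.
Implicit Types M N P : gbimodType L.

(* M_z = 0 for z < 0 *)
Definition homog M (z : int) (x : M) : Prop :=
  if z is Posz n then grade n x = x else x = 0.

Definition hat M (x : M) : M :=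
  \sum_(n \in [set: nat]) (-1) ^+ n *: grade n x.

Definition is_hom M N (f : M -> N) : Prop :=
  [/\ forall x y, f (x + y) = f x + f y,
      forall a x, f (a *: x) = a *: f x
    & forall x a, f (rscale x a) = rscale (f x) a].

Definition hom_of_degree M N (r : int) (f : M -> N) : Prop :=
  is_hom f /\ forall (q : nat) x, homog q x -> homog (q%:Z + r) (f x).

Definition graded_iso M N : Prop :=
  exists f : M -> N, hom_of_degree 0 f /\ bijective f.

(* M_i is free as a left L-module. *)
Definition free_in_degree M (i : nat) : Prop :=
  exists b : set M,
    (forall e, b e -> homog i e) /\
    forall x, homog i x ->
      exists! c : M -> L,
        [/\ finite_set (c @^-1` [set~ 0]), c @^-1` [set~ 0] `<=` b
          & x = \sum_(e \in b) c e *: e].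

Definition is_differential M (d : M -> M) : Prop :=
  hom_of_degree (-1) d /\ forall x, d (d x) = 0.

Definition chain_equivalent M (d : M -> M) N (d' : N -> N) : Prop :=
  exists (f : M -> N) (g : N -> M) (s : M -> M) (t : N -> N),
    [/\ hom_of_degree 0 f, hom_of_degree 0 g,
        hom_of_degree 1 s & hom_of_degree 1 t] /\
    [/\ forall x, f (d x) = d' (f x),
        forall y, g (d' y) = d (g y),
        forall x, g (f x) - x = d (s x) + s (d x)
      & forall y, f (g y) - y = d' (t y) + t (d' y)].

End Graded.

Lemma hom0 (L : pzRingType) (M N : gbimodType L) (f : M -> N) :
  is_hom f -> f 0 = 0.
Proof. by case=> fD _ _; apply: (addrI (f 0)); rewrite -fD !addr0. Qed.

Lemma homN (L : pzRingType) (M N : gbimodType L) (f : M -> N) x :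
  is_hom f -> f (- x) = - f x.
Proof.
by move=> hf; apply: (addrI (f x)); case: (hf) => fD _ _;
   rewrite -fD !subrr hom0.
Qed.

Lemma hom_sum (L : pzRingType) (M N : gbimodType L) (f : M -> N) I r
    (P : pred I) (F : I -> M) :
  is_hom f -> f (\sum_(i <- r | P i) F i) = \sum_(i <- r | P i) f (F i).
Proof.
by move=> hf; case: (hf) => fD _ _; apply: big_morph => //; exact: hom0.
Qed.

Lemma grade_hom (L : pzRingType) (M : gbimodType L) n :
  is_hom (@grade L M n).
Proof. by split=> *; rewrite ?gradeD ?gradeZ ?gradeR. Qed.

Lemma rscale0l (L : pzRingType) (M : gbimodType L) (a : L) :
  rscale (0 : M) a = 0.
Proof. by apply: (addrI (rscale (0 : M) a)); rewrite -rscaleDl !addr0. Qed.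

Lemma rscaleNl (L : pzRingType) (M : gbimodType L) (x : M) (a : L) :
  rscale (- x) a = - rscale x a.
Proof. by apply: (addrI (rscale x a)); rewrite -rscaleDl !subrr rscale0l. Qed.

Lemma rscale_suml (L : pzRingType) (M : gbimodType L) I r (P : pred I)
    (F : I -> M) (a : L) :
  rscale (\sum_(i <- r | P i) F i) a = \sum_(i <- r | P i) rscale (F i) a.
Proof.
by apply: (big_morph (fun x => rscale x a)); [move=> x y; exact: rscaleDl
                                             |exact: rscale0l].
Qed.

(* A family of homomorphisms f_i : M^{(x)i} -> N, i >= 1, is encoded by one   *)
(* function on sequences, f_i (a_1 (x) ... (x) a_i) = f [:: a_1; ...; a_i];   *)
(* homomorphisms out of an iterated tensor product over L are the L-balanced  *)
(* multiadditive maps that are left linear in the first and right linear in   *)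
(* the last variable.  The value at [::] is never used.                       *)

Section MultiHom.
Variable L : pzRingType.
Implicit Types M N P : gbimodType L.

Definition homog_seq M (q : seq nat) (s : seq M) : Prop :=
  size q = size s /\
  forall j, (j < size s)%N -> homog (nth 0%N q j) (nth 0 s j).

(* f_i ((M^{(x)i})_q) is contained in N_{q + i + r} *)
Definition multihom M N (r : int) (f : seq M -> N) : Prop :=
  [/\ forall s x y s', f (s ++ (x + y) :: s')
                       = f (s ++ x :: s') + f (s ++ y :: s'),
      forall a x s, f (a *: x :: s) = a *: f (x :: s),
      forall s x a, f (rcons s (rscale x a)) = rscale (f (rcons s x)) a,
      forall s x a y s', f (s ++ rscale x a :: y :: s')
                         = f (s ++ x :: a *: y :: s')
    & forall q s, s <> [::] -> homog_seq q s ->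
        homog ((sumn q)%:Z + (size s)%:Z + r) (f s)].

(* Same for g_i : M^{(x)(i-1)} (x) P -> N, encoded as                         *)
(* g_i (a_1 (x) ... (x) a_(i-1) (x) b) = g [:: a_1; ...; a_(i-1)] b, with     *)
(* g_i of degree i + r.                                                       *)
Definition multihom_mod M P N (r : int) (g : seq M -> P -> N) : Prop :=
  [/\ forall s x y s' b, g (s ++ (x + y) :: s') b
                         = g (s ++ x :: s') b + g (s ++ y :: s') b,
      forall s b b', g s (b + b') = g s b + g s b',
      (forall a x s b, g (a *: x :: s) b = a *: g (x :: s) b) /\
      (forall a b, g [::] (a *: b) = a *: g [::] b),
      forall s b a, g s (rscale b a) = rscale (g s b) a
    & [/\ forall s x a y s' b, g (s ++ rscale x a :: y :: s') b
                               = g (s ++ x :: a *: y :: s') b,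
          forall s x a b, g (rcons s (rscale x a)) b = g (rcons s x) (a *: b)
        & forall q s (n : nat) b, homog_seq q s -> homog n b ->
            homog ((sumn q + n)%:Z + (size s).+1%:Z + r) (g s b)]].

End MultiHom.

Section AInfinity.
Variable L : pzRingType.

(* sum over k, j of
   (-1)^k f_{i-j+1}(^a_1,...,^a_k, m_j(a_{k+1},...,a_{k+j}),...,a_i) *)
Definition insert_sum (M N : gbimodType L) (f : seq M -> N) (m : seq M -> M)
    (s : seq M) : N :=
  \sum_(k < size s) \sum_(1 <= j < (size s - k).+1)
     (-1) ^+ k *: f ([seq hat a | a <- take k s]
                       ++ m (take j (drop k s)) :: drop (k + j) s).

Definition composition t i (k : t.-tuple 'I_i.+1) : bool :=
  all (fun x : 'I_i.+1 => 0 < x)%N k && (sumn [seq val x | x <- k] == i).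

Definition is_Ainf_algebra (M : gbimodType L) (m : seq M -> M) : Prop :=
  multihom (-2) m /\ forall s, s <> [::] -> insert_sum m m s = 0.

Definition is_Ainf_morphism (M M' : gbimodType L) (m : seq M -> M)
    (m' : seq M' -> M') (f : seq M -> M') : Prop :=
  multihom (-1) f /\
  forall s, s <> [::] ->
    insert_sum f m s =
    \sum_(1 <= t < (size s).+1)
      \sum_(k : t.-tuple 'I_(size s).+1 | composition k)
        m' [seq f u | u <- reshape [seq val x | x <- k] s].

(* s = [:: a_1; ...; a_(i-1)] below, so that i = (size s).+1 *)

Definition mod_insert_sum (M P N : gbimodType L) (g : seq M -> P -> N)
    (m : seq M -> M) (p : seq M -> P -> P) (s : seq M) (b : P) : N :=
  insert_sum (fun u => g u b) m s +
  \sum_(k < (size s).+1)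
     (-1) ^+ k *: g [seq hat a | a <- take k s] (p (drop k s) b).

Definition is_Ainf_module (M P : gbimodType L) (m : seq M -> M)
    (p : seq M -> P -> P) : Prop :=
  multihom_mod (-2) p /\ forall s b, mod_insert_sum p m p s b = 0.

(* [(f, g)] is a morphism ((M, m), (P, p)) -> ((M', m'), (P', p')) *)
Definition is_Minf_morphism (M P M' P' : gbimodType L)
    (m : seq M -> M) (p : seq M -> P -> P)
    (m' : seq M' -> M') (p' : seq M' -> P' -> P')
    (f : seq M -> M') (g : seq M -> P -> P') : Prop :=
  [/\ is_Ainf_morphism m m' f,
      multihom_mod (-1) g
    & forall s b,
        mod_insert_sum g m p s b =
        \sum_(1 <= t < (size s).+2)
          \sum_(k : t.-tuple 'I_(size s).+2 | composition k)
            let ks := take t.-1 [seq val x | x <- k] in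
            p' [seq f u | u <- reshape ks s] (g (drop (sumn ks) s) b)].

Definition alg_Ainf (C : gbimodType L) (d : C -> C) (mul : C -> C -> C)
    (s : seq C) : C :=
  match s with
  | [:: a] => d a
  | [:: a; b] => - mul (hat a) b
  | _ => 0
  end.

Definition mod_Ainf (C D : gbimodType L) (d : D -> D) (act : C -> D -> D)
    (s : seq C) (b : D) : D :=
  match s with
  | [::] => d b
  | [:: a] => - act (hat a) b
  | _ => 0
  end.

End AInfinity.

(* -------------------------------------------------------------------------- *)
(*  Tensor product over L.  A formal sum of pairs (x, y) represents           *)
(*  sum x (x) y; two formal sums represent the same tensor iff every          *)
(*  L-balanced biadditive map into an abelian group takes the same value on   *)
(*  them.                                                                     *)
(* -------------------------------------------------------------------------- *)

Section TensorDef.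
Variables (L : pzRingType) (M N : gbimodType L).

Definition balanced (Z : zmodType) (b : M -> N -> Z) : Prop :=
  [/\ forall x x' y, b (x + x') y = b x y + b x' y,
      forall x y y', b x (y + y') = b x y + b x y'
    & forall x a y, b (rscale x a) y = b x (a *: y)].

Definition fsum (Z : zmodType) (b : M -> N -> Z) (s : seq (M * N)) : Z :=
  \sum_(u <- s) b u.1 u.2.

Definition same_tensor (s t : seq (M * N)) : bool :=
  `[< forall (Z : zmodType) (b : M -> N -> Z),
        balanced b -> fsum b s = fsum b t >].

Lemma same_tensor_equiv : equiv_class_of same_tensor.
Proof.
split=> [s|s t|t s u].
- exact/asboolP.
- by apply/asboolP/asboolP => st Z b bb; rewrite st.
- move=> /asboolP st /asboolP tu; apply/asboolP => Z b bb.
  by rewrite st // tu.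
Qed.

Definition same_tensor_rel := EquivRelPack same_tensor_equiv.

Definition tensor : Type := {eq_quot same_tensor_rel}.
HB.instance Definition _ := Choice.on tensor.
HB.instance Definition _ := EqQuotient.on tensor.

Definition tlift (Z : zmodType) (b : M -> N -> Z) (t : tensor) : Z :=
  fsum b (repr t).

Definition tens (x : M) (y : N) : tensor := \pi_tensor [:: (x, y)].

Lemma tlift_pi (Z : zmodType) (b : M -> N -> Z) s :
  balanced b -> tlift b (\pi_tensor s) = fsum b s.
Proof.
move=> bb; rewrite /tlift; have := reprK (\pi_tensor s).
by move/eqquotP => /= /asboolP ->.
Qed.

Lemma pi_eq s t :
  (forall (Z : zmodType) (b : M -> N -> Z), balanced b ->
     fsum b s = fsum b t) -> \pi_tensor s = \pi_tensor t :> tensor.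
Proof. by move=> st; apply/eqquotP/asboolP. Qed.

Definition tadd (t u : tensor) : tensor := \pi_tensor (repr t ++ repr u).
Definition topp (t : tensor) : tensor :=
  \pi_tensor [seq (- u.1, u.2) | u <- repr t].

Lemma fsum_cat (Z : zmodType) (b : M -> N -> Z) s t :
  fsum b (s ++ t) = fsum b s + fsum b t.
Proof. by rewrite /fsum big_cat. Qed.

Lemma fsum_opp (Z : zmodType) (b : M -> N -> Z) s : balanced b ->
  fsum b [seq (- u.1, u.2) | u <- s] = - fsum b s.
Proof.
case=> bD _ _; rewrite /fsum big_map -sumrN; apply: eq_bigr => -[x y] _ /=.
have b0 : b 0 y = 0 by apply: (addrI (b 0 y)); rewrite -bD !addr0.
by apply: (addrI (b x y)); rewrite -bD !subrr.
Qed.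

Lemma fsum_repr_pi (Z : zmodType) (b : M -> N -> Z) s : balanced b ->
  fsum b (repr (\pi_tensor s)) = fsum b s.
Proof. exact: tlift_pi. Qed.

Lemma taddA : associative tadd.
Proof.
move=> t u v; apply: pi_eq => Z b bb.
by rewrite !fsum_cat !fsum_repr_pi // !fsum_cat addrA.
Qed.
Lemma taddC : commutative tadd.
Proof. by move=> t u; apply: pi_eq => Z b bb; rewrite !fsum_cat addrC. Qed.
Lemma tadd0 : left_id (\pi_tensor [::] : tensor) tadd.
Proof.
move=> t; rewrite -[RHS]reprK; apply: pi_eq => Z b bb.
by rewrite fsum_cat fsum_repr_pi // [X in X + _]big_nil add0r.
Qed.
Lemma taddN : left_inverse (\pi_tensor [::] : tensor) topp tadd.
Proof.
move=> t; apply: pi_eq => Z b bb.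
by rewrite fsum_cat fsum_repr_pi // fsum_opp // addNr [RHS]big_nil.
Qed.

HB.instance Definition _ := GRing.isZmodule.Build tensor taddA taddC tadd0 taddN.

Lemma tliftD (Z : zmodType) (b : M -> N -> Z) t u : balanced b ->
  tlift b (t + u) = tlift b t + tlift b u.
Proof. by move=> bb; rewrite [LHS]tlift_pi // fsum_cat. Qed.

Lemma tlift0 (Z : zmodType) (b : M -> N -> Z) : balanced b -> tlift b 0 = 0.
Proof. by move=> bb; rewrite [LHS]tlift_pi // [LHS]big_nil. Qed.

Lemma tlift_sum (Z : zmodType) (b : M -> N -> Z) I r (P : pred I)
    (F : I -> tensor) : balanced b ->
  tlift b (\sum_(i <- r | P i) F i) = \sum_(i <- r | P i) tlift b (F i).
Proof.
by move=> bb; apply: big_morph => [t u|]; [exact: tliftD | exact: tlift0].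
Qed.

Lemma tlift_tens (Z : zmodType) (b : M -> N -> Z) x y : balanced b ->
  tlift b (tens x y) = b x y.
Proof. by move=> bb; rewrite tlift_pi // /fsum big_seq1. Qed.

Lemma tens_balanced : balanced tens.
Proof.
split=> [x x' y|x y y'|x a y]; apply: pi_eq => Z b bb; case: (bb) => b1 b2 b3.
- by rewrite fsum_cat !fsum_repr_pi // /fsum !big_seq1 b1.
- by rewrite fsum_cat !fsum_repr_pi // /fsum !big_seq1 b2.
- by rewrite /fsum !big_seq1 b3.
Qed.

Lemma tensorE (t : tensor) : t = \sum_(u <- repr t) tens u.1 u.2.
Proof.
rewrite -[LHS]reprK; elim: (repr t) => [|[x y] s IH]; first by rewrite big_nil.
rewrite big_cons -IH; apply: pi_eq => Z b bb.
by rewrite fsum_cat !fsum_repr_pi // -fsum_cat.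
Qed.

Lemma tensor_ext (Z : zmodType) (f g : tensor -> Z) :
  {morph f : t u / t + u} -> {morph g : t u / t + u} ->
  (forall x y, f (tens x y) = g (tens x y)) -> f =1 g.
Proof.
move=> fD gD fg t.
have f0 : f 0 = 0 by apply: (addrI (f 0)); rewrite -fD !addr0.
have g0 : g 0 = 0 by apply: (addrI (g 0)); rewrite -gD !addr0.
rewrite (tensorE t) (big_morph f fD f0) (big_morph g gD g0).
exact: eq_bigr.
Qed.

Definition tscale (a : L) (t : tensor) : tensor :=
  tlift (fun x y => tens (a *: x) y) t.
Definition trscale (t : tensor) (a : L) : tensor :=
  tlift (fun x y => tens x (rscale y a)) t.
Definition tgrade (n : nat) (t : tensor) : tensor :=
  tlift (fun x y => \sum_(p < n.+1) tens (grade p x) (grade (n - p) y)) t.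

Lemma tscale_balanced a : balanced (fun x y => tens (a *: x) y).
Proof.
case: tens_balanced => b1 b2 b3.
by split=> *; rewrite ?scalerDr ?b1 ?b2 ?scale_rscale ?b3.
Qed.
Lemma trscale_balanced a : balanced (fun x y => tens x (rscale y a)).
Proof.
case: tens_balanced => b1 b2 b3.
by split=> *; rewrite ?rscaleDl ?b1 ?b2 -?scale_rscale ?b3.
Qed.
Lemma tgrade_balanced n :
  balanced (fun x y => \sum_(p < n.+1) tens (grade p x) (grade (n - p) y)).
Proof.
case: tens_balanced => b1 b2 b3.
split=> *; rewrite -?big_split /=; apply: eq_bigr => p _.
- by rewrite gradeD b1.
- by rewrite gradeD b2.
- by rewrite gradeR gradeZ b3.
Qed.

Lemma tens0l y : tens 0 y = 0.
Proof.
case: tens_balanced => b1 _ _.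
by apply: (addrI (tens 0 y)); rewrite -b1 !addr0.
Qed.
Lemma tens0r x : tens x 0 = 0.
Proof.
case: tens_balanced => _ b2 _.
by apply: (addrI (tens x 0)); rewrite -b2 !addr0.
Qed.

Lemma tens_suml I r (P : pred I) (F : I -> M) y :
  tens (\sum_(i <- r | P i) F i) y = \sum_(i <- r | P i) tens (F i) y.
Proof.
case: tens_balanced => b1 _ _.
by apply: (big_morph (fun x => tens x y)) => [x x'|]; [exact: b1 | exact: tens0l].
Qed.
Lemma tens_sumr I r (P : pred I) (F : I -> N) x :
  tens x (\sum_(i <- r | P i) F i) = \sum_(i <- r | P i) tens x (F i).
Proof.
case: tens_balanced => _ b2 _.
by apply: big_morph => [y y'|]; [exact: b2 | exact: tens0r].
Qed.

Lemma tscaleD a : {morph tscale a : t u / t + u}.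
Proof. by move=> t u; apply: tliftD (tscale_balanced a). Qed.
Lemma trscaleD a : {morph trscale^~ a : t u / t + u}.
Proof. by move=> t u; apply: tliftD (trscale_balanced a). Qed.
Lemma tgradeD n : {morph tgrade n : t u / t + u}.
Proof. by move=> t u; apply: tliftD (tgrade_balanced n). Qed.
Lemma tscale_tens a x y : tscale a (tens x y) = tens (a *: x) y.
Proof. exact: tlift_tens (tscale_balanced a). Qed.
Lemma trscale_tens a x y : trscale (tens x y) a = tens x (rscale y a).
Proof. exact: tlift_tens (trscale_balanced a). Qed.
Lemma tgrade_tens n x y :
  tgrade n (tens x y) = \sum_(p < n.+1) tens (grade p x) (grade (n - p) y).
Proof. exact: tlift_tens (tgrade_balanced n). Qed.

Lemma tscaleA a b t : tscale a (tscale b t) = tscale (a * b) t.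
Proof.
move: t; apply: tensor_ext => [t u|t u|x y]; rewrite ?tscaleD //.
by rewrite !tscale_tens scalerA.
Qed.
Lemma tscale1 : left_id 1 tscale.
Proof.
by apply: tensor_ext => [t u|//|x y]; rewrite ?tscaleD // tscale_tens scale1r.
Qed.
Lemma tscaleDr : right_distributive tscale +%R.
Proof. exact: tscaleD. Qed.
Lemma tscaleDl t : {morph tscale^~ t : a b / a + b}.
Proof.
move=> a b; move: t.
apply: (@tensor_ext _ (tscale (a + b)) (fun t => tscale a t + tscale b t)).
- exact: tscaleD.
- by move=> t u /=; rewrite !tscaleD addrACA.
- by move=> x y; rewrite !tscale_tens scalerDl; case: tens_balanced.
Qed.

HB.instance Definition _ := GRing.Zmodule_isLmodule.Build L tensor
  tscaleA tscale1 tscaleDr tscaleDl.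

Lemma trscaleDl t u a : trscale (t + u) a = trscale t a + trscale u a.
Proof. exact: trscaleD. Qed.
Lemma trscaleDr t a b : trscale t (a + b) = trscale t a + trscale t b.
Proof.
move: t.
apply: (@tensor_ext _ (trscale^~ (a + b)) (fun t => trscale t a + trscale t b)).
- exact: trscaleD.
- by move=> t u /=; rewrite !trscaleDl addrACA.
- by move=> x y; rewrite !trscale_tens rscaleDr; case: tens_balanced.
Qed.
Lemma trscaleA t a b : trscale (trscale t a) b = trscale t (a * b).
Proof.
move: t; apply: tensor_ext => [t u|t u|x y]; rewrite ?trscaleDl //.
by rewrite !trscale_tens rscaleA.
Qed.
Lemma trscale1 t : trscale t 1 = t.
Proof.
move: t; apply: tensor_ext => [t u|//|x y]; rewrite ?trscaleDl //.
by rewrite trscale_tens rscale1.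
Qed.
Lemma tscale_trscale a t b : a *: trscale t b = trscale (a *: t) b.
Proof.
move: t; apply: tensor_ext => [t u|t u|x y].
- by rewrite trscaleDl scalerDr.
- by rewrite scalerDr trscaleDl.
- rewrite trscale_tens [LHS]tscale_tens.
  by rewrite [a *: tens x y]tscale_tens trscale_tens.
Qed.
Lemma tgradeZ n a t : tgrade n (a *: t) = a *: tgrade n t.
Proof.
move: t; apply: tensor_ext => [t u|t u|x y].
- by rewrite scalerDr tgradeD.
- by rewrite tgradeD scalerDr.
- rewrite [a *: tens _ _]tscale_tens !tgrade_tens scaler_sumr.
  by apply: eq_bigr => p _; rewrite [RHS]tscale_tens gradeZ.
Qed.
Lemma trscale_sum I r (P : pred I) (F : I -> tensor) a :
  trscale (\sum_(i <- r | P i) F i) a = \sum_(i <- r | P i) trscale (F i) a.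
Proof. exact: tlift_sum (trscale_balanced a). Qed.
Lemma tgradeR n t a : tgrade n (trscale t a) = trscale (tgrade n t) a.
Proof.
move: t; apply: tensor_ext => [t u|t u|x y].
- by rewrite trscaleDl tgradeD.
- by rewrite tgradeD trscaleDl.
- rewrite trscale_tens !tgrade_tens trscale_sum.
  by apply: eq_bigr => p _; rewrite trscale_tens gradeR.
Qed.
Lemma tgrade_sum n I r (P : pred I) (F : I -> tensor) :
  tgrade n (\sum_(i <- r | P i) F i) = \sum_(i <- r | P i) tgrade n (F i).
Proof. exact: tlift_sum (tgrade_balanced n). Qed.
Lemma tgrade_tgrade n m t :
  tgrade n (tgrade m t) = if n == m then tgrade m t else 0.
Proof.
move: t; apply: tensor_ext => [t u|t u|x y].
- by rewrite !tgradeD.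
- by rewrite tgradeD; case: eqP; rewrite ?addr0.
rewrite tgrade_tens tgrade_sum.
have E (q : 'I_m.+1) : tgrade n (tens (grade q x) (grade (m - q) y)) =
    if n == m then tens (grade q x) (grade (m - q) y) else 0.
  have qm : (q <= m)%N by rewrite -ltnS.
  rewrite tgrade_tens.
  have [qn|nq] := leqP q n; last first.
    rewrite big1 => [|p _]; last first.
      rewrite !grade_grade; case: eqP => [pq|_]; last by rewrite tens0l.
      by have := ltn_ord p; rewrite ltnS pq leqNgt nq.
    by case: eqP nq qm => // ->; rewrite ltnNge => /negP.
  rewrite (bigD1 (Ordinal (qn : (q < n.+1)%N))) //= big1 ?addr0.
    rewrite !grade_grade eqxx; have [->|nm] := eqVneq n m; first by rewrite eqxx.
    case: eqP => [e|_]; last by rewrite tens0r.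
    by case/eqP: nm; rewrite -[LHS](subnK qn) -[RHS](subnK qm) e.
  move=> p pq; rewrite !grade_grade; case: eqP => [e|_]; last by rewrite tens0l.
  by move: pq; rewrite -val_eqE /= e eqxx.
rewrite (eq_bigr _ (fun q _ => E q)); case: eqP => // _.
by rewrite big1.
Qed.
Lemma tgrade_total t : exists K, t = \sum_(n < K) tgrade n t.
Proof.
suff [K HK] : exists K, forall K', (K <= K')%N -> t = \sum_(n < K') tgrade n t.
  by exists K; exact: HK.
rewrite [t]tensorE; elim: (repr t) => [|[x y] s [K HK]].
  exists 0%N => K' _; rewrite big_nil big1 // => n _.
  exact: tlift0 (tgrade_balanced n).
have [A xA] := grade_sum x; have [B yB] := grade_sum y.
have gx p : (A <= p)%N -> grade p x = 0.
  move=> Ap; rewrite xA (hom_sum _ _ _ (grade_hom _ p)) big1 // => q _.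
  rewrite grade_grade; case: eqP => // e.
  by have := ltn_ord q; rewrite -e ltnNge Ap.
have gy p : (B <= p)%N -> grade p y = 0.
  move=> Ap; rewrite yB (hom_sum _ _ _ (grade_hom _ p)) big1 // => q _.
  rewrite grade_grade; case: eqP => // e.
  by have := ltn_ord q; rewrite -e ltnNge Ap.
exists (maxn K (A + B)) => K'; rewrite geq_max => /andP[KK' ABK'].
rewrite big_cons /= {1}(HK _ KK').
under [RHS]eq_bigr do rewrite tgradeD.
rewrite big_split /=; congr (_ + _).
under eq_bigr do rewrite tgrade_tens.
have xK : x = \sum_(p < K') grade p x.
  rewrite {1}xA (@big_ord_widen _ _ _ A K' (fun p => grade p x)) ?(leq_trans (leq_addr B A)) //.
  rewrite big_mkcond /=; apply: eq_bigr => p _.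
  by case: ltnP => // /gx ->.
have yK k : (B <= k)%N -> y = \sum_(q < k) grade q y.
  move=> Bk; rewrite {1}yB (@big_ord_widen _ _ _ B k (fun p => grade p y)) // big_mkcond /=.
  by apply: eq_bigr => p _; case: ltnP => // /gy ->.
rewrite {1}xK tens_suml.
under [RHS]eq_bigr => n _.
  rewrite (@big_ord_widen _ _ _ n.+1 K' (fun p => tens (grade p x) (grade (n - p) y))) //.
  rewrite big_mkcond /=; over.
rewrite exchange_big /=; apply: eq_bigr => p _.
rewrite -big_mkcond /=.
have [Ap|pA] := leqP A p.
  rewrite (gx _ Ap) tens0l big1 // => n _; by rewrite tens0l.
rewrite [y in tens _ y](yK (K' - p)%N); last first.
  by rewrite leq_subRL ?(ltnW (ltn_ord p)) // (leq_trans _ ABK') // leq_add2r ltnW.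
rewrite tens_sumr.
rewrite -(big_mkord xpredT (fun q => tens (grade p x) (grade q y))).
rewrite -(big_mkord (fun n => p < n.+1)%N (fun n => tens (grade p x) (grade (n - p) y))).
rewrite [RHS](big_cat_nat (n := p)) //= ?(ltnW (ltn_ord p)) //.
rewrite [X in _ = X + _]big_nat_cond [X in _ = X + _]big1 ?add0r; last first.
  by move=> n /andP[/andP[_ np]]; rewrite ltnS leqNgt np.
rewrite -[X in _ = \sum_(X <= _ < _ | _) _]add0n big_addn.
apply: eq_big => [n|n _]; first by rewrite ltnS leq_addl.
by rewrite addnK.
Qed.

HB.instance Definition _ := Lmodule_isGradedBimodule.Build L tensor
  trscaleDl trscaleDr trscaleA trscale1 tscale_trscale
  tgradeD tgradeZ tgradeR tgrade_tgrade tgrade_total.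

End TensorDef.


Record complex (L : pzRingType) := Complex {
  cx_mod :> gbimodType L;
  cx_d : cx_mod -> cx_mod;
  cx_dP : is_differential cx_d
}.

Section Homology.
Variables (L : pzRingType) (C : complex L).
Local Notation d := (@cx_d L C).

Lemma cx_d_hom : is_hom d. Proof. by case: (cx_dP C) => -[]. Qed.
Lemma cx_dd x : d (d x) = 0. Proof. by case: (cx_dP C). Qed.

Lemma grade0_d x : d (grade 0 x) = 0.
Proof.
case: (cx_dP C) => -[_ hd] _.
by apply: (hd 0%N); rewrite /homog grade_grade eqxx.
Qed.

Lemma grade_d n x : grade n (d x) = d (grade n.+1 x).
Proof.
have gd q y : grade n (d (grade q y)) = if q == n.+1 then d (grade q y) else 0.
  case: q => [|q]; first by rewrite grade0_d (hom0 (grade_hom C n)).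
  case: (cx_dP C) => -[_ hd] _.
  have : homog (q.+1%:Z + -1) (d (grade q.+1 y)).
    by apply: hd; rewrite /homog grade_grade eqxx.
  rewrite -addn1 PoszD addrK /= => e.
  by rewrite -{1}e grade_grade e addn1 eqSS eq_sym.
have [N xN] := grade_sum x.
rewrite {1}xN (hom_sum _ _ _ cx_d_hom) (hom_sum _ _ _ (grade_hom C n)).
under eq_bigr do rewrite gd.
rewrite [in RHS]xN (hom_sum _ _ _ (grade_hom C n.+1)) (hom_sum _ _ _ cx_d_hom).
apply: eq_bigr => q _; rewrite grade_grade eq_sym; case: eqP => //.
by rewrite (hom0 cx_d_hom).
Qed.

Definition cx_cycle : Type := {x : C | d x == 0}.
HB.instance Definition _ := SubChoice.on cx_cycle.

Definition homologous (z w : cx_cycle) : bool :=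
  `[< exists c, val z - val w = d c >].

Lemma homologous_equiv : equiv_class_of homologous.
Proof.
case: (cx_d_hom) => dD _ _; split=> [z|z w|w z v].
- by apply/asboolP; exists 0; rewrite subrr (hom0 cx_d_hom).
- by apply/asboolP/asboolP => -[c e]; exists (- c);
    rewrite (homN _ cx_d_hom) -e opprB.
- move=> /asboolP[c e] /asboolP[c' e']; apply/asboolP; exists (c + c').
  by rewrite dD -e -e' addrA subrK.
Qed.

Definition homologous_rel := EquivRelPack homologous_equiv.

Definition homology : Type := {eq_quot homologous_rel}.
HB.instance Definition _ := Choice.on homology.
HB.instance Definition _ := EqQuotient.on homology.

Lemma cx_cycle0P : d 0 == 0. Proof. by rewrite (hom0 cx_d_hom). Qed.
Definition cx_cycle0 : cx_cycle := exist _ 0 cx_cycle0P.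

(* The class of a cycle x; junk if x is not a cycle. *)
Definition hclass (x : C) : homology :=
  \pi_homology (insubd cx_cycle0 x).
Definition hrep (h : homology) : C := val (repr h).

Lemma d_hrep h : d (hrep h) = 0. Proof. exact/eqP/(valP (repr h)). Qed.

Lemma hrepK : cancel hrep hclass.
Proof. by move=> h; rewrite /hclass /hrep valKd reprK. Qed.

Lemma hclass_eqP x y : d x = 0 -> d y = 0 ->
  hclass x = hclass y <-> exists c, x - y = d c.
Proof.
move=> /eqP x0 /eqP y0.
have e u : d u == 0 -> val (insubd cx_cycle0 u) = u.
  by move=> u0; rewrite val_insubd u0.
split=> [/eqquotP /asboolP|[c exy]]; rewrite ?e //.
by apply/eqquotP/asboolP; exists c; rewrite !e.
Qed.

Lemma hrep_hclass x : d x = 0 -> exists c, hrep (hclass x) = x + d c.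
Proof.
move=> x0; have /hclass_eqP[] // := hrepK (hclass x); first exact: d_hrep.
by move=> c e; exists c; rewrite -e addrC subrK.
Qed.

Definition hadd (h k : homology) := hclass (hrep h + hrep k).
Definition hmap (T : C -> C) (h : homology) := hclass (T (hrep h)).

Lemma haddE x y : d x = 0 -> d y = 0 ->
  hadd (hclass x) (hclass y) = hclass (x + y).
Proof.
case: (cx_d_hom) => dD _ _ x0 y0.
have [a ea] := hrep_hclass x0; have [b eb] := hrep_hclass y0.
apply/hclass_eqP; rewrite ?dD ?d_hrep ?x0 ?y0 ?addr0 //.
by exists (a + b); rewrite ea eb dD addrACA [LHS]addrC addKr.
Qed.

Lemma hmapE (T : C -> C) x :
    {morph T : x y / x + y} -> (forall x, d x = 0 -> d (T x) = 0) ->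
    (forall c, exists c', T (d c) = d c') -> d x = 0 ->
  hmap T (hclass x) = hclass (T x).
Proof.
move=> TD Tz Tb x0; have [a ea] := hrep_hclass x0; have [b eb] := Tb a.
apply/hclass_eqP; rewrite ?Tz ?d_hrep //.
by exists b; rewrite ea TD eb [LHS]addrC addKr.
Qed.

Lemma homology_ind (P : homology -> Prop) :
  (forall x, d x = 0 -> P (hclass x)) -> forall h, P h.
Proof. by move=> Px h; rewrite -[h]hrepK; apply: Px; exact: d_hrep. Qed.

Lemma cx_d0 : d 0 = 0. Proof. exact: hom0 cx_d_hom. Qed.
Lemma cx_dD0 x y : d x = 0 -> d y = 0 -> d (x + y) = 0.
Proof. by case: cx_d_hom => dD _ _ x0 y0; rewrite dD x0 y0 addr0. Qed.

Lemma hoppE x : d x = 0 -> hmap -%R (hclass x) = hclass (- x).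
Proof.
apply: hmapE => [y z|y y0|c]; first exact: opprD.
- by rewrite (homN _ cx_d_hom) y0 oppr0.
- by exists (- c); rewrite (homN _ cx_d_hom).
Qed.

Lemma haddA : associative hadd.
Proof.
elim/homology_ind=> x x0; elim/homology_ind=> y y0; elim/homology_ind=> z z0.
by rewrite !haddE ?cx_dD0 // addrA.
Qed.
Lemma haddC : commutative hadd.
Proof. by move=> h k; rewrite /hadd addrC. Qed.
Lemma hadd0 : left_id (hclass 0) hadd.
Proof. by elim/homology_ind=> x x0; rewrite haddE ?cx_d0 // add0r. Qed.
Lemma haddN : left_inverse (hclass 0) (hmap -%R) hadd.
Proof.
elim/homology_ind=> x x0; rewrite hoppE // haddE ?addNr //.
by rewrite (homN _ cx_d_hom) x0 oppr0.
Qed.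

HB.instance Definition _ :=
  GRing.isZmodule.Build homology haddA haddC hadd0 haddN.

Lemma hclassD x y : d x = 0 -> d y = 0 ->
  hclass (x + y) = hclass x + hclass y.
Proof. by move=> x0 y0; rewrite -haddE. Qed.

Lemma hclass_sum n (F : nat -> C) : (forall i, d (F i) = 0) ->
  hclass (\sum_(i < n) F i) = \sum_(i < n) hclass (F i).
Proof.
move=> F0; suff [] : d (\sum_(i < n) F i) = 0 /\
    hclass (\sum_(i < n) F i) = \sum_(i < n) hclass (F i) by [].
elim: n => [|n [IH1 IH2]]; first by rewrite !big_ord0 cx_d0.
by rewrite !big_ord_recr /= hclassD // IH2 cx_dD0.
Qed.

Definition hscale (a : L) := hmap ( *:%R a).
Definition hrscale (h : homology) (a : L) := hmap (fun x => rscale x a) h.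
Definition hgrade (n : nat) := hmap (@grade L C n).

Lemma cx_dZ0 a x : d x = 0 -> d (a *: x) = 0.
Proof. by case: cx_d_hom => _ dZ _ x0; rewrite dZ x0 scaler0. Qed.
Lemma cx_dR0 a x : d x = 0 -> d (rscale x a) = 0.
Proof. by case: cx_d_hom => _ _ dR x0; rewrite dR x0 rscale0l. Qed.
Lemma cx_dG0 n x : d x = 0 -> d (grade n x) = 0.
Proof.
move=> x0; case: n => [|n]; first exact: grade0_d.
by rewrite -grade_d x0 (hom0 (grade_hom C n)).
Qed.

Lemma hscaleE a x : d x = 0 -> hscale a (hclass x) = hclass (a *: x).
Proof.
apply: hmapE => [y z|y|c]; [exact: scalerDr | exact: cx_dZ0 |].
by exists (a *: c); case: cx_d_hom => _ ->.
Qed.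
Lemma hrscaleE a x : d x = 0 -> hrscale (hclass x) a = hclass (rscale x a).
Proof.
apply: (@hmapE (fun x => rscale x a)) => [y z|y|c].
- exact: rscaleDl.
- exact: cx_dR0.
- by exists (rscale c a); case: cx_d_hom => _ _ ->.
Qed.
Lemma hgradeE n x : d x = 0 -> hgrade n (hclass x) = hclass (grade n x).
Proof.
apply: hmapE => [y z|y|c]; [exact: gradeD | exact: cx_dG0 |].
by exists (grade n.+1 c); rewrite grade_d.
Qed.

Lemma hscaleA a b h : hscale a (hscale b h) = hscale (a * b) h.
Proof.
by elim/homology_ind: h => x x0; rewrite !hscaleE ?cx_dZ0 // scalerA.
Qed.
Lemma hscale1 : left_id 1 hscale.
Proof. by elim/homology_ind=> x x0; rewrite hscaleE // scale1r. Qed.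
Lemma hscaleDr : right_distributive hscale +%R.
Proof.
move=> a; elim/homology_ind=> x x0; elim/homology_ind=> y y0.
by rewrite -hclassD // !hscaleE ?cx_dD0 // scalerDr hclassD ?cx_dZ0.
Qed.
Lemma hscaleDl h : {morph hscale^~ h : a b / a + b}.
Proof.
elim/homology_ind: h => x x0 a b.
by rewrite /= !hscaleE // scalerDl hclassD ?cx_dZ0.
Qed.

HB.instance Definition _ := GRing.Zmodule_isLmodule.Build L homology
  hscaleA hscale1 hscaleDr hscaleDl.

Lemma hclassZ a x : d x = 0 -> hclass (a *: x) = a *: hclass x.
Proof. by move=> x0; rewrite -hscaleE. Qed.

Lemma hrscaleDl h k a : hrscale (h + k) a = hrscale h a + hrscale k a.
Proof.
elim/homology_ind: h => x x0; elim/homology_ind: k => y y0.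
by rewrite -hclassD // !hrscaleE ?cx_dD0 // rscaleDl hclassD ?cx_dR0.
Qed.
Lemma hrscaleDr h a b : hrscale h (a + b) = hrscale h a + hrscale h b.
Proof.
by elim/homology_ind: h => x x0; rewrite !hrscaleE // rscaleDr hclassD ?cx_dR0.
Qed.
Lemma hrscaleA h a b : hrscale (hrscale h a) b = hrscale h (a * b).
Proof.
by elim/homology_ind: h => x x0; rewrite !hrscaleE ?cx_dR0 // rscaleA.
Qed.
Lemma hrscale1 h : hrscale h 1 = h.
Proof. by elim/homology_ind: h => x x0; rewrite hrscaleE // rscale1. Qed.
Lemma hscale_hrscale a h b : a *: hrscale h b = hrscale (a *: h) b.
Proof.
elim/homology_ind: h => x x0.
by rewrite hrscaleE // -!hclassZ ?cx_dR0 // hrscaleE ?cx_dZ0 // scale_rscale.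
Qed.
Lemma hgradeD n h k : hgrade n (h + k) = hgrade n h + hgrade n k.
Proof.
elim/homology_ind: h => x x0; elim/homology_ind: k => y y0.
by rewrite -hclassD // !hgradeE ?cx_dD0 // gradeD hclassD ?cx_dG0.
Qed.
Lemma hgradeZ n a h : hgrade n (a *: h) = a *: hgrade n h.
Proof.
elim/homology_ind: h => x x0.
by rewrite hgradeE // -!hclassZ ?cx_dG0 // hgradeE ?cx_dZ0 // gradeZ.
Qed.
Lemma hgradeR n h a : hgrade n (hrscale h a) = hrscale (hgrade n h) a.
Proof.
elim/homology_ind: h => x x0.
by rewrite hrscaleE // !hgradeE ?cx_dR0 // hrscaleE ?cx_dG0 // gradeR.
Qed.
Lemma hgrade_hgrade p q h :
  hgrade p (hgrade q h) = if p == q then hgrade q h else 0.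
Proof.
elim/homology_ind: h => x x0.
by rewrite !hgradeE ?cx_dG0 // grade_grade; case: eqP.
Qed.
Lemma hgrade_total h : exists N, h = \sum_(n < N) hgrade n h.
Proof.
elim/homology_ind: h => x x0; have [N xN] := grade_sum x; exists N.
under eq_bigr do rewrite hgradeE //.
by rewrite -(hclass_sum N (fun i => cx_dG0 i x0)) -xN.
Qed.

HB.instance Definition _ := Lmodule_isGradedBimodule.Build L homology
  hrscaleDl hrscaleDr hrscaleA hrscale1 hscale_hrscale
  hgradeD hgradeZ hgradeR hgrade_hgrade hgrade_total.

End Homology.

(* The operation induced in homology by a pairing of complexes. *)
Definition hpair (L : pzRingType) (C D E : complex L) (op : C -> D -> E)
    (h : homology C) (k : homology D) : homology E :=
  hclass (op (hrep h) (hrep k)).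

(* -------------------------------------------------------------------------- *)
(*  Finitely supported L-valued functions on a graded set S = (S n)_n.        *)
(* -------------------------------------------------------------------------- *)

Section Free.
Variables (L : pzRingType) (S : nat -> choiceType).
Local Notation T := {n : nat & S n}.

Definition fin_supp (c : T -> L^o) : bool :=
  `[< finite_set (c @^-1` [set~ 0]) >].

Lemma fin_supp_submod : submod_closed fin_supp.
Proof.
split=> [|a c c' /asboolP fc /asboolP fc']; apply/asboolP.
  by rewrite (_ : _ @^-1` _ = set0) //; apply/seteqP; split=> s //= [].
apply: (@sub_finite_set _ _ ((c @^-1` [set~ 0]) `|` (c' @^-1` [set~ 0]))).
  move=> s /= cs; have [c0|] := pselect (c s = 0); last by left.
  right=> c0'; apply: cs; rewrite /= [LHS](_ : _ = a *: c s + c' s) //.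
  by rewrite c0 c0' scaler0 addr0.
by rewrite finite_setU.
Qed.

HB.instance Definition _ :=
  GRing.isSubmodClosed.Build L (T -> L^o) fin_supp fin_supp_submod.

Definition freemod : Type := {c : T -> L^o | fin_supp c}.
HB.instance Definition _ := SubChoice.on freemod.
HB.instance Definition _ := [SubChoice_isSubZmodule of freemod by <:].
HB.instance Definition _ := [SubZmodule_isSubLmodule of freemod by <:].

Definition fcoef (c : freemod) (s : T) : L := val c s.

Lemma freemod_ext (c c' : freemod) : fcoef c =1 fcoef c' -> c = c'.
Proof. by move=> e; apply: val_inj; apply: funext. Qed.

Lemma fcoefD c c' s : fcoef (c + c') s = fcoef c s + fcoef c' s.
Proof. by []. Qed.
Lemma fcoefZ a c s : fcoef (a *: c) s = a * fcoef c s.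
Proof. by []. Qed.
Lemma fcoef0 s : fcoef 0 s = 0.
Proof. by []. Qed.
Lemma fcoef_sum I r (P : pred I) (F : I -> freemod) s :
  fcoef (\sum_(i <- r | P i) F i) s = \sum_(i <- r | P i) fcoef (F i) s.
Proof.
by apply: (big_morph (fun c => fcoef c s)).
Qed.

Lemma fcoef_fin c : finite_set (fcoef c @^-1` [set~ 0]).
Proof. by have /asboolP := valP c. Qed.

Lemma sub_fin_supp (c : freemod) (f : T -> L) :
  (forall s, fcoef c s = 0 -> f s = 0) -> fin_supp f.
Proof.
move=> cf; apply/asboolP; apply: sub_finite_set (fcoef_fin c) => s /= fs cs.
by apply: fs; exact: cf.
Qed.

Lemma fm_rscale_subproof (c : freemod) (a : L) :
  fin_supp (fun s => fcoef c s * a).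
Proof. by apply: (sub_fin_supp (c := c)) => s ->; rewrite mul0r. Qed.
Definition fm_rscale (c : freemod) (a : L) : freemod :=
  Sub (fun s => fcoef c s * a) (fm_rscale_subproof c a).

Lemma fm_grade_subproof n (c : freemod) :
  fin_supp (fun s => if tag s == n then fcoef c s else 0).
Proof. by apply: (sub_fin_supp (c := c)) => s ->; case: ifP. Qed.
Definition fm_grade n (c : freemod) : freemod :=
  Sub (fun s => if tag s == n then fcoef c s else 0) (fm_grade_subproof n c).

Lemma fcoefR c a s : fcoef (fm_rscale c a) s = fcoef c s * a.
Proof. by rewrite /fcoef SubK. Qed.
Lemma fcoefG n c s : fcoef (fm_grade n c) s = if tag s == n then fcoef c s else 0.
Proof. by rewrite /fcoef SubK. Qed.

Lemma fm_rscaleDl x y a : fm_rscale (x + y) a = fm_rscale x a + fm_rscale y a.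
Proof. by apply: freemod_ext => s; rewrite fcoefD !fcoefR mulrDl. Qed.
Lemma fm_rscaleDr x a b : fm_rscale x (a + b) = fm_rscale x a + fm_rscale x b.
Proof. by apply: freemod_ext => s; rewrite fcoefD !fcoefR mulrDr. Qed.
Lemma fm_rscaleA x a b : fm_rscale (fm_rscale x a) b = fm_rscale x (a * b).
Proof. by apply: freemod_ext => s; rewrite !fcoefR mulrA. Qed.
Lemma fm_rscale1 x : fm_rscale x 1 = x.
Proof. by apply: freemod_ext => s; rewrite fcoefR mulr1. Qed.
Lemma fm_scale_rscale a x b : a *: fm_rscale x b = fm_rscale (a *: x) b.
Proof. by apply: freemod_ext => s; rewrite fcoefR !fcoefZ fcoefR mulrA. Qed.
Lemma fm_gradeD n x y : fm_grade n (x + y) = fm_grade n x + fm_grade n y.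
Proof.
by apply: freemod_ext => s; rewrite fcoefD !fcoefG fcoefD; case: eqP; rewrite ?addr0.
Qed.
Lemma fm_gradeZ n a x : fm_grade n (a *: x) = a *: fm_grade n x.
Proof.
by apply: freemod_ext => s; rewrite fcoefZ !fcoefG fcoefZ; case: eqP; rewrite ?mulr0.
Qed.
Lemma fm_gradeR n x a : fm_grade n (fm_rscale x a) = fm_rscale (fm_grade n x) a.
Proof.
by apply: freemod_ext => s; rewrite fcoefR !fcoefG fcoefR; case: eqP; rewrite ?mul0r.
Qed.
Lemma fm_grade_grade p q x :
  fm_grade p (fm_grade q x) = if p == q then fm_grade q x else 0.
Proof.
apply: freemod_ext => s; rewrite !fcoefG.
have [->|pq] := eqVneq p q; first by rewrite fcoefG; case: eqP.
rewrite fcoef0; case: (eqVneq (tag s) p) => // ->.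
by rewrite (negbTE pq).
Qed.
Lemma fm_grade_total x : exists N, x = \sum_(n < N) fm_grade n x.
Proof.
have [r xr] : exists r : seq T, forall s, fcoef x s != 0 -> s \in r.
  have /finite_seqP[r er] := fcoef_fin x.
  by exists r => s /eqP xs; have : (fcoef x @^-1` [set~ 0]) s by []; rewrite er.
have rN s : s \in r -> (tag s < \max_(s <- r) (tag s).+1)%N.
  by move=> sr; exact: (leq_bigmax_seq (F := fun s : T => (tag s).+1) s sr).
move: (\max_(s <- r) (tag s).+1)%N rN => N rN; exists N.
apply: freemod_ext => s.
rewrite fcoef_sum; under eq_bigr do rewrite fcoefG.
have [x0|xs] := eqVneq (fcoef x s) 0.
  by rewrite big1 // => n _; rewrite x0; case: ifP.
have sr := rN _ (xr _ xs).
rewrite (bigD1 (Ordinal sr)) //= eqxx big1 ?addr0 // => n nE.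
by move: nE; rewrite -val_eqE /= eq_sym => /negbTE ->.
Qed.

HB.instance Definition _ := Lmodule_isGradedBimodule.Build L freemod
  fm_rscaleDl fm_rscaleDr fm_rscaleA fm_rscale1 fm_scale_rscale
  fm_gradeD fm_gradeZ fm_gradeR fm_grade_grade fm_grade_total.

Lemma fgen_subproof (s : T) : fin_supp (fun t => (t == s)%:R).
Proof.
apply/asboolP; apply: (@sub_finite_set _ _ [set s]); last exact: finite_set1.
by move=> t /= ts; apply: contrapT => /eqP tns; apply: ts; rewrite (negbTE tns).
Qed.
Definition fgen (s : T) : freemod :=
  Sub (fun t => (t == s)%:R : L) (fgen_subproof s).

Definition linext (N : lmodType L) (h : T -> N) (c : freemod) : N :=
  \sum_(s \in [set: T]) fcoef c s *: h s.

Definition central (N : gbimodType L) (y : N) : Prop :=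
  forall a, a *: y = rscale y a.

Lemma linextE (N : lmodType L) (h : T -> N) (c : freemod) (r : seq T) :
  uniq r -> (forall s, fcoef c s != 0 -> s \in r) ->
  linext h c = \sum_(s <- r) fcoef c s *: h s.
Proof.
move=> ur cr; rewrite /linext (fsbigE r) //.
  by apply: eq_bigl => s; rewrite in_setT.
move=> s _; have [-> _|] := eqVneq (fcoef c s) 0; first by rewrite scale0r.
by move=> /cr ->.
Qed.

Lemma fcoef_supp (c c' : freemod) : exists r : seq T,
  [/\ uniq r, forall s, fcoef c s != 0 -> s \in r
    & forall s, fcoef c' s != 0 -> s \in r].
Proof.
have /finite_seqP[r er] := fcoef_fin c; have /finite_seqP[r' er'] := fcoef_fin c'.
exists (undup (r ++ r')); split=> [|s /eqP cs|s /eqP cs]; first exact: undup_uniq.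
  have : (fcoef c @^-1` [set~ 0]) s by [].
  by rewrite er mem_undup mem_cat /= => ->.
have : (fcoef c' @^-1` [set~ 0]) s by [].
by rewrite er' mem_undup mem_cat /= => ->; rewrite orbT.
Qed.

Lemma linextD (N : lmodType L) (h : T -> N) : {morph linext h : c c' / c + c'}.
Proof.
move=> c c'; have [r [ur cr cr']] := fcoef_supp c c'.
rewrite !(linextE h ur) //.
  by rewrite -big_split; apply: eq_bigr => s _; rewrite fcoefD scalerDl.
move=> s; apply: contraR => sr; rewrite fcoefD.
have [/eqP->|/cr] := boolP (fcoef c s == 0); last by rewrite (negbTE sr).
have [/eqP->|/cr'] := boolP (fcoef c' s == 0); last by rewrite (negbTE sr).
by rewrite addr0.
Qed.

Lemma linextZ (N : lmodType L) (h : T -> N) a c :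
  linext h (a *: c) = a *: linext h c.
Proof.
have [r [ur cr _]] := fcoef_supp c c.
rewrite !(linextE h ur) //.
  by rewrite scaler_sumr; apply: eq_bigr => s _; rewrite fcoefZ scalerA.
move=> s; apply: contraR => sr; rewrite fcoefZ.
have [/eqP->|/cr] := boolP (fcoef c s == 0); last by rewrite (negbTE sr).
by rewrite mulr0.
Qed.

Lemma linext_hom (N : gbimodType L) (h : T -> N) :
  (forall s, central (h s)) -> is_hom (linext h).
Proof.
move=> hc; split; [exact: linextD | exact: linextZ |] => c a.
have [r [ur cr _]] := fcoef_supp c c.
rewrite !(linextE h ur) //.
  rewrite rscale_suml; apply: eq_bigr => s _.
  by rewrite fcoefR -scale_rscale -hc scalerA.
move=> s; apply: contraR => sr; rewrite fcoefR.
have [/eqP->|/cr] := boolP (fcoef c s == 0); last by rewrite (negbTE sr).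
by rewrite mul0r.
Qed.

Lemma linext_fgen (N : lmodType L) (h : T -> N) s : linext h (fgen s) = h s.
Proof.
have cg t : fcoef (fgen s) t = (t == s)%:R by rewrite /fcoef SubK.
rewrite (linextE h (r := [:: s])) // => [|t].
  by rewrite big_seq1 cg eqxx scale1r.
by rewrite cg inE; case: (t == s) => //; rewrite eqxx.
Qed.

Lemma fgen_central s : central (fgen s).
Proof.
move=> a; apply: freemod_ext => t; rewrite fcoefZ fcoefR /fcoef SubK.
by case: (t == s); rewrite ?mulr1 ?mul1r ?mulr0 ?mul0r.
Qed.

Lemma homog_fgen (s : T) : homog (Posz (tag s)) (fgen s).
Proof.
apply: freemod_ext => t; rewrite fcoefG /fcoef SubK.
by have [->|_] := eqVneq t s; [rewrite eqxx | case: ifP].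
Qed.

Lemma linext_homog (N : gbimodType L) (h : T -> N) (z : int) (q : nat) c :
  (forall s, tag s = q -> homog z (h s)) -> homog (Posz q) c -> homog z (linext h c).
Proof.
move=> hz cq; have [r [ur cr _]] := fcoef_supp c c.
rewrite (linextE h ur) //.
have hs s : homog z (fcoef c s *: h s).
  have [/hz|/eqP sq] := eqVneq (tag s) q.
    by case: z {hz} => n /=; [rewrite gradeZ => -> | move=> ->; rewrite scaler0].
  rewrite -cq fcoefG (negbTE (introN eqP sq)) scale0r.
  by case: z {hz} => n //=; exact: hom0 (grade_hom N n).
case: z {hz} hs => n /= hs; last by rewrite big1.
rewrite (hom_sum _ _ _ (grade_hom N n)); apply: eq_bigr => s _; exact: hs.
Qed.

End Free.

Lemma centralZ (L : pzRingType) (N : gbimodType L) (y : N) k :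
  central y -> central ((-1) ^+ k *: y).
Proof.
by move=> yc a; rewrite scalerA -scale_rscale -yc scalerA commr_sign.
Qed.

Lemma central0 (L : pzRingType) (N : gbimodType L) : central (0 : N).
Proof. by move=> a; rewrite scaler0 rscale0l. Qed.

Lemma central_sum (L : pzRingType) (N : gbimodType L) I r (P : pred I)
    (F : I -> N) : (forall i, central (F i)) ->
  central (\sum_(i <- r | P i) F i).
Proof.
move=> Fc a; rewrite scaler_sumr rscale_suml.
by apply: eq_bigr => i _; exact: Fc.
Qed.

Lemma alternating_sum0 (V : zmodType) (F : nat -> nat -> V) n :
  (forall i j, (i <= j)%N -> F i j = - F j.+1 i) ->
  \sum_(i < n.+1) \sum_(j < n) F i j = 0.
Proof.
move=> Falt; elim: n => [|n IH]; first by rewrite big1 // => i _; rewrite big_ord0.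
rewrite big_ord_recr /=; under eq_bigr do rewrite big_ord_recr /=.
rewrite big_split /= IH add0r -big_split big1 //= => i _.
by rewrite Falt ?addNr // -ltnS.
Qed.


Section Simplices.
Variable R : realType.
Implicit Types X Y : topologicalType.

Definition std_simplex (n : nat) : set 'rV[R]_n.+1 :=
  [set v | (forall j, 0 <= v ord0 j) /\ \sum_j v ord0 j = 1].
Arguments std_simplex n : clear implicits.

Definition sing (X : topologicalType) (n : nat) : choiceType :=
  {s : std_simplex n -> X | `[< continuous s >]}.

Definition simplex (X : topologicalType) := {n : nat & sing X n}.

(* The affine map of standard simplices induced by a map of vertices. *)
Definition vertex_mx m n (al : 'I_m.+1 -> 'I_n.+1) (v : 'rV[R]_m.+1) :
  'rV[R]_n.+1 := \row_j \sum_(i | al i == j) v ord0 i.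

Lemma vertex_mx_subproof m n (al : 'I_m.+1 -> 'I_n.+1) (v : std_simplex m) :
  vertex_mx al (val v) \in std_simplex n.
Proof.
have /set_mem[v0 v1] := valP v; apply/mem_set; split=> [j|].
  by rewrite mxE sumr_ge0.
rewrite -[RHS]v1 (partition_big al xpredT) //=.
by apply: eq_bigr => j _; rewrite mxE.
Qed.

Definition vertex_map m n (al : 'I_m.+1 -> 'I_n.+1) (v : std_simplex m) :
  std_simplex n := exist _ (vertex_mx al (val v)) (vertex_mx_subproof al v).

Lemma vertex_mx_continuous m n (al : 'I_m.+1 -> 'I_n.+1) :
  continuous (vertex_mx al).
Proof.
have cj (j : 'I_n.+1) : continuous (fun u : 'rV[R]_m.+1 =>
    \sum_(i | al i == j) u ord0 i).
  apply: (@continuous_big R 'I_m.+1 +%R 0 (fun i => al i == j) _ 'rV[R]_m.+1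
            (index_enum _) (fun i u => u ord0 i)) => [|i _].
    by move=> [a b]; apply: (cvgD cvg_fst cvg_snd).
  exact: coord_continuous.
move=> v A [P vP PA].
have : \forall u \near v, forall j, P ord0 j (vertex_mx al u ord0 j).
  apply: (@filter_forall _ _
            (fun j u => P ord0 j (vertex_mx al u ord0 j)) _ (nbhs_filter v)) => j.
  have := vP ord0 j; rewrite mxE => /(cj j v).
  by apply: (@filterS _ _ (nbhs_filter v)) => u /=; rewrite mxE.
by apply: (@filterS _ _ (nbhs_filter v)) => u Pu; apply: PA => i j; rewrite ord1.
Qed.

Lemma vertex_map_continuous m n (al : 'I_m.+1 -> 'I_n.+1) :
  continuous (vertex_map al).
Proof.
apply: continuous_comp_initial => v.
apply: (@continuous_comp _ _ _ (set_val : std_simplex m -> _) (vertex_mx al)).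
  exact: initial_continuous.
exact: vertex_mx_continuous.
Qed.

Lemma vertex_map_comp l m n (be : 'I_l.+1 -> 'I_m.+1) (al : 'I_m.+1 -> 'I_n.+1) v :
  vertex_map al (vertex_map be v) = vertex_map (al \o be) v.
Proof.
apply: val_inj; apply/rowP => j; rewrite !mxE.
rewrite [RHS](partition_big be (fun i => al i == j)) //=.
apply: eq_bigr => i /eqP ij; rewrite mxE; apply: eq_bigl => k.
by case: eqP => [->|]; rewrite ?andbF // ij eqxx.
Qed.

Lemma comp_subproof (A B C : topologicalType) (g : B -> C) (f : A -> B) :
  continuous g -> continuous f -> continuous (g \o f).
Proof. by move=> cg cf x; apply: continuous_comp; [exact: cf | exact: cg]. Qed.

Lemma sing_continuous X n (s : sing X n) : continuous (val s).
Proof. exact/asboolP/(valP s). Qed.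

Lemma pull_subproof X m n (al : 'I_m.+1 -> 'I_n.+1) (s : sing X n) :
  `[< continuous (val s \o vertex_map al) >].
Proof.
apply/asboolP/comp_subproof; first exact: sing_continuous.
exact: vertex_map_continuous.
Qed.

Definition pull X m n (al : 'I_m.+1 -> 'I_n.+1) (s : sing X n) : sing X m :=
  exist _ (val s \o vertex_map al) (pull_subproof al s).

Lemma pull_comp X l m n (be : 'I_l.+1 -> 'I_m.+1) (al : 'I_m.+1 -> 'I_n.+1)
    (s : sing X n) : pull be (pull al s) = pull (al \o be) s.
Proof.
by apply: val_inj; apply: funext => v; rewrite /= vertex_map_comp.
Qed.

Lemma push_subproof X Y n (f : X -> Y) (cf : continuous f) (s : sing X n) :
  `[< continuous (f \o val s) >].
Proof. by apply/asboolP/comp_subproof => //; exact: sing_continuous. Qed.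

Definition push X Y n (f : X -> Y) (cf : continuous f) (s : sing X n) :
  sing Y n := exist _ (f \o val s) (push_subproof cf s).

Lemma sing_pair_subproof X Y n (s : sing X n) (t : sing Y n) :
  `[< continuous (fun v => (val s v, val t v) : X * Y) >].
Proof.
apply/asboolP => v.
have ns := nbhs_filter (val s v); have nt := nbhs_filter (val t v).
have nv := nbhs_filter v.
exact: (cvg_pair (@sing_continuous X n s v) (@sing_continuous Y n t v)).
Qed.

Definition sing_pair X Y n (s : sing X n) (t : sing Y n) :
  sing (X * Y)%type n :=
  exist _ (fun v => (val s v, val t v)) (sing_pair_subproof s t).

End Simplices.

Section SingularChains.
Variables (R : realType) (L : pzRingType).
Implicit Types X Y Z : topologicalType.

Definition chain (X : topologicalType) : gbimodType L := freemod L (sing R X).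

Definition sgen X n (s : sing R X n) : chain X :=
  fgen L (existT (fun n => sing R X n) n s).

Definition face X n (s : sing R X n.+1) (i : 'I_n.+2) : sing R X n :=
  pull (lift i) s.

Definition simplex_bdry X (s : simplex R X) : chain X :=
  let: existT n s := s in
  match n return sing R X n -> chain X with
  | 0 => fun=> 0
  | n'.+1 => fun s => \sum_(i < n'.+2) (-1) ^+ i *: sgen (face s i)
  end s.

Definition bdry X : chain X -> chain X := linext (@simplex_bdry X).

Lemma simplex_bdry_central X s : central (@simplex_bdry X s).
Proof.
case: s => -[|n] s; first exact: central0.
by apply: central_sum => i; apply: centralZ; exact: fgen_central.
Qed.

Lemma bdry_simplex_bdry X s : bdry (@simplex_bdry X s) = 0.
Proof.
have bh := linext_hom (@simplex_bdry_central X).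
case: s => -[|[|n]] s; first exact: hom0 bh.
  rewrite [LHS](hom_sum _ _ _ bh) big1 // => i _.
  by rewrite linextZ linext_fgen scaler0.
rewrite [LHS](hom_sum _ _ _ bh).
pose F i j : chain X := (-1) ^+ (i + j) *:
  sgen (pull (fun k : 'I_n.+1 => inord (bump i (bump j k)) : 'I_n.+3) s).
rewrite -[RHS](@alternating_sum0 _ F n.+2).
  apply: eq_bigr => i _; rewrite linextZ linext_fgen scaler_sumr.
  apply: eq_bigr => j _; rewrite scalerA -exprD /F /face pull_comp.
  congr (_ *: sgen (pull _ s)); apply: funext => k; apply: val_inj.
  by rewrite /= inordK //; exact: (ltn_ord (lift i (lift j k))).
move=> i j ij; rewrite /F addSn exprS mulN1r scaleNr opprK addnC.
congr (_ *: sgen (pull _ s)); apply: funext => k; congr inord.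
by rewrite bumpC /unbump /bump; case: (leqP j.+1 i) => ?; lia.
Qed.

Lemma bdry_differential X : is_differential (@bdry X).
Proof.
have bh := linext_hom (@simplex_bdry_central X).
split; last first.
  move=> c; have [r [ur cr _]] := fcoef_supp c c.
  rewrite {2}/bdry (linextE _ ur cr) [LHS](hom_sum _ _ _ bh) big1 // => s _.
  by rewrite [LHS]linextZ [X in _ *: X]bdry_simplex_bdry scaler0.
split=> // q c; apply: linext_homog => -[[|n] s] /= <- //.
have -> : n.+1%:Z + -1 = n%:Z by rewrite -addn1 PoszD addrK.
rewrite /homog [LHS](hom_sum _ _ _ (grade_hom (chain X) n)); apply: eq_bigr => i _.
by rewrite gradeZ; congr (_ *: _);
   exact: (@homog_fgen L (sing R X) (existT _ n (face s i))).
Qed.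

Definition sing_complex (X : topologicalType) : complex L :=
  Complex (@bdry_differential X).

(* Alexander-Whitney diagonal *)
Definition simplex_diag X (s : simplex R X) : tensor (chain X) (chain X) :=
  let: existT n s := s in
  \sum_(p < n.+1)
     tens (sgen (pull (fun i : 'I_p.+1 => inord i : 'I_n.+1) s))
          (sgen (pull (fun i : 'I_(n - p).+1 => inord (p + i) : 'I_n.+1) s)).

Definition diag X : chain X -> tensor (chain X) (chain X) :=
  linext (@simplex_diag X).

(* Eilenberg-Zilber shuffle product.  A (p, q)-shuffle is encoded by the      *)
(* lattice path i |-> (ab.1 i, ab.2 i), from (0, 0) to (p, q); its sign is    *)
(* (-1)^e, e the number of pairs of a vertical step preceding a horizontal    *)
(* one.                                                                       *)
Definition shuffle p q
    (ab : {ffun 'I_(p + q).+1 -> 'I_p.+1} * {ffun 'I_(p + q).+1 -> 'I_q.+1}) :=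
  [forall i : 'I_(p + q).+1, ab.1 i + ab.2 i == i]%N &&
  [forall i : 'I_(p + q).+1, forall j : 'I_(p + q).+1, (i <= j)%N ==>
     ((ab.1 i <= ab.1 j) && (ab.2 i <= ab.2 j))%N].

Definition shuffle_sign p q
    (ab : {ffun 'I_(p + q).+1 -> 'I_p.+1} * {ffun 'I_(p + q).+1 -> 'I_q.+1}) :
  nat :=
  (\sum_(i < p + q) (ab.1 (inord i.+1) - ab.1 (inord i)) * ab.2 (inord i))%N.

Definition simplex_cross X Y (s : simplex R X) (t : simplex R Y) :
    chain (X * Y)%type :=
  let: existT p s := s in let: existT q t := t in
  \sum_(ab : {ffun 'I_(p + q).+1 -> 'I_p.+1} * {ffun 'I_(p + q).+1 -> 'I_q.+1}
        | shuffle ab)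
     (-1) ^+ shuffle_sign ab *: sgen (sing_pair (pull ab.1 s) (pull ab.2 t)).

Definition cross X Y (c : chain X) (c' : chain Y) : chain (X * Y)%type :=
  linext (fun s => linext (fun t => simplex_cross s t) c') c.

Definition chain_map X Y (f : X -> Y) (cf : continuous f) : chain X -> chain Y :=
  linext (fun s : simplex R X => let: existT n s := s in sgen (push cf s)).

(* The pairing of chains induced by a continuous pairing of spaces. *)
Definition chain_pairing X Y Z (mu : X * Y -> Z) (cmu : continuous mu)
    (c : chain X) (c' : chain Y) : chain Z :=
  chain_map cmu (cross c c').

End SingularChains.

(* -------------------------------------------------------------------------- *)
(*  [d] and [dg] are the differential and the diagonal of a differential      *)
(*  coalgebra K.  When phi has degree -1 and dg has degree 0 only finitely    *)
(*  many terms of the sums over nat below are nonzero at a given k, and       *)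
(*  likewise for (1 + c)^-1 when c vanishes on K_0.                           *)
(* -------------------------------------------------------------------------- *)

Section Twisting.
Variable L : pzRingType.
Variable K : gbimodType L.
Variables (d : K -> K) (dg : K -> tensor K K).

(* F composed with Delta^(i+1) : K -> K^{(x)(i+1)} *)
Fixpoint iter_diag (N : zmodType) (i : nat) (F : seq K -> N) (k : K) : N :=
  match i with
  | 0 => F [:: k]
  | i'.+1 => tlift (fun x y => iter_diag i' (fun s => F (x :: s)) y) (dg k)
  end.

(* sum over i >= 1 of f_i (phi (x) ... (x) phi) Delta^i *)
Definition diag_sum (M N : gbimodType L) (f : seq M -> N) (phi : K -> M)
    (k : K) : N :=
  \sum_(i \in [set: nat]) iter_diag i (fun s => f [seq phi x | x <- s]) k.

Definition is_tilde_twisting (M : gbimodType L) (m : seq M -> M)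
    (phi : K -> M) : Prop :=
  hom_of_degree (-1) phi /\ forall k, phi (d k) = diag_sum m phi k.

Definition is_twisting (C : gbimodType L) (dC : C -> C) (mul : C -> C -> C)
    (phi : K -> C) : Prop :=
  is_tilde_twisting (alg_Ainf dC mul) phi.

(* The differential of the ~-twisted tensor product; the value of
   (^id (x) p_{i+1}) (id (x) phi (x) ... (x) phi (x) id) on
   (k_0 (x) ... (x) k_i) (x) b is ^k_0 (x) p_{i+1} (phi k_1, ..., phi k_i, b). *)
Definition twisted_d (M P : gbimodType L) (p : seq M -> P -> P) (phi : K -> M) :
    tensor K P -> tensor K P :=
  tlift (fun k b => tens (d k) b +
    \sum_(i \in [set: nat])
       iter_diag i (fun s => tens (hat (head 0 s))
                               (p [seq phi x | x <- behead s] b)) k).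

Definition cup (C : gbimodType L) (mul : C -> C -> C) (al be : K -> C)
    (k : K) : C :=
  tlift (fun x y => mul (al x) (be y)) (dg k).

(* al . (1 + c)^-1 = sum over n >= 0 of (-1)^n al . c^n *)
Definition cup_inv1D (C : gbimodType L) (mul : C -> C -> C) (al c : K -> C)
    (k : K) : C :=
  \sum_(n \in [set: nat])
     (-1) ^+ n *: iter n (fun be => cup mul be c) al k.

Definition twisting_equivalent (C : gbimodType L) (dC : C -> C)
    (mul : C -> C -> C) (phi psi : K -> C) : Prop :=
  [/\ is_twisting dC mul phi, is_twisting dC mul psi
    & exists c : K -> C,
      [/\ hom_of_degree 0 c, forall k, homog 0 k -> c k = 0
        & forall k, psi k =
            cup_inv1D mul (fun x => phi x + cup mul (fun y => hat (c y)) phi x)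
              c k
            - cup_inv1D mul (fun x => c (d x) + dC (c x)) c k]].

End Twisting.

Section HomologyAinf.
Variable L : pzRingType.

Definition is_homology_Ainf_algebra (C : complex L) (mul : C -> C -> C)
    (X : seq (homology C) -> homology C) (f : seq (homology C) -> C) : Prop :=
  [/\ is_Ainf_algebra X,
      forall a, X [:: a] = 0,
      forall a b, X [:: a; b] = - hpair mul (hat a) b,
      is_Ainf_morphism X (alg_Ainf (@cx_d L C) mul) f
    & forall h, cx_d (f [:: h]) = 0 /\ hclass (f [:: h]) = h].

Definition is_homology_Ainf_module (C D : complex L) (mul : C -> C -> C)
    (act : C -> D -> D)
    (X : seq (homology C) -> homology C) (f : seq (homology C) -> C)
    (Y : seq (homology C) -> homology D -> homology D)
    (g : seq (homology C) -> homology D -> D) : Prop :=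
  [/\ is_Ainf_module X Y,
      forall b, Y [::] b = 0,
      forall a b, Y [:: a] b = - hpair act (hat a) b,
      is_Minf_morphism X Y (alg_Ainf (@cx_d L C) mul)
        (mod_Ainf (@cx_d L D) act) f g
    & forall h, cx_d (g [::] h) = 0 /\ hclass (g [::] h) = h].

End HomologyAinf.


HB.mixin Record isTopologicalGroup G of Topological G & Group G := {
  mulg_continuous : continuous (fun z : G * G => (z.1 * z.2)%g);
  invg_continuous : continuous (fun x : G => x^-1%g)
}.

#[short(type="topGroupType")]
HB.structure Definition TopologicalGroup :=
  { G of Topological G & Group G & isTopologicalGroup G }.

(* No separation axiom is included. *)
Definition paracompact (B : topologicalType) : Prop :=
  forall U : set (set B), U `<=` open -> \bigcup_(A in U) A = [set: B] ->
    exists V : set (set B),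
      [/\ V `<=` open, \bigcup_(A in V) A = [set: B],
          forall A, V A -> exists2 A', U A' & A `<=` A'
        & forall x : B, exists2 N, nbhs x N &
            finite_set [set A | V A /\ A `&` N !=set0]].

(* Left G-space. *)
Record gspace (G : topGroupType) := GSpace {
  gs_space :> topologicalType;
  gs_act : G * gs_space -> gs_space;
  gs_act_continuous : continuous gs_act;
  gs_act1 : forall x, gs_act (1%g, x) = x;
  gs_actM : forall g h x, gs_act ((g * h)%g, x) = gs_act (g, gs_act (h, x))
}.

(* G acts on the right on the total space, and (X, p) is locally trivial: h   *)
(* and h' are mutually inverse homeomorphisms between U x G and p^-1 U, and h *)
(* is G-equivariant over U.                                                   *)
Record principal_fibration (G : topGroupType) (B : topologicalType) :=
  PrincipalFibration {
  pf_total : topologicalType;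
  pf_proj : pf_total -> B;
  pf_act : pf_total * G -> pf_total;
  pf_proj_continuous : continuous pf_proj;
  pf_act_continuous : continuous pf_act;
  pf_act1 : forall x, pf_act (x, 1%g) = x;
  pf_actM : forall x g h, pf_act (x, (g * h)%g) = pf_act (pf_act (x, g), h);
  pf_trivial : forall b : B, exists (U : set B) (h : B * G -> pf_total)
      (h' : pf_total -> B * G),
    [/\ open U /\ U b,
        {within U `*` [set: G], continuous h} /\
        {within pf_proj @^-1` U, continuous h'},
        forall u g, U u ->
          pf_proj (h (u, g)) = u /\ h' (h (u, g)) = (u, g),
        forall x, U (pf_proj x) -> h (h' x) = x
      & forall u g g', U u -> h (u, (g * g')%g) = pf_act (h (u, g), g')]
}.

Section AssociatedBundle.
Variables (G : topGroupType) (B : topologicalType).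
Variables (xi : principal_fibration G B) (F : gspace G).
Local Notation XF := (pf_total xi * F)%type.

(* (x g, y) ~ (x, g y) *)
Definition assoc_rel (z w : XF) : bool :=
  `[< exists g : G, z.1 = pf_act (w.1, g) /\ w.2 = gs_act (g, z.2) >].

Lemma assoc_rel_equiv : equiv_class_of assoc_rel.
Proof.
have sym z w : assoc_rel z w -> assoc_rel w z.
  case: z w => [x y] [x' y'] /asboolP[g /= [-> ->]]; apply/asboolP.
  exists (g^-1)%g; split => /=.
    by rewrite -pf_actM mulgV pf_act1.
  by rewrite -gs_actM mulVg gs_act1.
split=> [[x y]|z w|w z v].
- by apply/asboolP; exists 1%g; rewrite pf_act1 gs_act1.
- by apply/idP/idP; exact: sym.
- case: z w v => [x y] [x' y'] [x'' y''].
  move=> /asboolP[g /= [-> ->]] /asboolP[h /= [-> ->]]; apply/asboolP.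
  by exists (h * g)%g; rewrite /= pf_actM gs_actM.
Qed.

Definition assoc_equiv := EquivRelPack assoc_rel_equiv.

(* X x_G F *)
Definition assoc_total : topologicalType :=
  quotient_topology {eq_quot assoc_equiv}.

End AssociatedBundle.

Section Brown.
Variables (R : realType) (L : pzRingType).
Variables (G : topGroupType) (B : topologicalType).

Definition pontryagin : chain R L G -> chain R L G -> chain R L G :=
  chain_pairing (@mulg_continuous G).

Definition gs_chain_act (F : gspace G) : chain R L G -> chain R L F -> chain R L F :=
  chain_pairing (@gs_act_continuous G F).

(* The property of Brown's twisting cochains of xi, relative to the fibre F.  *)
Definition is_brown_twisting (xi : principal_fibration G B) (F : gspace G)
    (phi : chain R L B -> chain R L G) : Prop :=
  is_twisting (@bdry R L B) (@diag R L B) (@bdry R L G) pontryagin phi /\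
  chain_equivalent
    (twisted_d (@bdry R L B) (@diag R L B)
       (mod_Ainf (@bdry R L F) (@gs_chain_act F)) phi)
    (@bdry R L (assoc_total xi F)).

End Brown.

(* Main.v *)
Require Import Defs.
From mathcomp Require Import all_boot all_order all_algebra.
From mathcomp Require Import all_classical all_reals all_analysis.
From mathcomp Require Import zify.
Set Implicit Arguments.
Unset Strict Implicit.
Unset Printing Implicit Defensive.
Import Order.TTheory GRing.Theory Num.Theory.
Local Open Scope classical_set_scope.
Local Open Scope ring_scope.

(* With psi = sum_i f_i (phis (x) ... (x) phis) Delta^i, there are chain maps
     K (x)_phis H(F)  -- Theta -->  K (x)_psi C(F)  <-- gauge --  K (x)_phi C(F),
   where K = C(B).  Theta sums k_0 (x) g_i (phis k_1, ..., phis k_(i-1), b) over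
   the iterated diagonals of k, and gauge (k (x) b) = k (x) b + k' (x) ^c(k'') b
   for the cochain c of the equivalence.  Both preserve the filtration by the
   dimension of simplices in B, and on the part of dimension n they are g_1,
   which induces the identity in homology, and the identity.  Hence their mapping
   cones are acyclic, by induction on the dimension.

   On the simplices of K all identities reduce to identities between sums over
   faces and cuts of lists of vertices; the Leibniz rule and the associativity
   of the action of C(G) on C(F) reduce in the same way to shuffles of lists. *)

(** No spectral sequences are compared: every tensor has bounded dimension in B, so an induction on
    elements of the mapping cone gives injectivity and surjectivity in homology together. About the
    fibre it uses only that [g [::] h] is a cycle in the class h. The sums over all iterated
    diagonals are finite because a cochain of degree -1, or one that is 0 on K_0, kills vertices,
    and a simplex has only finitely many cuts into pieces with at least one edge. As L need not be
    commutative, scalars cannot be moved past an arbitrary chain; simplices are central, and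
    identities are reduced to them by linearity. The formal inverse of 1 + c is removed at once:
    multiplied by 1 + c on the right, the equivalence reads psi (1 + c) = (1 + ^c) phi - (c d + d
    c), and this is what makes [gauge] commute with the differentials. Lists of vertices may be
    empty, so the boundary of lists is augmented. This makes the recursions uniform, and the extra
    terms vanish in the end because the empty list stands for the chain 0. *)

(** * Deciding identities in abelian groups by reflection *)

Inductive zmod_expr := ZVar of nat | ZZero | ZAdd of zmod_expr & zmod_expr | ZOpp of zmod_expr.

Fixpoint zmod_eval (V : zmodType) (env : seq V) (e : zmod_expr) : V :=
  match e with
  | ZVar n => nth 0 env n
  | ZZero => 0
  | ZAdd e1 e2 => zmod_eval env e1 + zmod_eval env e2
  | ZOpp e1 => - zmod_eval env e1
  end.

Fixpoint zmod_coef (e : zmod_expr) (n : nat) : int :=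
  match e with
  | ZVar m => (m == n)%:Z
  | ZZero => 0
  | ZAdd e1 e2 => zmod_coef e1 n + zmod_coef e2 n
  | ZOpp e1 => - zmod_coef e1 n
  end.

Lemma zmod_evalE (V : zmodType) (env : seq V) e :
  zmod_eval env e = \sum_(i < size env) nth 0 env i *~ zmod_coef e i.
Proof.
elim: e => [n||e1 IH1 e2 IH2|e1 IH1] /=.
- have [nn|nn] := ltnP n (size env); last first.
    rewrite nth_default // big1 // => i _; case: eqP => // ni.
    by have := ltn_ord i; rewrite -ni ltnNge nn.
  rewrite (bigD1 (Ordinal nn)) //= eqxx big1 ?addr0 // => i; rewrite -val_eqE /= eq_sym.
  by move/negbTE ->.
- by rewrite big1.
- by rewrite IH1 IH2 -big_split; apply: eq_bigr => i _; rewrite mulrzDr.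
- by rewrite IH1 -sumrN; apply: eq_bigr => i _; rewrite mulrNz.
Qed.

Lemma zmod_eqP (V : zmodType) (env : seq V) e1 e2 :
  all (fun n => zmod_coef e1 n == zmod_coef e2 n) (iota 0 (size env)) ->
  zmod_eval env e1 = zmod_eval env e2.
Proof.
move=> /allP h; rewrite !zmod_evalE; apply: eq_bigr => i _.
by rewrite (eqP (h i _)) // mem_iota /= add0n ltn_ord.
Qed.

(** The vacuous [match goal] lets [unify] run inside tactics that return a term. *)
Ltac zmod_same x y := match goal with _ => unify x y with typeclass_instances end.

Ltac zmod_index x env :=
  lazymatch env with
  | ?y :: ?env' =>
      match goal with
      | _ => let _ := zmod_same x y in constr:(0%N)
      | _ => let n := zmod_index x env' in constr:(n.+1)
      end
  end.

Ltac zmod_insert x env0 env :=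
  lazymatch env with
  | nil => constr:(x :: env0)
  | ?y :: ?env' =>
      match goal with
      | _ => let _ := zmod_same x y in constr:(env0)
      | _ => zmod_insert x env0 env'
      end
  end.

Ltac zmod_atoms env t :=
  lazymatch t with
  | GRing.add ?a ?b => let env := zmod_atoms env a in zmod_atoms env b
  | GRing.opp ?a => zmod_atoms env a
  | GRing.zero => env
  | _ => zmod_insert t env env
  end.

Ltac zmod_reify env t :=
  lazymatch t with
  | GRing.add ?a ?b =>
      let a := zmod_reify env a in let b := zmod_reify env b in constr:(ZAdd a b)
  | GRing.opp ?a => let a := zmod_reify env a in constr:(ZOpp a)
  | GRing.zero => constr:(ZZero)
  | _ => let n := zmod_index t env in constr:(ZVar n)
  end.

(* Decides identities between sums of signed atoms in an abelian group. *)
Ltac zmod :=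
  lazymatch goal with
  | |- @eq ?T ?lhs ?rhs =>
      let env := zmod_atoms (@nil T) lhs in
      let env := zmod_atoms env rhs in
      let e1 := zmod_reify env lhs in
      let e2 := zmod_reify env rhs in
      refine (@zmod_eqP _ env e1 e2 _); vm_compute; reflexivity
  end.

(** Additivity is kept as a bare property of functions, since most maps it is applied to are ad hoc
    abstractions such as a pairing with one argument fixed. *)
Lemma additive0 (V W : zmodType) (h : V -> W) :
  {morph h : x y / x + y} -> h 0 = 0.
Proof. by move=> hD; apply: (addrI (h 0)); rewrite -hD !addr0. Qed.

Lemma additive_sum (V W : zmodType) (h : V -> W) I (r : seq I) (F : I -> V) :
  {morph h : x y / x + y} -> h (\sum_(i <- r) F i) = \sum_(i <- r) h (F i).
Proof. by move=> hD; apply: big_morph => //; exact: additive0. Qed.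

Lemma additiveN (V W : zmodType) (h : V -> W) x :
  {morph h : x y / x + y} -> h (- x) = - h x.
Proof. by move=> hD; apply: (addrI (h x)); rewrite -hD !subrr additive0. Qed.

Lemma sign_scale (L : pzRingType) (V : lmodType L) n (x : V) :
  (-1) ^+ n *: x = if odd n then - x else x.
Proof. by rewrite -signr_odd; case: (odd n); rewrite ?expr1 ?expr0 ?scaleN1r ?scale1r. Qed.

Lemma sign_scaleK (L : pzRingType) (V : lmodType L) n (x : V) :
  (-1) ^+ n *: ((-1) ^+ n *: x) = x.
Proof. by rewrite !sign_scale; case: odd; rewrite ?opprK. Qed.

Lemma sign_scaleC (L : pzRingType) (V : lmodType L) n m (x : V) :
  (-1) ^+ n *: ((-1) ^+ m *: x) = (-1) ^+ m *: ((-1) ^+ n *: x).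
Proof. by rewrite !sign_scale; case: odd; case: odd. Qed.

Lemma sign_scaleD (L : pzRingType) (V : lmodType L) n m (x : V) :
  (-1) ^+ n *: ((-1) ^+ m *: x) = (-1) ^+ (n + m) *: x.
Proof. by rewrite scalerA exprD. Qed.

Lemma eq_sign_scale (L : pzRingType) (V : lmodType L) n m (x : V) :
  odd n = odd m -> (-1) ^+ n *: x = (-1) ^+ m *: x.
Proof. by rewrite !sign_scale => ->. Qed.

(** * Faces and cuts of lists of vertices *)

Section VertexLists.
Variable A : Type.
Implicit Types v w a b : seq A.

(* A list of vertices stands for a simplex, so its degree is its size minus 1.
   [faces] records each face with the exponent of its sign, [cuts] the pairs of
   the Alexander-Whitney diagonal. *)
Fixpoint faces v : seq (nat * seq A) :=
  if v is x :: w then (0%N, w) :: [seq (f.1.+1, x :: f.2) | f <- faces w]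
  else [::].

Fixpoint cuts v : seq (seq A * seq A) :=
  if v is x :: w then ([:: x], v) :: [seq (x :: ab.1, ab.2) | ab <- cuts w]
  else [::].

(** Boundary and diagonal are given in continuation form, as the value of a map [Phi] on them, so
    that no module of formal sums of lists is needed. A one-vertex list has the empty list as a
    face: this is the augmented boundary. *)
Definition bnd (L : pzRingType) (Z : lmodType L) v (Phi : seq A -> Z) : Z :=
  \sum_(f <- faces v) (-1) ^+ f.1 *: Phi f.2.

Definition dgs (Z : zmodType) v (Phi : seq A -> seq A -> Z) : Z :=
  \sum_(ab <- cuts v) Phi ab.1 ab.2.

Lemma cuts_size v ab : List.In ab (cuts v) ->
  (0 < size ab.1)%N /\ (0 < size ab.2)%N /\ (size ab.1 + size ab.2 = (size v).+1)%N.
Proof.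
elim: v ab => [//|x w IH] ab /= [<-|] //=.
rewrite -[map _ _]/(List.map _ _) => /List.in_map_iff[[c d]] [<-] /IH /= [? [? ?]].
by split=> //; split=> //; lia.
Qed.

(** Membership is [List.In] because the vertices carry no decidable equality. *)
Lemma eq_big_In (Z : nmodType) (I : Type) (r : seq I) (F G : I -> Z) :
  (forall i, List.In i r -> F i = G i) -> \sum_(i <- r) F i = \sum_(i <- r) G i.
Proof.
elim: r => [|i r IH] h; first by rewrite !big_nil.
rewrite !big_cons h /=; last by left.
by congr (_ + _); apply: IH => j jr; apply: h; right.
Qed.

Section Bnd.
Variables (L : pzRingType) (Z : lmodType L).
Implicit Types Phi : seq A -> Z.

Lemma bnd_nil Phi : bnd [::] Phi = 0.
Proof. by rewrite /bnd big_nil. Qed.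

Lemma bnd_cons x w Phi : bnd (x :: w) Phi = Phi w - bnd w (fun u => Phi (x :: u)).
Proof.
rewrite /bnd big_cons big_map /= expr0 scale1r -sumrN; congr (_ + _).
by apply: eq_bigr => f _ /=; rewrite exprS mulN1r scaleNr.
Qed.

Lemma eq_bnd v Phi Psi :
  (forall u, size v = (size u).+1 -> Phi u = Psi u) -> bnd v Phi = bnd v Psi.
Proof.
elim: v Phi Psi => [|x w IH] Phi Psi e; first by rewrite !bnd_nil.
rewrite !bnd_cons e //; congr (_ - _); apply: IH => u uw.
by apply: e; rewrite /= uw.
Qed.

Lemma bndD v Phi Psi : bnd v (fun u => Phi u + Psi u) = bnd v Phi + bnd v Psi.
Proof. by rewrite /bnd -big_split; apply: eq_bigr => f _; rewrite scalerDr. Qed.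

Lemma bnd0 v : bnd v (fun=> 0 : Z) = 0.
Proof. by rewrite /bnd big1 // => f _; rewrite scaler0. Qed.

Lemma bndN v Phi : bnd v (fun u => - Phi u) = - bnd v Phi.
Proof. by rewrite /bnd -sumrN; apply: eq_bigr => f _; rewrite scalerN. Qed.

Lemma bnd_sum I (r : seq I) v (Phi : I -> seq A -> Z) :
  bnd v (fun u => \sum_(i <- r) Phi i u) = \sum_(i <- r) bnd v (Phi i).
Proof.
rewrite /bnd exchange_big /=; apply: eq_bigr => f _.
by rewrite scaler_sumr.
Qed.

Lemma bndZ v e Phi :
  bnd v (fun u => (-1) ^+ e *: Phi u) = (-1) ^+ e *: bnd v Phi.
Proof. by rewrite /bnd scaler_sumr; apply: eq_bigr => f _; rewrite sign_scaleC. Qed.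

(** By the recursion d(xw) = w - x dw one gets dd(xw) = dw - dw + x ddw. *)
Lemma bnd_bnd v Phi : bnd v (fun u => bnd u Phi) = 0.
Proof.
elim: v Phi => [|x w IH] Phi; first by rewrite bnd_nil.
rewrite bnd_cons [X in _ - X](eq_bnd (Psi := fun u => Phi u - bnd u (fun t => Phi (x :: t)))).
  by rewrite bndD bndN IH; zmod.
by move=> u _; rewrite bnd_cons.
Qed.

End Bnd.

Lemma bnd_morph (L : pzRingType) (Z Z' : lmodType L) (h : Z -> Z') v Phi :
  {morph h : x y / x + y} -> h (bnd v Phi) = bnd v (fun u => h (Phi u)).
Proof.
move=> hD; have h0 := additive0 hD.
have hN x := additiveN x hD.
rewrite /bnd (big_morph h hD h0); apply: eq_bigr => f _.
by rewrite !sign_scale; case: odd.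
Qed.

Section Dgs.
Variable Z : zmodType.
Implicit Types Phi : seq A -> seq A -> Z.

Lemma dgs_nil Phi : dgs [::] Phi = 0.
Proof. by rewrite /dgs big_nil. Qed.

Lemma dgs_cons x w Phi :
  dgs (x :: w) Phi = Phi [:: x] (x :: w) + dgs w (fun a b => Phi (x :: a) b).
Proof. by rewrite /dgs big_cons big_map. Qed.

Lemma eq_dgs v Phi Psi :
  (forall a b, (0 < size a)%N -> (0 < size b)%N ->
     (size a + size b = (size v).+1)%N -> Phi a b = Psi a b) ->
  dgs v Phi = dgs v Psi.
Proof. by move=> e; apply: eq_big_In => -[a b] /cuts_size /= [? [? ?]]; apply: e. Qed.

Lemma dgsD v Phi Psi : dgs v (fun a b => Phi a b + Psi a b) = dgs v Phi + dgs v Psi.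
Proof. by rewrite /dgs -big_split. Qed.

Lemma dgsN v Phi : dgs v (fun a b => - Phi a b) = - dgs v Phi.
Proof. by rewrite /dgs -sumrN. Qed.

Lemma dgs_sum I (r : seq I) v (Phi : I -> seq A -> seq A -> Z) :
  dgs v (fun a b => \sum_(i <- r) Phi i a b) = \sum_(i <- r) dgs v (Phi i).
Proof. by rewrite /dgs exchange_big. Qed.

Lemma dgs_coassoc v (Phi : seq A -> seq A -> seq A -> Z) :
  dgs v (fun a b => dgs a (fun a1 a2 => Phi a1 a2 b)) =
  dgs v (fun a b => dgs b (fun b1 b2 => Phi a b1 b2)).
Proof.
elim: v Phi => [|x w IH] Phi; first by rewrite !dgs_nil.
rewrite !dgs_cons dgs_nil addr0 -addrA; congr (_ + _).
rewrite -IH -dgsD; apply: eq_dgs => a b _ _ _.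
by rewrite dgs_cons.
Qed.

End Dgs.

Lemma dgs_morph (Z Z' : zmodType) (h : Z -> Z') v Phi :
  {morph h : x y / x + y} -> h (dgs v Phi) = dgs v (fun a b => h (Phi a b)).
Proof.
move=> hD; have h0 := additive0 hD.
by rewrite /dgs (big_morph h hD h0).
Qed.

(* - (-1)^(size a) is the Koszul sign (-1)^(deg a). *)
Lemma bnd_dgs (L : pzRingType) (Z : lmodType L) v (Phi : seq A -> seq A -> Z) :
  dgs v (fun a b => bnd a (fun u => Phi u b) - (-1) ^+ size a *: bnd b (Phi a)) =
  bnd v (fun u => dgs u Phi) + Phi [::] v - (-1) ^+ size v *: Phi v [::].
Proof.
(* The two extra terms on the right come from the cuts with a half that is a single vertex, whose
   only face is the empty list. *)
elim: v Phi => [|x w IH] Phi.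
  by rewrite dgs_nil bnd_nil /= expr0 scale1r; zmod.
rewrite dgs_cons !bnd_cons bnd_nil /= expr1 scaleN1r.
rewrite [X in _ = _ - X + _ - _](eq_bnd (Psi := fun u => Phi [:: x] (x :: u) + dgs u (fun a b => Phi (x :: a) b))); last first.
  by move=> u _; rewrite dgs_cons.
rewrite bndD.
transitivity (Phi [::] (x :: w) + (Phi [:: x] w - bnd w (fun u => Phi [:: x] (x :: u)))
   + (dgs w Phi - dgs w (fun a b => bnd a (fun u => Phi (x :: u) b)
                            - (-1) ^+ size a *: bnd b (Phi (x :: a))))).
  rewrite -dgsN -dgsD.
  have -> : dgs w (fun a b => bnd (x :: a) (Phi^~ b) - (-1) ^+ size (x :: a) *: bnd b (Phi (x :: a)))
   = dgs w (fun a b => Phi a b + - (bnd a (fun u => Phi (x :: u) b) - (-1) ^+ size a *: bnd b (Phi (x :: a)))).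
    apply: eq_dgs => a b _ _ _; rewrite bnd_cons /= exprS mulN1r scaleNr; zmod.
  by zmod.
rewrite (IH (fun a b => Phi (x :: a) b)) /= exprS mulN1r scaleNr.
by zmod.
Qed.

End VertexLists.

Section Words.
Variable A : Type.
Implicit Types v w a b : seq A.

(** The second half of a cut may be all of [v], so the recursion is on a bound [n] for the number of
    further cuts. Terms beyond the bound [size v] contain a one-vertex piece. *)
Fixpoint words n v : seq (seq (seq A)) :=
  [:: v] :: if n is n'.+1 then
    flatten [seq [seq ab.1 :: ws | ws <- words n' ab.2] | ab <- cuts v]
  else [::].

Lemma words_nonempty n v ws : List.In ws (words n v) -> ws <> [::].
Proof.
case: n => [|n] /= [<-|] //.
elim: (cuts v) => [//|ab r IH] /=; rewrite -[_ ++ _]/(List.app _ _).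
case/List.in_app_iff => // {IH}; rewrite -[map _ _]/(List.map _ _).
by case/List.in_map_iff => u [<-].
Qed.

(** The consequence of multiadditivity that discards words with a piece on which the cochain is 0.
    Unlike multiadditivity it passes at once to composites such as [split_sum] and [insert_sum]. *)
Definition vanishing (M Z : zmodType) (F : seq M -> Z) : Prop :=
  forall s, 0 \in s -> F s = 0.

Definition multiadditive (M Z : zmodType) (F : seq M -> Z) : Prop :=
  forall s x y s', F (s ++ (x + y) :: s') = F (s ++ x :: s') + F (s ++ y :: s').

Lemma vanishing_cons (M Z : zmodType) (F : seq M -> Z) x :
  vanishing F -> vanishing (fun s => F (x :: s)).
Proof. by move=> F0 s s0; apply: F0; rewrite inE s0 orbT. Qed.

Lemma multiadditive_cons (M Z : zmodType) (F : seq M -> Z) x :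
  multiadditive F -> multiadditive (fun s => F (x :: s)).
Proof. by move=> FD s y z s'; exact: (FD (x :: s)). Qed.

Lemma multiadditive_vanishing (M Z : zmodType) (F : seq M -> Z) :
  multiadditive F -> vanishing F.
Proof.
move=> FD s /splitPr[s1 s2]; apply: (addrI (F (s1 ++ 0 :: s2))).
by rewrite -FD !addr0.
Qed.

Section Tsum.
Variables (M : zmodType) (phi : seq A -> M).
Hypothesis phi_short : forall v, (size v <= 1)%N -> phi v = 0.

Definition tsum_upto (Z : zmodType) n v (F : seq M -> Z) : Z :=
  \sum_(ws <- words n v) F (map phi ws).

(* The sum of F (phi v_1, ..., phi v_r) over all r >= 1 and all ways to cut v
   into r pieces, consecutive ones sharing a vertex. *)
Definition tsum (Z : zmodType) v (F : seq M -> Z) : Z := tsum_upto (size v) v F.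

Section Zmod.
Variable Z : zmodType.
Implicit Types F G : seq M -> Z.

Lemma tsum_upto0 v F : tsum_upto 0 v F = F [:: phi v].
Proof. by rewrite /tsum_upto big_seq1. Qed.

Lemma tsum_uptoS n v F : tsum_upto n.+1 v F =
  F [:: phi v] + dgs v (fun a b => tsum_upto n b (fun s => F (phi a :: s))).
Proof.
rewrite /tsum_upto /= big_cons big_flatten /= big_map; congr (_ + _).
by rewrite /dgs; apply: eq_bigr => ab _; rewrite big_map.
Qed.

Lemma eq_tsum_upto n v F G :
  (forall x s, F (x :: s) = G (x :: s)) -> tsum_upto n v F = tsum_upto n v G.
Proof. by move=> FG; apply: eq_big_In => -[/words_nonempty|w ws _] //; exact: FG. Qed.

Lemma tsum_upto_zero n v F :
  (forall x s, F (x :: s) = 0) -> tsum_upto n v F = 0.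
Proof.
by move=> F0; rewrite (@eq_tsum_upto _ _ _ (fun=> 0)) // /tsum_upto big1.
Qed.

(** The numbers of edges of the pieces add up to that of [v]; one piece more than the bound allows
    forces a piece without edges, and [phi] is 0 on it. *)
Lemma tsum_upto_stable n v F : vanishing F -> (size v <= n.+1)%N ->
  tsum_upto n.+1 v F = tsum_upto n v F.
Proof.
elim: n v F => [|n IH] v F F0 vn.
  rewrite tsum_uptoS tsum_upto0 -[RHS]addr0; congr (_ + _).
  rewrite (eq_dgs (Psi := fun _ _ => 0)); first by rewrite /dgs big1.
  move=> a b a0 b0 ab; rewrite phi_short; last by lia.
  by apply: tsum_upto_zero => x s; rewrite F0 // inE eqxx.
rewrite !tsum_uptoS; congr (_ + _); apply: eq_dgs => a b a0 b0 ab.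
have [a1|a1] := leqP (size a) 1.
  by rewrite phi_short // !tsum_upto_zero // => x s; rewrite F0 // inE eqxx.
by apply: IH; [exact: vanishing_cons | lia].
Qed.

Lemma tsum_upto_tsum n v F : vanishing F -> (size v <= n)%N ->
  tsum_upto n v F = tsum v F.
Proof.
move=> F0; rewrite /tsum; elim: n => [|n IH] vn.
  by move: vn; rewrite leqn0 => /eqP ->.
move: vn; rewrite leq_eqVlt => /orP[/eqP <- //|vn].
by rewrite tsum_upto_stable ?IH // ltnW.
Qed.

Lemma tsum_rec v F : vanishing F -> tsum v F =
  F [:: phi v] + dgs v (fun a b => tsum b (fun s => F (phi a :: s))).
Proof.
move=> F0; rewrite -(@tsum_upto_tsum (size v).+1) // tsum_uptoS.
congr (_ + _); apply: eq_dgs => a b a0 b0 ab.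
by apply: tsum_upto_tsum; [exact: vanishing_cons | lia].
Qed.

Lemma eq_tsum v F G :
  (forall x s, F (x :: s) = G (x :: s)) -> tsum v F = tsum v G.
Proof. exact: eq_tsum_upto. Qed.

Lemma tsum_zero v F : (forall x s, F (x :: s) = 0) -> tsum v F = 0.
Proof. exact: tsum_upto_zero. Qed.

Lemma tsum_short v F : vanishing F -> (size v <= 1)%N -> tsum v F = 0.
Proof.
move=> F0 v1; rewrite -(tsum_upto_tsum F0 (leqnn _)).
rewrite (tsum_upto_tsum F0 (leqnn _)) tsum_rec // phi_short // F0 ?inE // add0r.
rewrite (eq_dgs (Psi := fun _ _ => 0)); first by rewrite /dgs big1.
move=> a b a0 b0 ab; rewrite phi_short; last by lia.
by apply: tsum_zero => x s; rewrite F0 // inE eqxx.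
Qed.

Lemma tsumD v F G : tsum v (fun s => F s + G s) = tsum v F + tsum v G.
Proof. by rewrite /tsum /tsum_upto -big_split. Qed.

Lemma tsumN v F : tsum v (fun s => - F s) = - tsum v F.
Proof. by rewrite /tsum /tsum_upto -sumrN. Qed.

Lemma tsum_dgs v w (F : seq A -> seq A -> seq M -> Z) :
  tsum v (fun s => dgs w (fun a b => F a b s)) = dgs w (fun a b => tsum v (F a b)).
Proof. by rewrite /dgs -exchange_big. Qed.

End Zmod.

Lemma tsum_morph (Z Z' : zmodType) (h : Z -> Z') v F :
  {morph h : x y / x + y} -> h (tsum v F) = tsum v (fun s => h (F s)).
Proof.
move=> hD; have h0 := additive0 hD.
by rewrite /tsum /tsum_upto (big_morph h hD h0).
Qed.

Section Split.
Variable Z : zmodType.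

Definition split_sum (B : Type) (F : seq B -> seq B -> Z) (s : seq B) : Z :=
  \sum_(1 <= j < size s) F (take j s) (drop j s).

Lemma split_sum_cons B (F : seq B -> seq B -> Z) x y s :
  split_sum F [:: x, y & s] =
  F [:: x] (y :: s) + split_sum (fun t u => F (x :: t) u) (y :: s).
Proof. by rewrite /split_sum big_ltn //= big_add1. Qed.

Lemma split_sum1 B (F : seq B -> seq B -> Z) x : split_sum F [:: x] = 0.
Proof. by rewrite /split_sum big_geq. Qed.

Lemma split_sum_vanishing (F : seq M -> seq M -> Z) :
  (forall t, vanishing (F t)) -> (forall u, vanishing (F^~ u)) ->
  vanishing (split_sum F).
Proof.
move=> F1 F2 s s0; rewrite /split_sum big1 // => j _.
move: s0; rewrite -{1}(cat_take_drop j s) mem_cat => /orP[/F2|/F1]; exact.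
Qed.

(* The words on v cut in two are the pairs of words on the two halves of v. *)
Lemma tsum_split v (F : seq M -> seq M -> Z) :
  (forall t, vanishing (F t)) -> (forall u, vanishing (F^~ u)) ->
  tsum v (split_sum F) = dgs v (fun a b => tsum a (fun t => tsum b (F t))).
Proof.
elim: {v}(size v) {-2}v (leqnn (size v)) F => [|n IH] v vn F F1 F2.
  case: v vn => // _; rewrite dgs_nil tsum_short //.
  exact: split_sum_vanishing.
rewrite tsum_rec ?split_sum1 ?add0r; last exact: split_sum_vanishing.
transitivity (dgs v (fun a b => tsum b (F [:: phi a])
   + dgs b (fun b1 b2 => tsum b1 (fun t => tsum b2 (F (phi a :: t)))))).
  apply: eq_dgs => a b a0 b0 ab.
  rewrite (@eq_tsum _ _ _ (fun s => F [:: phi a] s + split_sum (fun t u => F (phi a :: t) u) s)).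
    rewrite tsumD; congr (_ + _).
    (* If [a] is a single vertex then [b] is as long as [v] and the induction hypothesis does not
       apply, but then [phi a] is 0 and so are both sides. The same distinction recurs in the later
       inductions on the size. *)
    have [a1|a1] := leqP (size a) 1.
      rewrite phi_short // tsum_zero => [|x s].
        rewrite /dgs big1 // => bb _; rewrite tsum_zero // => x s.
        by rewrite tsum_zero // => y u; rewrite F2 // inE eqxx.
      by rewrite /split_sum big1 // => j _; rewrite F2 // inE eqxx.
    apply: IH => [|t|u]; first by lia.
    - exact: F1.
    - by move=> t t0; apply: F2; rewrite inE t0 orbT.
  move=> x s; exact: split_sum_cons.
rewrite dgsD -(dgs_coassoc v (fun a b1 b2 => tsum b1 (fun t => tsum b2 (F (phi a :: t))))).
rewrite -dgsD; apply: eq_dgs => a b _ _ _.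
rewrite [RHS]tsum_rec //.
by move=> u u0; rewrite tsum_zero // => x s; rewrite F2.
Qed.

End Split.
End Tsum.
End Words.

(** * Signs, insertion sums, and boundaries of sums over cuts *)

Section Hat.
Variables (L : pzRingType) (M : gbimodType L).

Lemma grade_bounded (x : M) :
  exists N, forall n, (N <= n)%N -> grade n x = 0.
Proof.
have [N xN] := grade_sum x; exists N => n Nn.
rewrite xN (hom_sum _ _ _ (grade_hom _ n)) big1 // => q _.
rewrite grade_grade; case: eqP => // e.
by have := ltn_ord q; rewrite -e ltnNge Nn.
Qed.

Lemma hatE (x : M) N : (forall n, (N <= n)%N -> grade n x = 0) ->
  hat x = \sum_(n < N) (-1) ^+ n *: grade n x.
Proof.
move=> xN; rewrite /hat (fsbigE (index_iota 0 N)) ?iota_uniq //.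
  rewrite (eq_bigl xpredT) => [|n]; last by rewrite in_setT.
  by rewrite big_mkord.
move=> n _; rewrite mem_index_iota /=; case: (leqP N n) => // /xN ->.
by rewrite scaler0.
Qed.

Lemma hat_hom : is_hom (@hat L M).
Proof.
split=> [x y|a x|x a].
- have [N1 x0] := grade_bounded x; have [N2 y0] := grade_bounded y.
  have hx n : (maxn N1 N2 <= n)%N -> grade n x = 0 by rewrite geq_max => /andP[/x0].
  have hy n : (maxn N1 N2 <= n)%N -> grade n y = 0 by rewrite geq_max => /andP[_ /y0].
  rewrite !(@hatE _ (maxn N1 N2)) // => [|n nN]; last by rewrite gradeD hx ?hy ?addr0.
  by rewrite -big_split; apply: eq_bigr => n _; rewrite gradeD scalerDr.
- have [N x0] := grade_bounded x.
  rewrite !(@hatE _ N) // => [|n /x0 x1]; last by rewrite gradeZ x1 scaler0.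
  rewrite scaler_sumr; apply: eq_bigr => n _.
  by rewrite gradeZ !scalerA commr_sign.
- have [N x0] := grade_bounded x.
  rewrite !(@hatE _ N) // => [|n /x0 x1]; last by rewrite gradeR x1 rscale0l.
  rewrite rscale_suml; apply: eq_bigr => n _.
  by rewrite gradeR scale_rscale.
Qed.

Lemma hat_homog n (x : M) : homog (Posz n) x -> hat x = (-1) ^+ n *: x.
Proof.
move=> xn; have g m : grade m x = if m == n then x else 0.
  by rewrite -{1}xn grade_grade xn.
rewrite (@hatE _ n.+1) => [|m nm]; last by rewrite g gtn_eqF.
rewrite big_ord_recr /= g eqxx big1 ?add0r // => i _.
by rewrite g ltn_eqF ?scaler0.
Qed.

Lemma hat0 : hat (0 : M) = 0. Proof. exact: hom0 hat_hom. Qed.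

Lemma hatD (x y : M) : hat (x + y) = hat x + hat y.
Proof. by case: hat_hom. Qed.

End Hat.

Section Insertion.
Variable L : pzRingType.

Lemma morph_sign (Z Z' : lmodType L) (h : Z -> Z') e x :
  {morph h : x y / x + y} -> h ((-1) ^+ e *: x) = (-1) ^+ e *: h x.
Proof.
by move=> hD; rewrite !sign_scale; case: odd; rewrite ?additiveN.
Qed.

Lemma multiadditive_head (M Z : zmodType) (F : seq M -> Z) s :
  multiadditive F -> {morph (fun x => F (x :: s)) : x y / x + y}.
Proof. by move=> FD x y; exact: (FD [::]). Qed.

Lemma insert_sum_nil (M N : gbimodType L) (f : seq M -> N) m :
  insert_sum f m [::] = 0.
Proof. by rewrite /insert_sum big_ord0. Qed.

(** The cases are: nothing before the inserted operation and everything inside it, nothing before it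
    and something after it, and at least one entry before it. They match the terms produced by
    [tsum_rec] and [tsum_split]. *)
Lemma insert_sum_cons (M N : gbimodType L) (f : seq M -> N) m x s :
  insert_sum f m (x :: s) =
  f [:: m (x :: s)] + split_sum (fun t u => f (m t :: u)) (x :: s)
  - insert_sum (fun u => f (hat x :: u)) m s.
Proof.
rewrite /insert_sum /split_sum big_ord_recl /= subn0; congr (_ + _).
  rewrite big_nat_recr //= addrC expr0 scale1r take_size drop_size.
  by congr (_ + _); apply: eq_bigr => j _; rewrite scale1r add0n.
rewrite -sumrN; apply: eq_bigr => k _.
rewrite -sumrN /bump /= add1n subSS; apply: eq_bigr => j _.
by rewrite exprS mulN1r scaleNr !add0n.
Qed.

Lemma insert_sum_vanishing (M N : gbimodType L) (f : seq M -> N) m :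
  vanishing f -> vanishing m -> vanishing (insert_sum f m).
Proof.
move=> f0 m0 s s0; rewrite /insert_sum big1 // => k _; rewrite big1 // => j _.
rewrite f0 ?scaler0 // mem_cat inE.
move: s0; rewrite -{1}(cat_take_drop k s) -{1}(cat_take_drop j (drop k s)).
rewrite drop_drop !mem_cat addnC => /or3P[s0|s0|->]; last by rewrite !orbT.
- by apply/orP; left; apply/mapP; exists 0; rewrite ?hat0.
- by rewrite m0 // eqxx orbT.
Qed.

End Insertion.

Section Differentials.
Variables (L : pzRingType) (A : Type) (M : gbimodType L).
Variable phi : seq A -> M.
Hypothesis phi_short : forall v, (size v <= 1)%N -> phi v = 0.
Implicit Types v w a b : seq A.

(* The sum over all ways to cut v into r + 1 pieces of
   F v_0 [:: phi v_1; ...; phi v_r]. *)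
Definition esum (Z : zmodType) v (F : seq A -> seq M -> Z) : Z :=
  F v [::] + dgs v (fun a b => tsum phi b (F a)).

Lemma eq_esum (Z : zmodType) v (F G : seq A -> seq M -> Z) :
  (forall a s, (0 < size v -> 0 < size a)%N -> F a s = G a s) -> esum v F = esum v G.
Proof.
move=> FG; rewrite /esum FG //; congr (_ + _); apply: eq_dgs => a b a0 _ _.
by apply: eq_tsum => x s; apply: FG.
Qed.

Lemma esumD (Z : zmodType) v (F G : seq A -> seq M -> Z) :
  esum v (fun a s => F a s + G a s) = esum v F + esum v G.
Proof.
rewrite /esum addrACA; congr (_ + _); rewrite -dgsD; apply: eq_dgs => a b _ _ _.
exact: tsumD.
Qed.

Lemma esum_morph (Z Z' : zmodType) (h : Z -> Z') v F :
  {morph h : x y / x + y} -> h (esum v F) = esum v (fun a s => h (F a s)).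
Proof.
move=> hD; rewrite /esum hD (dgs_morph _ _ hD); congr (_ + _).
by apply: eq_dgs => a b _ _ _; rewrite (tsum_morph _ _ _ hD).
Qed.

(** By coassociativity, cutting [v] and then cutting its first piece again is cutting [v] once into
    a first piece and a longer word, with a marked place where the word is divided. Both parts of
    the word may be empty, whence the range of [j]. *)
Lemma esum_esum (Z : zmodType) v (F : seq A -> seq M -> seq M -> Z) :
  (forall a t, vanishing (F a t)) -> (forall a u, vanishing (F a ^~ u)) ->
  esum v (fun a s => esum a (fun a' t => F a' t s)) =
  esum v (fun a s => \sum_(j < (size s).+1) F a (take j s) (drop j s)).
Proof.
move=> F1 F2; rewrite /esum big_ord_recl big_ord0 addr0 /= -!addrA; congr (_ + _).
transitivity (dgs v (fun a b => tsum phi b (F a [::]) +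
  (tsum phi b (fun t => F a t [::]) + tsum phi b (split_sum (F a))))); last first.
  apply: eq_dgs => a b _ _ _; rewrite -!tsumD; apply: eq_tsum => x s.
  rewrite -(big_mkord xpredT (fun j => F a (take j (x :: s)) (drop j (x :: s)))).
  (* The extreme values of [j], where one part is empty, are not covered by [split_sum]. *)
  by rewrite big_ltn // big_nat_recr //= take_size drop_size; congr (_ + _); rewrite addrC.
rewrite !dgsD addrCA; congr (_ + _).
rewrite (eq_dgs (Psi := fun a b => tsum phi b (F a [::]) +
  tsum phi b (fun s => dgs a (fun a1 a2 => tsum phi a2 (fun t => F a1 t s))))); last first.
  by move=> a b _ _ _; rewrite tsumD.
rewrite dgsD; congr (_ + _).
transitivity (dgs v (fun a b => dgs a (fun a1 a2 =>
    tsum phi a2 (fun t => tsum phi b (fun s => F a1 t s))))).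
  apply: eq_dgs => a b _ _ _; rewrite tsum_dgs; apply: eq_dgs => a1 a2 _ _ _.
  by rewrite /tsum /tsum_upto exchange_big.
rewrite (dgs_coassoc v (fun a1 a2 b => tsum phi a2 (fun t => tsum phi b (fun s => F a1 t s)))).
by apply: eq_dgs => a b _ _ _; rewrite tsum_split.
Qed.

Hypothesis phi_hat : forall v, hat (phi v) = (-1) ^+ size v *: phi v.

Lemma map_hat_vanishing (Z : zmodType) (F : seq M -> Z) :
  vanishing F -> vanishing (fun s => F (map (@hat L M) s)).
Proof. by move=> F0 s s0; apply: F0; apply/mapP; exists 0; rewrite ?hat0. Qed.

(** Consecutive pieces share a vertex, so the sizes of r pieces add up to [size v] + r - 1, while
    the hats contribute the sign of the sum of these sizes. *)
Lemma tsum_hat (Z : lmodType L) v (F : seq M -> Z) : multiadditive F ->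
  (-1) ^+ size v *: tsum phi v F =
  tsum phi v (fun s => (-1) ^+ (size s).+1 *: F (map (@hat L M) s)).
Proof.
elim: {v}(size v) {-2}v (leqnn (size v)) F => [|n IH] v vn F FD;
  have F0 := multiadditive_vanishing FD;
  have G0 : vanishing (fun s => (-1) ^+ (size s).+1 *: F (map (@hat L M) s))
    by move=> s /(map_hat_vanishing F0) ->; rewrite scaler0.
  by rewrite !tsum_short ?scaler0 ?(leq_trans vn).
rewrite (tsum_rec phi_short v F0) (tsum_rec phi_short v G0) /=.
rewrite scalerDr phi_hat (morph_sign _ _ (multiadditive_head _ FD)) sign_scaleD.
congr (_ + _); first by apply: eq_sign_scale; lia.
rewrite (dgs_morph _ _ (scalerDr _)); apply: eq_dgs => a b a0 b0 ab.
have [a1|a1] := leqP (size a) 1.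
  by rewrite phi_short // hat0 !tsum_zero ?scaler0 // => x s; rewrite F0 ?scaler0 ?inE ?eqxx.
rewrite phi_hat.
transitivity ((-1) ^+ (size a).+1 *: ((-1) ^+ size b *: tsum phi b (fun s => F (phi a :: s)))).
  by rewrite sign_scaleD; apply: eq_sign_scale; lia.
rewrite IH ?(tsum_morph _ _ _ (scalerDr _)); [|lia|exact: multiadditive_cons].
apply: eq_tsum => x s.
rewrite (morph_sign _ _ (multiadditive_head _ FD)) !sign_scaleD /=.
by apply: eq_sign_scale; lia.
Qed.

Section Leibniz.
Variable m : seq M -> M.
Hypothesis m_vanishing : vanishing m.
Hypothesis phi_bnd : forall v, bnd v phi = tsum phi v m.

(** The diagonal is a chain map, so the boundary falls on one piece at a time. There the twisting
    equation replaces it by an operation [m], and passing the earlier pieces puts hats on them. *)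
Lemma bnd_tsum (N : gbimodType L) v (F : seq M -> N) : multiadditive F ->
  bnd v (fun u => tsum phi u F) = tsum phi v (insert_sum F m).
Proof.
elim: {v}(size v) {-2}v (leqnn (size v)) F => [|n IH] v vn F FD;
  have F0 := multiadditive_vanishing FD;
  have I0 := insert_sum_vanishing F0 m_vanishing.
  by case: v vn => // _; rewrite bnd_nil tsum_short.
rewrite (eq_bnd (Psi := fun u => F [:: phi u] + dgs u (fun a b => tsum phi b (fun s => F (phi a :: s)))));
  last by move=> u _; exact: tsum_rec.
rewrite bndD -(bnd_morph v phi (multiadditive_head [::] FD)) phi_bnd.
rewrite (tsum_morph _ _ _ (multiadditive_head [::] FD)).
have := bnd_dgs v (fun a b => tsum phi b (fun s => F (phi a :: s))).
rewrite /= (@tsum_short _ _ _ phi_short _ [::] _ (vanishing_cons (phi v) F0)) // scaler0 subr0.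
rewrite phi_short // tsum_zero ?addr0 => [<-|x s]; last by rewrite F0 ?inE ?eqxx.
(* Packages the last part of [insert_sum_cons] as a function of the whole list, so that [tsum_rec]
   applies to it. *)
pose I s := insert_sum (fun u => F (hat (head 0 s) :: u)) m (behead s).
have head_hat0 s : vanishing (fun u => F (hat (head 0 s) :: u)).
  exact: vanishing_cons.
have vI : vanishing I.
  case=> [|x s]; rewrite // inE => /orP[/eqP <-|s0].
    rewrite /I /= /insert_sum big1 // => k _; rewrite big1 // => j _.
    by rewrite F0 ?scaler0 // inE hat0 eqxx.
  by rewrite /I /= insert_sum_vanishing //; exact: vanishing_cons.
rewrite (@eq_tsum _ _ _ _ v (insert_sum F m) (fun s => F [:: m s] +
  (split_sum (fun t u => F (m t :: u)) s + - I s))); last first.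
  by move=> x s; rewrite insert_sum_cons addrA.
rewrite !tsumD tsumN; congr (_ + _).
rewrite tsum_split //; first last.
- by move=> u t t0; rewrite F0 // m_vanishing ?inE ?eqxx.
- by move=> t; exact: vanishing_cons.
rewrite (tsum_rec phi_short v vI) {1}/I insert_sum_nil add0r -dgsN -dgsD.
apply: eq_dgs => a b a0 b0 ab; congr (_ + _).
  rewrite -(bnd_morph a phi (h := fun x => tsum phi b (fun s => F (x :: s)))).
    rewrite phi_bnd (tsum_morph _ _ _ (h := fun x => tsum phi b (fun s => F (x :: s)))) //.
    by move=> x y; rewrite -tsumD; apply: eq_tsum => z s; exact: (FD [::]).
  by move=> x y; rewrite -tsumD; apply: eq_tsum => z s; exact: (FD [::]).
rewrite /I /=; congr (- _).
have [a1|a1] := leqP (size a) 1.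
  rewrite phi_short // hat0 (eq_bnd (Psi := fun=> 0)) => [|u _]; last first.
    by rewrite tsum_zero // => x s; rewrite F0 ?inE ?eqxx.
  rewrite bnd0 scaler0 tsum_zero // => x s.
  rewrite /insert_sum big1 // => k _; rewrite big1 // => j _.
  by rewrite F0 ?scaler0 ?inE ?eqxx.
rewrite IH; [|lia|exact: multiadditive_cons].
rewrite (tsum_morph _ _ _ (scalerDr _)); apply: eq_tsum => x s.
rewrite phi_hat /insert_sum scaler_sumr; apply: eq_bigr => k _.
rewrite scaler_sumr; apply: eq_bigr => j _.
by rewrite sign_scaleC (morph_sign _ _ (multiadditive_head _ FD)).
Qed.

Lemma bnd_esum (N : gbimodType L) v (F : seq A -> seq M -> N) :
  (forall a, multiadditive (F a)) -> (forall s, F [::] s = 0) ->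
  bnd v (fun u => esum u F) =
  esum v (fun a s => bnd a (fun u => F u s) - (-1) ^+ size a *: insert_sum (F a) m s).
Proof.
move=> FD F0; have Fv a := multiadditive_vanishing (FD a).
have := bnd_dgs v (fun a b => tsum phi b (F a)).
rewrite /= (@tsum_short _ _ _ phi_short _ [::] _ (Fv v)) // scaler0 subr0.
rewrite tsum_zero ?addr0 => [e|x s]; last by rewrite F0.
rewrite /esum bndD -e insert_sum_nil scaler0 subr0; congr (_ + _).
apply: eq_dgs => a b _ _ _; rewrite tsumD tsumN; congr (_ - _).
  by rewrite /tsum /tsum_upto bnd_sum.
by rewrite bnd_tsum // (tsum_morph _ _ _ (scalerDr _)).
Qed.

End Leibniz.
End Differentials.

Section MasterIdentity.
Variables (L : pzRingType) (A : Type) (M : gbimodType L).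
Variable phi : seq A -> M.
Hypothesis phi_short : forall v, (size v <= 1)%N -> phi v = 0.
Hypothesis phi_hat : forall v, hat (phi v) = (-1) ^+ size v *: phi v.
Implicit Types v a : seq A.

(** For differential modules, where p_i = 0 for i > 2, this turns a sum over all words into one
    ordinary cut. *)
Lemma tsum_single (Z : zmodType) v (F : seq M -> Z) :
  (forall x y s, F [:: x, y & s] = 0) -> tsum phi v F = F [:: phi v].
Proof.
move=> F0; rewrite /tsum; case: (size v) => [|n]; first by rewrite tsum_upto0.
rewrite tsum_uptoS [X in _ + X](_ : _ = 0) ?addr0 //.
rewrite (eq_dgs (Psi := fun _ _ => 0)); first by rewrite /dgs big1.
by move=> a b _ _ _; apply: tsum_upto_zero => x s; exact: F0.
Qed.

Lemma esum_hat (Z : lmodType L) v (F : seq A -> seq M -> Z) :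
  (forall a, multiadditive (F a)) ->
  (-1) ^+ (size v).+1 *: esum phi v F =
  esum phi v (fun a s => (-1) ^+ (size a + size s).+1 *: F a (map (@hat L M) s)).
Proof.
move=> FD; rewrite /esum scalerDr /= addn0; congr (_ + _).
rewrite (dgs_morph _ _ (scalerDr _)); apply: eq_dgs => a b a0 b0 ab.
transitivity ((-1) ^+ size a *: ((-1) ^+ size b *: tsum phi b (F a))).
  by rewrite sign_scaleD; apply: eq_sign_scale; lia.
rewrite tsum_hat // (tsum_morph _ _ _ (scalerDr _)); apply: eq_tsum => x s.
by rewrite sign_scaleD addnS.
Qed.

Variables (P Q Z : gbimodType L).
Variables (m : seq M -> M) (p : seq M -> P -> P) (g : seq M -> P -> Q).
Hypothesis m_vanishing : vanishing m.
Hypothesis phi_bnd : forall v, bnd v phi = tsum phi v m.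
Hypothesis p_vanishing : forall b, vanishing (p^~ b).
Hypothesis g_multiadditive : forall b, multiadditive (g^~ b).
Hypothesis g_additive : forall s, {morph g s : b c / b + c}.
Variable H : seq A -> Q -> Z.
Hypothesis H_nil : forall c, H [::] c = 0.
Hypothesis H_additive : forall a, {morph H a : c c' / c + c'}.

(** The sign of [a] is distributed over the pieces of [a] as hats, and the two successive cuttings
    merge into one. The length of the hatted part supplies the sign (-1)^k of the module
    relation. *)
Lemma esum_sign_esum v b :
  esum phi v (fun a s => (-1) ^+ (size a).+1 *:
    esum phi a (fun a' t => H a' (g t (p s b)))) =
  esum phi v (fun a s => (-1) ^+ (size a).+1 *:
    H a (\sum_(k < (size s).+1)
           (-1) ^+ k *: g (map (@hat L M) (take k s)) (p (drop k s) b))).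
Proof.
pose F a t s := (-1) ^+ (size a + size t).+1 *: H a (g (map (@hat L M) t) (p s b)).
have gv c := multiadditive_vanishing (g_multiadditive c).
have g0 t : g t 0 = 0 := additive0 (g_additive t).
have H0 a : H a 0 = 0 := additive0 (@H_additive a).
transitivity (esum phi v (fun a s => esum phi a (fun a' t => F a' t s))).
  apply: eq_esum => a s _; rewrite esum_hat // => a' s1 x y s2.
  by rewrite g_multiadditive H_additive.
rewrite esum_esum //; first last.
- by move=> a u t t0; rewrite /F (map_hat_vanishing (gv _)) ?H0 ?scaler0.
- by move=> a t s s0; rewrite /F p_vanishing ?g0 ?H0 ?scaler0.
apply: eq_esum => a s _.
rewrite (additive_sum _ _ (@H_additive a)) scaler_sumr; apply: eq_bigr => k _.
have ks : (k <= size s)%N by rewrite -ltnS.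
by rewrite /F (morph_sign _ _ (@H_additive a)) sign_scaleD size_takel //.
Qed.

(* Applied with H a c = ^a (x) c and g = p this is the vanishing of the square
   of the twisted differential, with H a c = a (x) c the compatibility of a
   morphism of A(oo)-modules with the twisted differentials. *)
Lemma esum_mod_insert_sum v b :
  bnd v (fun u => esum phi u (fun a s => H a (g s b)))
  + esum phi v (fun a s => (-1) ^+ (size a).+1 *:
      esum phi a (fun a' t => H a' (g t (p s b)))) =
  esum phi v (fun a s => bnd a (fun u => H u (g s b))
    + (-1) ^+ (size a).+1 *: H a (mod_insert_sum g m p s b)).
Proof.
rewrite (@bnd_esum L A M phi phi_short phi_hat m m_vanishing phi_bnd) //; last by move=> a s1 x y s2; rewrite g_multiadditive H_additive.
rewrite esum_sign_esum -esumD; apply: eq_esum => a s _.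
rewrite /mod_insert_sum H_additive scalerDr addrA; congr (_ + _ + _).
rewrite exprS mulN1r scaleNr; congr (- (_ *: _)).
rewrite /insert_sum (additive_sum _ _ (@H_additive a)); apply: eq_bigr => k _.
rewrite (additive_sum _ _ (@H_additive a)); apply: eq_bigr => j _.
by rewrite (morph_sign _ _ (@H_additive a)).
Qed.

End MasterIdentity.

(** * Shuffles *)

Section Shuffles.

(* The lattice paths through the grid u x w, each with the number of pairs of a
   vertical step preceding a horizontal one. *)
Fixpoint paths (A B : Type) (u : seq A) :
    seq B -> seq (nat * seq (A * B)) :=
  fix paths_u w :=
    match u, w with
    | x :: u', y :: w' =>
        if nilp u' && nilp w' then [:: (0%N, [:: (x, y)])] else
          [seq (p.1, (x, y) :: p.2) | p <- paths u' w] ++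
          [seq ((size u' + p.1)%N, (x, y) :: p.2) | p <- paths_u w']
    | _, _ => [::]
    end.

Definition shuf (L : pzRingType) (Z : lmodType L) A B (u : seq A) (w : seq B)
    (Phi : seq (A * B) -> Z) : Z :=
  \sum_(p <- paths u w) (-1) ^+ p.1 *: Phi p.2.

Variables (L : pzRingType) (Z : lmodType L).

Lemma shuf_nill A B (w : seq B) (Phi : seq (A * B) -> Z) : shuf [::] w Phi = 0.
Proof. by rewrite /shuf; case: w => [|y w]; rewrite big_nil. Qed.

Lemma shuf_nilr A B (u : seq A) (Phi : seq (A * B) -> Z) : shuf u [::] Phi = 0.
Proof. by rewrite /shuf; case: u => [|x u]; rewrite big_nil. Qed.

(** A vertical first step precedes all [size u] horizontal steps, which accounts for the sign of the
    last summand. *)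
Lemma shuf_cons A B x (u : seq A) y (w : seq B) (Phi : seq (A * B) -> Z) :
  shuf (x :: u) (y :: w) Phi =
  (if nilp u && nilp w then Phi [:: (x, y)] else 0)
  + shuf u (y :: w) (fun z => Phi ((x, y) :: z))
  + (-1) ^+ size u *: shuf (x :: u) w (fun z => Phi ((x, y) :: z)).
Proof.
case: ifP => [/andP[/nilP -> /nilP ->]|nn].
  rewrite shuf_nill shuf_nilr scaler0 !addr0.
  by rewrite /shuf big_seq1 scale1r.
rewrite add0r /shuf [paths (x :: u) (y :: w)]/= nn big_cat !big_map /=.
congr (_ + _); rewrite scaler_sumr; apply: eq_bigr => p _.
by rewrite exprD scalerA.
Qed.

Lemma paths_size A B (u : seq A) (w : seq B) p :
  List.In p (paths u w) -> (size p.2).+1 = (size u + size w)%N /\ (0 < size p.2)%N.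
Proof.
elim: u w p => [|x u IHu]; first by case.
elim=> [//|y w IHw] p /=; case: ifP => [/andP[/nilP-> /nilP->]|_] /=; first by case=> // <-.
rewrite -[_ ++ _]/(List.app _ _) => /List.in_app_iff[] /List.in_map_iff[q [<-]].
- by move/IHu => /= [e _]; split=> //; lia.
- by move/IHw => /= [e _]; split=> //; lia.
Qed.

Lemma eq_shuf A B (u : seq A) (w : seq B) (Phi Psi : seq (A * B) -> Z) :
  (forall z, (0 < size z)%N -> (size z).+1 = (size u + size w)%N -> Phi z = Psi z) ->
  shuf u w Phi = shuf u w Psi.
Proof. by move=> e; apply: eq_big_In => p /paths_size[? ?]; rewrite e. Qed.

Lemma shufD A B (u : seq A) (w : seq B) (Phi Psi : seq (A * B) -> Z) :
  shuf u w (fun z => Phi z + Psi z) = shuf u w Phi + shuf u w Psi.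
Proof. by rewrite /shuf -big_split; apply: eq_bigr => p _; rewrite scalerDr. Qed.

Lemma shufN A B (u : seq A) (w : seq B) (Phi : seq (A * B) -> Z) :
  shuf u w (fun z => - Phi z) = - shuf u w Phi.
Proof. by rewrite /shuf -sumrN; apply: eq_bigr => p _; rewrite scalerN. Qed.

Lemma shufZ A B (u : seq A) (w : seq B) e (Phi : seq (A * B) -> Z) :
  shuf u w (fun z => (-1) ^+ e *: Phi z) = (-1) ^+ e *: shuf u w Phi.
Proof. by rewrite /shuf scaler_sumr; apply: eq_bigr => p _; rewrite sign_scaleC. Qed.

Lemma shuf_map A A' B B' (f : A -> A') (g : B -> B') (u : seq A) (w : seq B)
    (Phi : seq (A' * B') -> Z) :
  shuf (map f u) (map g w) Phi =
  shuf u w (fun z => Phi [seq (f ab.1, g ab.2) | ab <- z]).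
Proof.
elim: u w Phi => [|x u IHu] w Phi; first by rewrite !shuf_nill.
elim: w Phi => [|y w IHw] Phi; first by rewrite !shuf_nilr.
rewrite !shuf_cons /= (IHu (y :: w)) IHw size_map /nilp !size_map //.
Qed.

Lemma bnd_nilp A (u : seq A) (t : bool) (c : Z) :
  bnd u (fun u' => if nilp u' && t then c else 0) =
  if (size u == 1%N) && t then c else 0.
Proof.
case: u => [|x [|x' u]]; rewrite ?bnd_nil // bnd_cons /= ?bnd_nil ?subr0 //.
by rewrite bnd0 subr0.
Qed.

(** The Leibniz rule: - (-1)^(size u) is the sign (-1)^(deg u). The last summand is due to the
    augmentation: for two points the only path has the empty face, while deleting a point on either
    side leaves no path. *)
Lemma bnd_shuf A B (u : seq A) (w : seq B) (Phi : seq (A * B) -> Z) :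
  shuf u w (fun z => bnd z Phi) =
  bnd u (fun u' => shuf u' w Phi)
  - (-1) ^+ size u *: bnd w (fun w' => shuf u w' Phi)
  + (if (size u == 1%N) && (size w == 1%N) then Phi [::] else 0).
Proof.
elim: u w Phi => [|x u IHu] w Phi.
  rewrite shuf_nill bnd_nil (eq_bnd (Psi := fun=> 0)) => [|*]; last exact: shuf_nill.
  by rewrite bnd0 scaler0 /=; zmod.
elim: w Phi => [|y w IHw] Phi.
  rewrite shuf_nilr bnd_nil (eq_bnd (Psi := fun=> 0)) => [|*]; last exact: shuf_nilr.
  by rewrite bnd0 scaler0 andbF; zmod.
set Pxy := fun z => Phi ((x, y) :: z).
have Eb (u' : seq A) (w' : seq B) : shuf u' w' (fun z => bnd ((x, y) :: z) Phi) =
    shuf u' w' Phi - shuf u' w' (fun z => bnd z Pxy).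
  by rewrite -shufN -shufD; apply: eq_shuf => z _ _; rewrite bnd_cons.
have EU : bnd u (fun u' => shuf (x :: u') (y :: w) Phi) =
    (if (size u == 1%N) && nilp w then Phi [:: (x, y)] else 0)
    + bnd u (fun u' => shuf u' (y :: w) Pxy)
    - (-1) ^+ size u *: bnd u (fun u' => shuf (x :: u') w Pxy).
  rewrite -bnd_nilp -bndZ -bndN -!bndD; apply: eq_bnd => u' eu.
  by rewrite shuf_cons eu exprS mulN1r scaleNr opprK.
have EW : bnd w (fun w' => shuf (x :: u) (y :: w') Phi) =
    (if (size w == 1%N) && nilp u then Phi [:: (x, y)] else 0)
    + bnd w (fun w' => shuf u (y :: w') Pxy)
    + (-1) ^+ size u *: bnd w (fun w' => shuf (x :: u) w' Pxy).
  rewrite -bnd_nilp -bndZ -!bndD; apply: eq_bnd => w' ew.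
  by rewrite shuf_cons andbC.
rewrite shuf_cons !Eb (IHu (y :: w)) IHw !bnd_cons EU EW bnd_nil subr0 /Pxy.
rewrite -/Pxy /nilp ![size (_ :: _)]/= !eqSS !sign_scale [odd _.+1]/=.
by case: (size u == 1%N); case: (size u == 0%N); case: (size w == 1%N);
   case: (size w == 0%N); case: (odd (size u)); rewrite /=; zmod.
Qed.

Lemma shuf_assoc A B C (u : seq A) (v : seq B) (w : seq C) (Phi : seq (A * B * C) -> Z) :
  shuf u v (fun z => shuf z w Phi) =
  shuf v w (fun z => shuf u z (fun q =>
    Phi [seq (abc.1, abc.2.1, abc.2.2) | abc <- q])).
Proof.
elim: u v w Phi => [|x u IHu] v w Phi.
  by rewrite shuf_nill (eq_shuf (Psi := fun=> 0)) => [|*];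
     rewrite ?shuf_nill // /shuf big1 // => *; rewrite scaler0.
elim: v w Phi => [|y v IHv] w Phi; first by rewrite shuf_nill shuf_nilr.
elim: w Phi => [|t w IHw] Phi.
  by rewrite shuf_nilr (eq_shuf (Psi := fun=> 0)) => [|*];
     rewrite ?shuf_nilr // /shuf big1 // => *; rewrite scaler0.
set F := fun q => Phi [seq (abc.1, abc.2.1, abc.2.2) | abc <- q].
pose P z := Phi ((x, y, t) :: z).
have /= eu := IHu (y :: v) (t :: w) P.
have /= ev := IHv (t :: w) P.
have /= ew := IHw P.
pose cst := if [&& nilp u, nilp v & nilp w] then Phi [:: (x, y, t)] else 0.
(* The common value of both sides: paths in the three-dimensional grid sorted by the direction of
   the first step, with [cst] for the path without steps. A first step precedes all steps in the
   earlier directions, which gives the exponents. *)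
transitivity (cst + shuf u (y :: v) (fun z => shuf z (t :: w) P)
  + (-1) ^+ size u *: shuf (x :: u) v (fun z => shuf z (t :: w) P)
  + (-1) ^+ (size u + size v) *: shuf (x :: u) (y :: v) (fun z => shuf z w P)).
  rewrite (shuf_cons x u y v (fun z => shuf z (t :: w) Phi)).
  rewrite (shuf_cons x u y v (fun z => shuf z w P)).
  rewrite (eq_shuf (u := u) (Psi := fun z => shuf z (t :: w) P
      + (-1) ^+ (size u + size v) *: shuf ((x, y) :: z) w P)); last first.
    move=> z z0 /= ez; rewrite shuf_cons.
    have -> : nilp z = false by case: z z0 {ez}.
    by rewrite add0r; congr (_ + _); apply: eq_sign_scale; lia.
  rewrite (eq_shuf (u := x :: u) (Psi := fun z => shuf z (t :: w) P
      + (-1) ^+ (size u + size v) *: shuf ((x, y) :: z) w P)); last first.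
    move=> z z0 /= ez; rewrite shuf_cons.
    have -> : nilp z = false by case: z z0 {ez}.
    by rewrite add0r; congr (_ + _); apply: eq_sign_scale; lia.
  rewrite !shufD !shufZ !scalerDr /cst.
  have -> : (if nilp u && nilp v then shuf [:: (x, y)] (t :: w) Phi else 0) =
     (if [&& nilp u, nilp v & nilp w] then Phi [:: (x, y, t)] else 0)
     + (-1) ^+ (size u + size v) *: (if nilp u && nilp v then shuf [:: (x, y)] w P else 0).
    have [/andP[/nilP -> /nilP ->]|] := boolP (nilp u && nilp v).
      by rewrite shuf_cons shuf_nill /= expr0 !scale1r addr0.
    by rewrite scaler0 addr0 andbA => /negbTE ->.
  by rewrite (sign_scaleC (size u)); zmod.
pose Q q := P [seq (abc.1, abc.2.1, abc.2.2) | abc <- q].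
rewrite [RHS]shuf_cons.
rewrite (eq_shuf (u := v) (w := t :: w) (Psi := fun z => shuf u ((y, t) :: z) Q
    + (-1) ^+ size u *: shuf (x :: u) z Q)); last first.
  move=> z z0 /= ez; rewrite shuf_cons.
  have -> : nilp z = false by case: z z0 {ez}.
  by rewrite andbF add0r.
rewrite [in RHS](eq_shuf (u := y :: v) (w := w) (Psi := fun z => shuf u ((y, t) :: z) Q
    + (-1) ^+ size u *: shuf (x :: u) z Q)); last first.
  move=> z z0 /= ez; rewrite shuf_cons.
  have -> : nilp z = false by case: z z0 {ez}.
  by rewrite andbF add0r.
rewrite eu ev ew -/Q !shufD !shufZ (shuf_cons y v t w) !scalerDr.
have -> : (if nilp v && nilp w then shuf (x :: u) [:: (y, t)] F else 0) =
   cst + (if nilp v && nilp w then shuf u [:: (y, t)] Q else 0).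
  rewrite /cst andbA.
  have [/andP[/nilP -> /nilP ->]|] := boolP (nilp v && nilp w).
    by rewrite shuf_cons shuf_nilr scaler0 addr0 !andbT.
  by rewrite -andbA => /negbTE ->; rewrite andbF addr0.
rewrite (sign_scaleC (size v)) !sign_scaleD.
by zmod.
Qed.

End Shuffles.

(** * Shuffles given by index functions and recursively listed lattice paths *)

Section LatticePaths.

(** Phrased by coordinate sums and monotonicity so as to agree with [shuffle]; [lattice_path_cons]
    translates it into the steps by which [paths] recurses. The path leads from (i, j) to (i + m, j
    + n). *)
Definition lattice_path m n i j (z : seq (nat * nat)) : Prop :=
  size z = (m + n).+1 /\
  forall k l, (k <= l)%N -> (l < (m + n).+1)%N ->
    let a := nth (0, 0)%N z k in let b := nth (0, 0)%N z l in
    [/\ (b.1 + b.2 = i + j + l)%N, (i <= a.1)%N && (b.1 <= i + m)%N,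
        (j <= a.2)%N && (b.2 <= j + n)%N, (a.1 <= b.1)%N & (a.2 <= b.2)%N].

Lemma lattice_path_cons m n i j c z : lattice_path m n i j (c :: z) <->
  c = (i, j) /\ [\/ [/\ m = 0, n = 0 & z = [::]]%N,
    exists2 m', m = m'.+1 & lattice_path m' n i.+1 j z
  | exists2 n', n = n'.+1 & lattice_path m n' i j.+1 z].
Proof.
split=> [[/= [sz] h]|[-> ]].
  have ec : c = (i, j).
    have := h 0%N 0%N isT isT; case: c {h} => c1 c2 /= [? /andP[? ?] /andP[? ?] _ _].
    by congr (_, _); lia.
  split=> //; case: z sz h => [|[a b] z] /= sz h; first by constructor 1; split=> //; lia.
  have := h 0%N 1%N isT; rewrite ec /= => /(_ _)[|? /andP[? ?] /andP[? ?] ? ?]; first by lia.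
  have [[ea eb]|[ea eb]] : (a = i.+1 /\ b = j) \/ (a = i /\ b = j.+1) by lia.
  - constructor 2; exists m.-1; first by lia.
    split=> [/=|k l kl lm]; first by lia.
    have := h k.+1 l.+1 kl; have := h 1%N k.+1 isT => /= h1 h2.
    have [] := h1; first by lia.
    move=> ? /andP[? ?] /andP[? ?] ? ?; have [] := h2; first by lia.
    move=> ? /andP[? ?] /andP[? ?] ? ?; split=> //; lia.
  - constructor 3; exists n.-1; first by lia.
    split=> [/=|k l kl lm]; first by lia.
    have := h k.+1 l.+1 kl; have := h 1%N k.+1 isT => /= h1 h2.
    have [] := h1; first by lia.
    move=> ? /andP[? ?] /andP[? ?] ? ?; have [] := h2; first by lia.
    move=> ? /andP[? ?] /andP[? ?] ? ?; split=> //; lia.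
case=> [[-> -> ->]|[m' -> [sz h]]|[n' -> [sz h]]].
- by split=> // -[|k] [|l] //= _ _; rewrite !addn0 !leqnn.
- split=> [/=|[|k] [|l] //= kl lm]; first by lia.
  + by split; lia.
  + by have [|? /andP[? ?] /andP[? ?] ? ?] := h l l (leqnn _); [lia | split; lia].
  + by have [|? /andP[? ?] /andP[? ?] ? ?] := h k l kl; [lia | split; lia].
- split=> [/=|[|k] [|l] //= kl lm]; first by lia.
  + by split; lia.
  + by have [|? /andP[? ?] /andP[? ?] ? ?] := h l l (leqnn _); [lia | split; lia].
  + by have [|? /andP[? ?] /andP[? ?] ? ?] := h k l kl; [lia | split; lia].
Qed.

(** The sign exponent of a shuffle, with heights measured from [j], so that the tail of a path can
    be measured from the starting height of the whole path. *)
Definition path_inversions j (z : seq (nat * nat)) : nat :=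
  (\sum_(k < (size z).-1) ((nth (0, 0) z k.+1).1 - (nth (0, 0) z k).1)
     * ((nth (0, 0) z k).2 - j))%N.

Lemma path_inversions_cons j a b z : path_inversions j [:: a, b & z] =
  ((b.1 - a.1) * (a.2 - j) + path_inversions j (b :: z))%N.
Proof. by rewrite /path_inversions /= big_ord_recl. Qed.

(** The path lies strictly above height [j], so raising the reference height by one loses one
    inversion for each of its [m] horizontal steps. *)
Lemma path_inversionsS m n i j j' z : lattice_path m n i j' z -> (j < j')%N ->
  path_inversions j z = (m + path_inversions j.+1 z)%N.
Proof.
elim: z m n i j' => [|c z IH] m n i j'; first by case.
case/lattice_path_cons=> -> [[-> _ ->] _|[m' -> l] jj'|[n' _ l] jj'].
- by rewrite /path_inversions !big_ord0.
- case: z l IH => [[] //|d z] l IH; rewrite !path_inversions_cons (IH _ _ _ _ l) //.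
  by move/lattice_path_cons: l => [-> _] /=; lia.
- case: z l IH => [[] //|d z] l IH; rewrite !path_inversions_cons (IH _ _ _ _ l) ?ltnS ?(ltnW jj') //.
  by move/lattice_path_cons: l => [-> _] /=; lia.
Qed.

Lemma in_paths_cons (A B : eqType) (x : A) u (y : B) w e z : ~~ (nilp u && nilp w) ->
  (e, z) \in paths (x :: u) (y :: w) <->
  exists2 z', z = (x, y) :: z' &
    (e, z') \in paths u (y :: w) \/
    exists2 e', e = (size u + e')%N & (e', z') \in paths (x :: u) w.
Proof.
move=> uw; have -> : paths (x :: u) (y :: w) =
    [seq (p.1, (x, y) :: p.2) | p <- paths u (y :: w)] ++
    [seq ((size u + p.1)%N, (x, y) :: p.2) | p <- paths (x :: u) w].
  by rewrite /= (negbTE uw).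
rewrite mem_cat; split=> [/orP[]/mapP[[e' z'] h [-> ->]]|[z' ->] [h|[e' -> h]]].
- by exists z' => //; left.
- by exists z' => //; right; exists e'.
- by apply/orP; left; apply/mapP; exists (e, z').
- by apply/orP; right; apply/mapP; exists (e', z').
Qed.

Lemma mem_paths m n i j e z :
  ((e, z) \in paths (iota i m.+1) (iota j n.+1)) <->
  lattice_path m n i j z /\ e = path_inversions j z.
Proof.
elim: {m n}(m + n)%N {-2}m {-2}n (erefl (m + n)%N) i j e z => [|k IH] m n mnk i j e z.
  have [-> ->] : m = 0%N /\ n = 0%N by lia.
  rewrite inE; split=> [/eqP[-> ->]|].
    by split; [apply/lattice_path_cons; split=> //; constructor 1
              |rewrite /path_inversions big_ord0].
  case: z => [|c z]; first by case=> -[].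
  case=> /lattice_path_cons[-> [[_ _ ->]|[]//|[]//]] ->.
  by rewrite /path_inversions big_ord0.
rewrite [iota i _]/= [iota j _]/= in_paths_cons; last first.
  by rewrite /nilp !size_iota; lia.
have pc a b z' m1 n1 i1 j1 : lattice_path m1 n1 i1 j1 z' ->
    path_inversions j ((a, b) :: z') = ((i1 - a) * (b - j) + path_inversions j z')%N.
  case: z' => [[] //|d z'] /lattice_path_cons[-> _].
  by rewrite path_inversions_cons.
split.
- case=> z' -> [|[e' ->]].
  + case: m mnk => [|m] mnk; first by rewrite in_nil.
    rewrite -[j :: _]/(iota j n.+1) IH => [[l ->]|]; last by lia.
    split; first by apply/lattice_path_cons; split=> //; constructor 2; exists m.
    by rewrite (pc _ _ _ _ _ _ _ l) subnn muln0.
  + case: n mnk => [|n] mnk; first by [].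
    rewrite -[i :: _]/(iota i m.+1) IH => [[l ->]|]; last by lia.
    split; first by apply/lattice_path_cons; split=> //; constructor 3; exists n.
    by rewrite (pc _ _ _ _ _ _ _ l) size_iota (path_inversionsS l (ltnSn j)) subnn mul0n.
- case; case: z => [[] //|c z] /lattice_path_cons[-> [[? ? ?]|[m' em l]|[n' en l]]] ->; first by lia.
  + exists z => //; left; rewrite (pc _ _ _ _ _ _ _ l) subnn muln0 add0n em.
    by rewrite -[j :: _]/(iota j n.+1) IH //; lia.
  + exists z => //; right; exists (path_inversions j.+1 z).
      by rewrite (pc _ _ _ _ _ _ _ l) size_iota (path_inversionsS l (ltnSn j)) subnn mul0n.
    by rewrite en -[i :: _]/(iota i m.+1) IH //; lia.
Qed.

Lemma paths_uniq m n i j : uniq (paths (iota i m.+1) (iota j n.+1)).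
Proof.
elim: {m n}(m + n)%N {-2}m {-2}n (erefl (m + n)%N) i j => [|k IH] m n mnk i j.
  by have [-> ->] : m = 0%N /\ n = 0%N by lia.
rewrite [iota i _]/= [iota j _]/= [paths _ _]/= ifF; last first.
  by rewrite /nilp !size_iota; lia.
rewrite cat_uniq; apply/and3P; split.
- case: m mnk => [|m] mnk //; rewrite map_inj_in_uniq; first by apply: (IH m n); lia.
  by move=> [e z] [e' z'] _ _ [-> ->].
- apply/hasPn => _ /mapP[[e z] h ->]; apply/mapP => -[[e' z'] h' /= [_ zz]].
  case: m mnk h h' => [|m] mnk h h' //; case: n mnk h h' => [|n] mnk h h' //.
  move/(mem_paths m n.+1): h' => [l' _].
  move/(mem_paths m.+1 n): h => [l _]; rewrite -zz in l'.
  (* A tail common to both kinds of paths would start both at (i + 1, j) and at (i, j + 1). *)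
  case: z l l' {zz} => [[] //|c z] /lattice_path_cons[-> _] /lattice_path_cons[].
  by case=> e1; have := n_Sn i; rewrite -e1.
- case: n mnk => [|n] mnk //; rewrite map_inj_in_uniq; first by apply: (IH m n); lia.
  by move=> [e z] [e' z'] _ _ [/addnI -> ->].
Qed.

End LatticePaths.

Section ShuffleSum.
Variables p q : nat.
Local Notation path_pair :=
  ({ffun 'I_(p + q).+1 -> 'I_p.+1} * {ffun 'I_(p + q).+1 -> 'I_q.+1})%type.

Definition shuffle_path (ab : path_pair) : seq (nat * nat) :=
  mkseq (fun k => (val (ab.1 (inord k)), val (ab.2 (inord k)))) (p + q).+1.

Lemma shuffle_path_inj : injective shuffle_path.
Proof.
move=> [a b] [a' b'] /eqP; rewrite /shuffle_path => /eqP e.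
have h (i : 'I_(p + q).+1) : (val (a i), val (b i)) = (val (a' i), val (b' i)).
  have := congr1 (fun z => nth (0, 0)%N z i) e.
  by rewrite !nth_mkseq //= inord_val.
by congr (_, _); apply/ffunP => i; apply: val_inj; case: (h i).
Qed.

Lemma shuffleP (ab : path_pair) :
  reflect (lattice_path p q 0 0 (shuffle_path ab)) (shuffle ab).
Proof.
case: ab => a b.
apply: (iffP andP) => [[/forallP s /forallP h]|[_ h]] /=.
  split=> [|k l kl lpq]; first by rewrite size_mkseq.
  rewrite !nth_mkseq //=; last by lia.
  have := s (inord l); rewrite /= inordK // => /eqP ->.
  have /forallP/(_ (inord l)) := h (inord k).
  rewrite !inordK //; last by lia.
  move=> /implyP/(_ kl)/andP[-> ->]; split=> //=; rewrite ?add0n ?leq0n //=.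
  - by rewrite -ltnS.
  - by rewrite -ltnS.
split; apply/forallP => i.
  have := h i i (leqnn i) (ltn_ord i).
  by rewrite nth_mkseq //= inord_val add0n => -[->].
apply/forallP => j; apply/implyP => ij.
have := h i j ij (ltn_ord j); rewrite !nth_mkseq //= !inord_val.
by case=> _ _ _ -> ->.
Qed.

Lemma shuffle_signE (ab : path_pair) :
  shuffle_sign ab = path_inversions 0 (shuffle_path ab).
Proof.
rewrite /shuffle_sign /path_inversions size_mkseq [_.+1.-1]/=; apply: eq_bigr => k _.
have kpq := ltn_ord k.
by rewrite !nth_mkseq ?subn0 //; lia.
Qed.

Lemma shuffle_path_surj z : lattice_path p q 0 0 z ->
  exists ab : path_pair, shuffle_path ab = z.
Proof.
case=> sz h; exists ([ffun i : 'I__ => inord (nth (0, 0)%N z i).1],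
                     [ffun i : 'I__ => inord (nth (0, 0)%N z i).2]).
apply: (@eq_from_nth _ (0, 0)%N); rewrite size_mkseq // => k kpq.
rewrite nth_mkseq //= !ffunE (inordK kpq).
have [_ /andP[_ h1] /andP[_ h2] _ _] := h k k (leqnn k) kpq.
by rewrite !inordK ?ltnS //; case: nth.
Qed.

(** The shuffles with their signs and the listed paths with their exponents are the same pairs,
    without repetition on either side, so the sums differ by a permutation. *)
Lemma shuffle_sum (L : pzRingType) (Z : lmodType L) (Phi : seq (nat * nat) -> Z) :
  \sum_(ab : path_pair | shuffle ab)
     (-1) ^+ shuffle_sign ab *: Phi (shuffle_path ab) =
  shuf (iota 0 p.+1) (iota 0 q.+1) Phi.
Proof.
rewrite -big_enum /=.
rewrite -(big_map (fun ab => (shuffle_sign ab, shuffle_path ab)) xpredT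
            (fun t => (-1) ^+ t.1 *: Phi t.2)).
apply: perm_big; apply: uniq_perm.
- by rewrite map_inj_uniq ?enum_uniq // => ab ab' /(congr1 snd) /= /shuffle_path_inj.
- exact: paths_uniq.
case=> e z; apply/mapP/idP => [[ab]|].
  rewrite mem_enum => /shuffleP l [-> ->]; apply/(mem_paths p q).
  by rewrite shuffle_signE.
move/(mem_paths p q) => [l ->]; have [ab eab] := shuffle_path_surj l.
exists ab; last by rewrite shuffle_signE eab.
by rewrite mem_enum; apply/shuffleP; rewrite eab.
Qed.

End ShuffleSum.

(** * Chains on lists of vertices *)

Section SingularFamilies.
Variable R : realType.
Implicit Types X Y Z : topologicalType.

Lemma pull_id X n (s : sing R X n) : pull id s = s.
Proof.
apply: val_inj; apply: funext => v; congr (val s _); apply: val_inj.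
apply/rowP => j; rewrite !mxE (big_pred1 j) //.
Qed.

Lemma pull_push X Y m n (be : 'I_m.+1 -> 'I_n.+1) (f : X -> Y) (cf : continuous f)
    (s : sing R X n) : pull be (push cf s) = push cf (pull be s).
Proof. exact: val_inj. Qed.

Lemma pull_sing_pair X Y m n (be : 'I_m.+1 -> 'I_n.+1) (s : sing R X n)
    (t : sing R Y n) : pull be (sing_pair s t) = sing_pair (pull be s) (pull be t).
Proof. exact: val_inj. Qed.

(* By compatibility with pull, faces, diagonals and shuffles of the simplices of
   a family are computed on lists of vertices; a product of families has the
   pairs of vertices as its vertices. *)
Record family X (A : Type) := Family {
  fam :> forall n, ('I_n.+1 -> A) -> sing R X n;
  fam_pull : forall m n (be : 'I_m.+1 -> 'I_n.+1) h, pull be (fam h) = fam (h \o be)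
}.

Lemma pull_fam_subproof X n (s : sing R X n) l m (be : 'I_l.+1 -> 'I_m.+1)
    (h : 'I_m.+1 -> nat) :
  pull be (pull (fun i => inord (h i) : 'I_n.+1) s) =
  pull (fun i => inord ((h \o be) i) : 'I_n.+1) s.
Proof. by rewrite pull_comp. Qed.

(** Vertices are labelled by natural numbers, not ordinals, so that the label type does not depend
    on [n] and the simplex itself is the list [iota 0 n.+1]. *)
Definition pull_fam X n (s : sing R X n) : family X nat :=
  @Family X nat (fun m h => pull (fun i => inord (h i) : 'I_n.+1) s)
    (pull_fam_subproof s).

Lemma pair_fam_subproof X Y Z A B (mu : X * Y -> Z) (cmu : continuous mu)
    (fX : family X A) (fY : family Y B) l m (be : 'I_l.+1 -> 'I_m.+1)
    (h : 'I_m.+1 -> A * B) :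
  pull be (push cmu (sing_pair (fX m (fst \o h)) (fY m (snd \o h)))) =
  push cmu (sing_pair (fX l (fst \o (h \o be))) (fY l (snd \o (h \o be)))).
Proof. by rewrite pull_push pull_sing_pair !fam_pull. Qed.

Definition pair_fam X Y Z A B (mu : X * Y -> Z) (cmu : continuous mu)
    (fX : family X A) (fY : family Y B) : family Z (A * B) :=
  @Family Z (A * B) (fun m h => push cmu (sing_pair (fX m (fst \o h)) (fY m (snd \o h))))
    (pair_fam_subproof cmu fX fY).

Variable L : pzRingType.

(** The value 0 at the empty list turns the augmented boundary of lists into the singular boundary,
    for which points are cycles. *)
Definition kap X A (f : family X A) (v : seq A) : chain R L X :=
  if v is x :: w then sgen L (f (size w) (fun i => nth x v i)) else 0.

Lemma kapE X A (f : family X A) x0 v n : size v = n.+1 ->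
  kap f v = sgen L (f n (fun i => nth x0 v i)).
Proof.
case: v => // x w [<-]; congr (sgen _ (f _ _)); apply: funext => i.
by apply: set_nth_default; rewrite /= ltn_ord.
Qed.

Lemma kap_pull_fam X n (s : sing R X n) : kap (pull_fam s) (iota 0 n.+1) = sgen L s.
Proof.
rewrite (kapE _ 0%N (n := n)) ?size_iota //; congr (sgen _ _).
rewrite -[RHS]pull_id; congr (pull _ s); apply: funext => i.
by rewrite nth_iota ?ltn_ord // inord_val.
Qed.

Lemma kap_homog X A (f : family X A) v : homog (size v).-1%:Z (kap f v).
Proof.
case: v => [|x w]; first exact: hom0 (grade_hom _ _).
exact: (homog_fgen L (existT _ (size w) _)).
Qed.

Lemma hat_kap X A (f : family X A) v : hat (kap f v) = (-1) ^+ (size v).+1 *: kap f v.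
Proof.
rewrite (hat_homog (kap_homog f v)); case: v => [|x w]; first by rewrite !scaler0.
by apply: eq_sign_scale; rewrite /= negbK.
Qed.

Lemma kap_central X A (f : family X A) v : central (kap f v).
Proof. case: v => [|x w]; [exact: central0 | exact: fgen_central]. Qed.

End SingularFamilies.

Section ChainFormulas.
Variables (R : realType) (L : pzRingType).
Implicit Types X Y Z : topologicalType.

Lemma bnd_del (V : lmodType L) A (v : seq A) (Phi : seq A -> V) :
  bnd v Phi = \sum_(i < size v) (-1) ^+ i *: Phi (take i v ++ drop i.+1 v).
Proof.
elim: v Phi => [|x v IH] Phi; first by rewrite bnd_nil big_ord0.
rewrite bnd_cons big_ord_recl /= expr0 scale1r drop0; congr (_ + _).
rewrite IH -sumrN; apply: eq_bigr => i _.
by rewrite /bump /= add1n add0n exprS mulN1r scaleNr.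
Qed.

Lemma dgs_take (V : zmodType) A (v : seq A) (Phi : seq A -> seq A -> V) :
  dgs v Phi = \sum_(p < size v) Phi (take p.+1 v) (drop p v).
Proof.
elim: v Phi => [|x v IH] Phi; first by rewrite dgs_nil big_ord0.
rewrite dgs_cons big_ord_recl /= take0; congr (_ + _).
by rewrite IH; apply: eq_bigr => i _.
Qed.

Lemma bdry_hom X : is_hom (@bdry R L X).
Proof. by case: (@bdry_differential R L X) => -[]. Qed.

Lemma bdry_kap X A (f : family R X A) v : bdry (kap L f v) = bnd v (kap L f).
Proof.
case: v => [|x [|y w]]; first by rewrite bnd_nil (hom0 (@bdry_hom X)).
  by rewrite bnd_cons bnd_nil subr0 [LHS]linext_fgen.
rewrite [LHS]linext_fgen bnd_del; apply: eq_bigr => i _; congr (_ *: _).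
set v := [:: x, y & w].
have sv : size v = (size w).+2 by [].
have iv : (i < size v)%N by [].
rewrite (@kapE _ _ _ _ f x _ (size w)); last first.
  rewrite size_cat size_take size_drop iv.
  by move: iv sv; move: (size v) (nat_of_ord i) => n k; lia.
rewrite /face fam_pull; congr (sgen _ (f _ _)); apply: funext => j /=.
rewrite nth_cat size_take iv /bump.
case: (ltnP j i) => ji; first by rewrite add0n nth_take.
by rewrite nth_drop subnKC // add1n.
Qed.

Lemma diag_kap X A (f : family R X A) v :
  diag (kap L f v) = dgs v (fun a b => tens (kap L f a) (kap L f b)).
Proof.
case: v => [|x w].
  by rewrite dgs_nil; exact: (additive0 (linextD _)).
rewrite [LHS]linext_fgen dgs_take; apply: eq_bigr => p _.
have pw : (p < (size w).+1)%N by [].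
congr tens.
  rewrite (@kapE _ _ _ _ f x _ p); last by rewrite size_takel.
  rewrite fam_pull; congr (sgen _ (f _ _)); apply: funext => j.
  by rewrite /comp inordK ?nth_take //; have := ltn_ord j; lia.
rewrite (@kapE _ _ _ _ f x _ (size w - p)); last by rewrite size_drop /= subSn //; lia.
rewrite fam_pull; congr (sgen _ (f _ _)); apply: funext => j.
by rewrite /comp nth_drop inordK //; have := ltn_ord j; lia.
Qed.

Lemma chain_map_hom X Y (f : X -> Y) (cf : continuous f) : is_hom (@chain_map R L X Y f cf).
Proof. by apply: linext_hom => -[n s]; exact: fgen_central. Qed.

Lemma map_nth_iota A (x0 : A) (u : seq A) :
  map (nth x0 u) (iota 0 (size u)) = u.
Proof. exact: mkseq_nth. Qed.

(** Both lists are images of lists of indices, and [shuf] is natural in the vertices, so the formula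
    follows from [shuffle_sum]. *)
Lemma pairing_kap X Y Z A B (mu : X * Y -> Z) (cmu : continuous mu)
    (fX : family R X A) (fY : family R Y B) u w :
  chain_pairing cmu (kap L fX u) (kap L fY w) =
  shuf u w (kap L (pair_fam cmu fX fY)).
Proof.
have ch := chain_map_hom cmu.
case: u => [|x u].
  rewrite shuf_nill /chain_pairing (_ : cross _ _ = 0) ?(hom0 ch) //.
  exact: (additive0 (linextD _)).
case: w => [|y w].
  rewrite shuf_nilr /chain_pairing (_ : cross _ _ = 0) ?(hom0 ch) //.
  by rewrite /cross linext_fgen; exact: (additive0 (linextD _)).
rewrite /chain_pairing /cross !linext_fgen /=.
rewrite -[x :: u in RHS](map_nth_iota x) -[y :: w in RHS](map_nth_iota y).
rewrite shuf_map /= -shuffle_sum (hom_sum _ _ _ ch).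
apply: eq_bigr => ab _; rewrite (morph_sign _ _ (h := chain_map cmu)); last by case: ch.
congr (_ *: _); rewrite [LHS]linext_fgen.
rewrite (@kapE _ _ _ _ _ (x, y) _ (size u + size w)); last by rewrite size_map size_mkseq.
rewrite !fam_pull.
have e (i : 'I_(size u + size w).+1) :
    nth (x, y) [seq (nth x (x :: u) k.1, nth y (y :: w) k.2) | k <- shuffle_path ab] i =
    (nth x (x :: u) (ab.1 i), nth y (y :: w) (ab.2 i)).
  by rewrite (nth_map (0, 0)%N) ?size_mkseq // nth_mkseq // inord_val.
by congr (sgen _ (push _ (sing_pair (fX _ _) (fY _ _)))); apply: funext => i;
  rewrite [RHS]/comp e.
Qed.

End ChainFormulas.

(** * Linearity, Leibniz rule and associativity of pairings of chains *)

Section Pairings.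
Variables (R : realType) (L : pzRingType).
Implicit Types X Y Z : topologicalType.

Lemma linext_morph X (V W : lmodType L) (h : simplex R X -> V) (g : V -> W) c :
  {morph g : x y / x + y} -> (forall a x, g (a *: x) = a *: g x) ->
  g (linext h (c : chain R L X)) = linext (fun s => g (h s)) c.
Proof.
move=> gD gZ; have [r [ur cr _]] := fcoef_supp c c.
rewrite !(linextE _ ur cr) (additive_sum _ _ gD).
by apply: eq_bigr => s _; rewrite gZ.
Qed.

Lemma eq_linext X (V : lmodType L) (h h' : simplex R X -> V) (c : chain R L X) :
  h =1 h' -> linext h c = linext h' c.
Proof. by move=> /funext ->. Qed.

Lemma linext_fgenE X (c : chain R L X) : linext (@fgen L (sing R X)) c = c.
Proof.
have [r [ur cr _]] := fcoef_supp c c; rewrite (linextE _ ur cr).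
apply: freemod_ext => s; rewrite fcoef_sum.
have cg t : fcoef (fcoef c t *: fgen L t) s = if t == s then fcoef c s else 0.
  rewrite fcoefZ /fcoef SubK eq_sym; case: eqP => [->|_]; by rewrite ?mulr1 ?mulr0.
under eq_bigr do rewrite cg.
rewrite -big_mkcond /=; have [sr|sr] := boolP (s \in r).
  by rewrite (big_rem s) //= eqxx big_seq_cond big1 ?addr0 // => t /andP[];
     rewrite mem_rem_uniq // inE => /andP[/negbTE ->].
rewrite big_seq_cond big1 => [|t /andP[tr /eqP ts]]; last by rewrite -ts tr in sr.
by apply/esym/eqP; apply: contraR sr => /cr.
Qed.

Lemma chain_ext X (V : lmodType L) (h h' : chain R L X -> V) :
  {morph h : x y / x + y} -> (forall a x, h (a *: x) = a *: h x) ->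
  {morph h' : x y / x + y} -> (forall a x, h' (a *: x) = a *: h' x) ->
  (forall n (s : sing R X n), h (sgen L s) = h' (sgen L s)) -> h =1 h'.
Proof.
move=> hD hZ hD' hZ' hh' c; rewrite -[c]linext_fgenE.
rewrite (linext_morph _ _ hD hZ) (linext_morph _ _ hD' hZ').
by apply: eq_linext => -[n s]; exact: hh'.
Qed.

Lemma kap_shuf_central X A B (f : family R X (A * B)) u w :
  central (shuf u w (kap L f)).
Proof.
rewrite /shuf; elim: (paths u w) => [|p r IH]; first by rewrite big_nil; exact: central0.
rewrite big_cons => a; rewrite scalerDr rscaleDl IH (centralZ _ _) //.
exact: kap_central.
Qed.

Section OnePairing.
Variables (X Y Z : topologicalType) (mu : X * Y -> Z) (cmu : continuous mu).
Local Notation "c ** c'" := (chain_pairing (R := R) (L := L) cmu c c') (at level 40).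

Lemma simplex_cross_central (s : simplex R X) (t : simplex R Y) :
  central (simplex_cross L s t).
Proof.
case: s t => [p s] [q t] /= a; rewrite scaler_sumr rscale_suml.
by apply: eq_bigr => ab _; rewrite (centralZ _ _) //; exact: fgen_central.
Qed.

Lemma pairingDl c1 c2 c' : (c1 + c2) ** c' = c1 ** c' + c2 ** c'.
Proof.
by case: (@chain_map_hom R L _ _ _ cmu) => chD _ _; rewrite /chain_pairing /cross linextD chD.
Qed.

Lemma pairingZl a c c' : (a *: c) ** c' = a *: (c ** c').
Proof.
by case: (@chain_map_hom R L _ _ _ cmu) => _ chZ _; rewrite /chain_pairing /cross linextZ chZ.
Qed.

Lemma pairingDr c c1 c2 : c ** (c1 + c2) = c ** c1 + c ** c2.
Proof.
case: (@chain_map_hom R L _ _ _ cmu) => chD _ _; rewrite /chain_pairing /cross -chD.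
have [r [ur cr _]] := fcoef_supp c c; rewrite !(linextE _ ur cr) -big_split.
by congr chain_map; apply: eq_bigr => s _; rewrite linextD scalerDr.
Qed.

Lemma pairing_balanced c a c' : (rscale c a) ** c' = c ** (a *: c').
Proof.
rewrite /chain_pairing /cross; congr chain_map.
have [r [ur cr cr']] := fcoef_supp c (rscale c a).
rewrite (linextE _ ur cr) (linextE _ ur cr'); apply: eq_bigr => s _.
by rewrite linextZ scalerA [fcoef (rscale c a) s]fcoefR.
Qed.

Lemma pairingR c c' a : c ** (rscale c' a) = rscale (c ** c') a.
Proof.
case: (@chain_map_hom R L _ _ _ cmu) => _ _ chR; rewrite /chain_pairing -chR; congr chain_map.
rewrite /cross (@linext_morph _ _ _ _ (fun x => rscale x a)) => [|x y|b x].
- apply: eq_linext => s; have [_ _ ->//] := linext_hom (simplex_cross_central s).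
- by rewrite rscaleDl.
- by rewrite scale_rscale.
Qed.

(** A scalar passes simplices, though not arbitrary chains. This is what allows reduction to
    simplices in the second variable once the first one is a simplex. *)
Lemma pairingZr c a c' : central c -> c ** (a *: c') = a *: (c ** c').
Proof. by move=> cc; rewrite -pairing_balanced -cc pairingZl. Qed.

Lemma sgen_homog n (s : sing R X n) : homog n%:Z (sgen L s).
Proof. exact: (homog_fgen L (existT _ n s)). Qed.

Lemma pairing_homog p q c c' : homog (Posz p) c -> homog (Posz q) c' ->
  homog (Posz (p + q)) (c ** c').
Proof.
move=> hc hc'; have [_ hm] : hom_of_degree 0 (@chain_map R L _ _ mu cmu).
  split; first exact: (@chain_map_hom R L _ _ _ cmu).
  move=> n x hx; rewrite addr0; apply: linext_homog hx => -[m s] /= <-.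
  exact: (homog_fgen L (existT _ m _)).
rewrite -[Posz _]addr0; apply: hm.
apply: (linext_homog _ hc) => s <- {hc}.
apply: (linext_homog (h := simplex_cross L s) _ hc') => t <- {hc'}.
case: s t => [p' s] [q' t] /=.
rewrite /homog (hom_sum _ _ _ (grade_hom _ _)); apply: eq_bigr => ab _.
by rewrite gradeZ; congr (_ *: _); exact: (homog_fgen L (existT _ (p' + q')%N _)).
Qed.

Lemma bdry_central X' n (s : sing R X' n) : central (bdry (sgen L s)).
Proof. by rewrite /bdry linext_fgen; exact: simplex_bdry_central. Qed.

(** Both sides are left linear in [c] and, for a simplex [c], also in [c']; on simplices the
    identity is [bnd_shuf]. *)
Lemma bdry_pairing c c' :
  bdry (c ** c') = bdry c ** c' + hat c ** bdry c'.
Proof.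
have [bD bZ _] := @bdry_hom R L X; have [bDY bZY _] := @bdry_hom R L Y.
have [bDZ bZZ _] := @bdry_hom R L Z; have [hD hZ _] := @hat_hom L (chain R L X).
move: c; apply: chain_ext => [c1 c2|a c|c1 c2|a c|p s].
- by rewrite pairingDl bDZ.
- by rewrite pairingZl bZZ.
- by rewrite bD hD !pairingDl; zmod.
- by rewrite bZ hZ !pairingZl scalerDr.
have cs : central (sgen L s) by exact: fgen_central.
have chs : central (hat (sgen L s)).
  by rewrite (hat_homog (sgen_homog s)); exact: centralZ.
move: c'; apply: chain_ext => [c1 c2|a c|c1 c2|a c|q t].
- by rewrite pairingDr bDZ.
- by rewrite pairingZr // bZZ.
- by rewrite bDY !pairingDr; zmod.
- by rewrite bZY !pairingZr ?scalerDr //; exact: bdry_central.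
rewrite -!kap_pull_fam pairing_kap.
have [bDb _ _] := @bdry_hom R L Z.
transitivity (shuf (iota 0 p.+1) (iota 0 q.+1)
   (fun z => bnd z (kap L (pair_fam cmu (pull_fam s) (pull_fam t))))).
  rewrite /shuf (additive_sum _ _ bDb); apply: eq_bigr => z _.
  by rewrite (morph_sign _ _ bDb) bdry_kap.
(* The augmentation term disappears because [kap] is 0 on the empty list. *)
rewrite bnd_shuf [X in _ + X](_ : _ = 0) ?addr0; last by case: ifP.
rewrite !bdry_kap hat_kap; congr (_ + _).
  rewrite (bnd_morph _ _ (h := fun c => c ** kap L (pull_fam t) (iota 0 q.+1))).
    by apply: eq_bnd => u _; rewrite pairing_kap.
  by move=> c1 c2; rewrite pairingDl.
rewrite (morph_sign _ _ (h := fun c => c ** _)); last by move=> c1 c2; rewrite pairingDl.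
rewrite exprS mulN1r scaleNr; congr (- (_ *: _)).
rewrite (bnd_morph _ _ (pairingDr _)).
by apply: eq_bnd => u _; rewrite pairing_kap.
Qed.

End OnePairing.
End Pairings.

Lemma kap_map (R : realType) (L : pzRingType) (X : topologicalType) A A'
    (f : family R X A) (f' : family R X A') (g : A' -> A) v :
  (forall n (h : 'I_n.+1 -> A'), f n (g \o h) = f' n h) ->
  kap L f [seq g x | x <- v] = kap L f' v.
Proof.
case: v => [|x v] e //; rewrite (kapE _ _ (g x) (n := size v)) ?size_map //.
congr sgen; rewrite -e; congr (f _ _); apply: funext => i.
exact: (@nth_map _ x _ (g x) g i (x :: v)).
Qed.

Section PairingAssociativity.
Variables (R : realType) (L : pzRingType).
Variables X Y W P S Q : topologicalType.
Variables (mXY : X * Y -> P) (mPW : P * W -> Q) (mYW : Y * W -> S) (mXS : X * S -> Q).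
Hypotheses (cXY : continuous mXY) (cPW : continuous mPW).
Hypotheses (cYW : continuous mYW) (cXS : continuous mXS).
Hypothesis assoc : forall x y w, mPW (mXY (x, y), w) = mXS (x, mYW (y, w)).

Lemma pairing_assoc (c : chain R L X) (c' : chain R L Y) (c'' : chain R L W) :
  chain_pairing cPW (chain_pairing cXY c c') c'' =
  chain_pairing cXS c (chain_pairing cYW c' c'').
Proof.
move: c; apply: chain_ext => [x y|a x|x y|a x|p s]; rewrite ?pairingDl ?pairingZl //.
have cs : central (sgen L s) by exact: fgen_central.
move: c'; apply: chain_ext => [x y|a x|x y|a x|q t].
- by rewrite pairingDr pairingDl.
- by rewrite pairingZr // pairingZl.
- by rewrite pairingDl pairingDr.
- by rewrite pairingZl pairingZr.
have ct : central (sgen L t) by exact: fgen_central.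
move: c''; apply: chain_ext => [x y|a x|x y|a x|r u].
- by rewrite pairingDr.
- by rewrite pairingZr // -!kap_pull_fam pairing_kap; exact: kap_shuf_central.
- by rewrite !pairingDr.
- by rewrite !pairingZr.
rewrite -!kap_pull_fam !pairing_kap.
set i := iota 0 p.+1; set j := iota 0 q.+1; set k := iota 0 r.+1.
set fXY := pair_fam _ _ _; set fYW := pair_fam _ _ _.
transitivity (shuf i j (fun z => shuf z k (kap L (pair_fam cPW fXY (pull_fam u))))).
  rewrite {1}/shuf (additive_sum _ _ (h := fun c => chain_pairing cPW c _)).
    apply: eq_bigr => z _.
    rewrite (morph_sign _ _ (h := fun c => chain_pairing cPW c _)) ?pairing_kap //.
    by move=> x y; rewrite pairingDl.
  by move=> x y; rewrite pairingDl.
rewrite shuf_assoc {1}/shuf [in RHS]/shuf (additive_sum _ _ (pairingDr _ _)).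
apply: eq_bigr => z _; rewrite (morph_sign _ _ (pairingDr _ _)) pairing_kap.
congr (_ *: _); apply: eq_shuf => v _ _.
apply: kap_map => n h; apply: val_inj; apply: funext => x /=.
by rewrite /comp /= assoc.
Qed.

End PairingAssociativity.

(** * Iterated diagonals of chains *)

Lemma tens_central (L : pzRingType) (M N : gbimodType L) (x : M) (y : N) :
  central x -> central y -> central (tens x y).
Proof.
move=> xc yc a; have [_ _ tb] := tens_balanced M N.
by rewrite [_ *: _]tscale_tens [RHS]trscale_tens xc tb yc.
Qed.

(** What is needed to evaluate on an iterated diagonal: without linearity at the two ends and
    without degrees it makes sense for values in an abelian group and survives fixing the first
    entry. *)
Definition slot_balanced (L : pzRingType) (M : gbimodType L) (N : zmodType)
    (F : seq M -> N) : Prop :=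
  multiadditive F /\
  forall s x a y s', F (s ++ rscale x a :: y :: s') = F (s ++ x :: a *: y :: s').

Lemma slot_balanced_cons (L : pzRingType) (M : gbimodType L) (N : zmodType)
    (F : seq M -> N) x : slot_balanced F -> slot_balanced (fun s => F (x :: s)).
Proof.
case=> FD FB; split; first exact: multiadditive_cons.
by move=> s y a z s'; exact: (FB (x :: s)).
Qed.

Section IteratedDiagonal.
Variables (R : realType) (L : pzRingType) (X : topologicalType).
Local Notation K := (chain R L X).
Local Notation dg := (@diag R L X).

Lemma diag_hom : is_hom dg.
Proof.
apply: linext_hom => -[n s]; apply: central_sum => p.
by apply: tens_central; exact: fgen_central.
Qed.

Section Zmod.
Variable N : zmodType.
Implicit Types F G : seq K -> N.

Lemma eq_iter_diag i F G k : (forall x s, F (x :: s) = G (x :: s)) ->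
  iter_diag dg i F k = iter_diag dg i G k.
Proof.
elim: i F G k => [|i IH] F G k FG /=; first exact: FG.
congr (tlift _ _); apply: funext => x; apply: funext => y.
by apply: IH => z s; exact: FG.
Qed.

Lemma iter_diagD i F G k :
  iter_diag dg i (fun s => F s + G s) k = iter_diag dg i F k + iter_diag dg i G k.
Proof.
elim: i F G k => [//|i IH] F G k /=; rewrite /tlift /fsum -big_split.
by apply: eq_bigr => u _; rewrite IH.
Qed.

Definition scale_head (a : L) (s : seq K) : seq K :=
  if s is x :: s' then a *: x :: s' else s.

Fixpoint scale_last (s : seq K) (a : L) : seq K :=
  match s with
  | [::] => [::]
  | [:: x] => [:: rscale x a]
  | x :: s' => x :: scale_last s' a
  end.

Lemma iter_diag_linear i F : slot_balanced F ->
  (forall k k', iter_diag dg i F (k + k') = iter_diag dg i F k + iter_diag dg i F k')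
  /\ forall a k, iter_diag dg i F (a *: k) = iter_diag dg i (fun s => F (scale_head a s)) k.
Proof.
have [dD dZ _] := diag_hom.
elim: i F => [|i IH] F FB.
  by split=> // k k' /=; case: FB => FD _; exact: (FD [::]).
have bal G : slot_balanced G ->
    balanced (fun x y => iter_diag dg i (fun s => G (x :: s)) y).
  move=> GB; have [GD Gb] := GB; split=> [x x' y|x y y'|x a y].
  - by rewrite -iter_diagD; apply: eq_iter_diag => z s; exact: (GD [::]).
  - by have [-> _] := IH _ (slot_balanced_cons x GB).
  - have [_ ->] := IH _ (slot_balanced_cons x GB).
    by apply: eq_iter_diag => z s /=; exact: (Gb [::]).
split=> [k k'|a k] /=; first by rewrite dD tliftD //; exact: bal.
rewrite dZ; move: (dg k); apply: tensor_ext => [t u|t u|x y].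
- by rewrite scalerDr tliftD //; exact: bal.
- have hb : balanced (fun x y => iter_diag dg i (fun s => F (a *: x :: s)) y).
    have [b1 b2 b3] := bal _ FB; split=> *; rewrite ?scalerDr ?b1 ?b2 //.
    by rewrite scale_rscale b3.
  by rewrite tliftD.
have hb : balanced (fun x y => iter_diag dg i (fun s => F (a *: x :: s)) y).
  have [b1 b2 b3] := bal _ FB; split=> *; rewrite ?scalerDr ?b1 ?b2 //.
  by rewrite scale_rscale b3.
by rewrite [a *: _]tscale_tens !tlift_tens //; exact: bal.
Qed.

Lemma iter_diag_balanced i F : slot_balanced F ->
  balanced (fun x y => iter_diag dg i (fun s => F (x :: s)) y).
Proof.
move=> FB; have [FD Fb] := FB; split=> [x x' y|x y y'|x a y].
- by rewrite -iter_diagD; apply: eq_iter_diag => z s; exact: (FD [::]).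
- by have [-> _] := iter_diag_linear i (slot_balanced_cons x FB).
- have [_ ->] := iter_diag_linear i (slot_balanced_cons x FB).
  by apply: eq_iter_diag => z s /=; exact: (Fb [::]).
Qed.

Lemma iter_diag_rscale i F a k : slot_balanced F ->
  iter_diag dg i F (rscale k a) = iter_diag dg i (fun s => F (scale_last s a)) k.
Proof.
have [_ _ dR] := diag_hom.
elim: i F k => [//|i IH] F k FB /=.
have bF := iter_diag_balanced i FB.
have e x y : iter_diag dg i (fun s => F (scale_last (x :: s) a)) y =
    iter_diag dg i (fun s => F (x :: s)) (rscale y a).
  rewrite IH; last exact: slot_balanced_cons.
  by apply: eq_iter_diag => z s.
transitivity (tlift (fun x y => iter_diag dg i (fun s => F (x :: s)) (rscale y a)) (dg k));
  last by congr (tlift _ _); apply: funext => x; apply: funext => y; rewrite -e.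
rewrite dR.
have [b1 b2 b3] := bF.
have bF' : balanced (fun x y => iter_diag dg i (fun s => F (x :: s)) (rscale y a)).
  split=> [x x' y|x y y'|x c y]; rewrite ?rscaleDl ?b1 ?b2 //.
  by rewrite b3 scale_rscale.
move: (dg k); apply: tensor_ext => [t u|t u|x y].
- by rewrite rscaleDl tliftD.
- by rewrite tliftD.
- by rewrite [rscale _ _]trscale_tens !tlift_tens.
Qed.

Lemma iter_diag_kap A (f : family R X A) i F v : slot_balanced F ->
  iter_diag dg i.+1 F (kap L f v) =
  dgs v (fun a b => iter_diag dg i (fun s => F (kap L f a :: s)) (kap L f b)).
Proof.
move=> FB /=; rewrite diag_kap /dgs tlift_sum; last exact: iter_diag_balanced.
by apply: eq_bigr => ab _; rewrite tlift_tens //; exact: iter_diag_balanced.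
Qed.

End Zmod.

Lemma iter_diag_morph (N N' : zmodType) (h : N -> N') i F k :
  {morph h : x y / x + y} ->
  h (iter_diag dg i F k) = iter_diag dg i (fun s => h (F s)) k.
Proof.
move=> hD; elim: i F k => [//|i IH] F k /=; rewrite /tlift /fsum (additive_sum _ _ hD).
by apply: eq_bigr => u _; rewrite IH.
Qed.

End IteratedDiagonal.

Section DiagonalSum.
Variables (R : realType) (L : pzRingType) (X : topologicalType).
Local Notation K := (chain R L X).
Local Notation dg := (@diag R L X).
Variables (M : gbimodType L) (phi : K -> M).
Hypothesis phi_hom : is_hom phi.
Hypothesis phi_short : forall A (f : family R X A) v, (size v <= 1)%N -> phi (kap L f v) = 0.

(* Psi x is applied to the values of phi on all the tensor factors of the
   iterated diagonal but the first one, which is x. *)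
Definition based (N : zmodType) (Psi : K -> seq M -> N) (s : seq K) : N :=
  Psi (head 0 s) (map phi (behead s)).

Definition dsum (N : zmodType) (Psi : K -> seq M -> N) (k : K) : N :=
  \sum_(i \in [set: nat]) iter_diag dg i (based Psi) k.

Definition based_balanced (N : zmodType) (Psi : K -> seq M -> N) : Prop :=
  [/\ forall x y s, Psi (x + y) s = Psi x s + Psi y s,
      forall x, multiadditive (Psi x),
      forall x a y s, Psi (rscale x a) (y :: s) = Psi x (a *: y :: s)
    & forall x s y a z s', Psi x (s ++ rscale y a :: z :: s') = Psi x (s ++ y :: a *: z :: s')].

Section Zmod.
Variable N : zmodType.
Variable Psi : K -> seq M -> N.
Hypothesis PsiB : based_balanced Psi.

Lemma based_slot_balanced : slot_balanced (based Psi).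
Proof.
have [pD pZ pR] := phi_hom; have [P1 P2 P3 P4] := PsiB.
split=> [[|x s] y z s'|[|x s] y a z s']; rewrite /based /= ?P1 ?P3 ?pZ //.
- by rewrite !map_cat /= pD P2.
- by rewrite !map_cat /= pR pZ P4.
Qed.

Lemma iter_diag_short A (f : family R X A) i v (F : seq M -> N) :
  slot_balanced (fun s : seq K => F (map phi s)) -> vanishing F -> (size v <= i.+1)%N ->
  iter_diag dg i (fun s => F (map phi s)) (kap L f v) = 0.
Proof.
elim: i v F => [|i IH] v F FB F0 vi.
  by rewrite /= phi_short // F0 ?inE.
rewrite iter_diag_kap //.
rewrite (eq_dgs (Psi := fun _ _ => 0)); first by rewrite /dgs big1.
move=> a b a0 b0 ab; have [a1|a1] := leqP (size a) 1.
  rewrite (@eq_iter_diag _ _ _ _ _ _ (fun=> 0)) => [|x s].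
    have := @iter_diag_morph R L X N N (fun=> 0) i (fun=> 0) (kap L f b).
    by move=> <- // x y; rewrite addr0.
  by rewrite /= phi_short // F0 ?inE ?eqxx.
apply: (IH b (fun s => F (phi (kap L f a) :: s))); last by lia.
- exact: (slot_balanced_cons (kap L f a) FB).
- exact: vanishing_cons.
Qed.

(** Term [i] applies [phi] to [i] pieces, each of which needs an edge, and a list of at most [i]
    vertices has fewer than [i] edges. *)
Lemma based_short A (f : family R X A) i v : (size v <= i)%N ->
  iter_diag dg i (based Psi) (kap L f v) = 0.
Proof.
have PB := based_slot_balanced; have [P1 P2 P3 P4] := PsiB.
case: i => [|i] vi.
  by move: vi; rewrite leqn0 => /nilP -> /=; rewrite /based /=; apply: (additive0 (fun x y => P1 x y [::])).
rewrite iter_diag_kap //.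
rewrite (eq_dgs (Psi := fun _ _ => 0)); first by rewrite /dgs big1.
move=> a b a0 b0 ab; apply: (@iter_diag_short _ f i b (Psi (kap L f a))); last by lia.
- exact: (slot_balanced_cons (kap L f a) PB).
- exact: multiadditive_vanishing.
Qed.

End Zmod.

Lemma based_balanced_scale (N : zmodType) (Psi : K -> seq M -> N) a :
  based_balanced Psi -> based_balanced (fun x => Psi (a *: x)).
Proof.
case=> P1 P2 P3 P4; split=> *; rewrite ?scalerDr ?P1 ?P4 //.
by rewrite scale_rscale P3.
Qed.

Lemma based_scale_head (N : zmodType) (Psi : K -> seq M -> N) i a k :
  iter_diag dg i (fun s => based Psi (scale_head a s)) k =
  iter_diag dg i (based (fun x => Psi (a *: x))) k.
Proof. exact: eq_iter_diag. Qed.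

(** Local finiteness of [dsum]: the bound is one more than the largest dimension of a simplex
    occurring in [k]. *)
Lemma based_bounded (N : zmodType) (Psi : K -> seq M -> N) k : based_balanced Psi ->
  exists n, forall i, (n <= i)%N -> iter_diag dg i (based Psi) k = 0.
Proof.
move=> PB; have [r [ur cr _]] := fcoef_supp k k.
exists (\max_(s <- r) (tag s).+1)%N => i ri.
have kE : k = \sum_(s <- r) fcoef k s *: fgen L s.
  by rewrite -{1}[k]linext_fgenE (linextE _ ur cr).
have [iD iZ] := iter_diag_linear i (based_slot_balanced PB).
rewrite kE (additive_sum _ _ iD) big_seq big1 // => -[n s] sr.
rewrite iZ based_scale_head -[fgen L _]/(sgen L s) -kap_pull_fam based_short //.
  exact: based_balanced_scale.
rewrite size_iota (leq_trans _ ri) //.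
exact: (leq_bigmax_seq (F := fun s : simplex R X => (tag s).+1) _ sr).
Qed.

Lemma dsumE (N : zmodType) (Psi : K -> seq M -> N) k n :
  (forall i, (n <= i)%N -> iter_diag dg i (based Psi) k = 0) ->
  dsum Psi k = \sum_(i < n) iter_diag dg i (based Psi) k.
Proof.
move=> h; rewrite /dsum (fsbigE (index_iota 0 n)) ?iota_uniq //.
  by rewrite (eq_bigl xpredT) ?big_mkord // => i; rewrite in_setT.
by move=> i _; rewrite mem_index_iota /=; case: (leqP n i) => // /h ->.
Qed.

Lemma dsumDr (N : zmodType) (Psi : K -> seq M -> N) k k' : based_balanced Psi ->
  dsum Psi (k + k') = dsum Psi k + dsum Psi k'.
Proof.
move=> PB; have [n h] := based_bounded k PB; have [n' h'] := based_bounded k' PB.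
have iD i := (iter_diag_linear i (based_slot_balanced PB)).1.
rewrite !(@dsumE _ _ _ (maxn n n')) => [|i|i|i]; rewrite ?geq_max.
- by rewrite -big_split; apply: eq_bigr => i _; exact: iD.
- by case/andP => _ /h'.
- by case/andP => /h.
- by case/andP => /h e /h' e'; rewrite iD e e' addr0.
Qed.

Lemma dsumZ (N : zmodType) (Psi : K -> seq M -> N) a k : based_balanced Psi ->
  dsum Psi (a *: k) = dsum (fun x => Psi (a *: x)) k.
Proof.
move=> PB; apply: eq_fsbigr => i _.
have [_ ->] := iter_diag_linear i (based_slot_balanced PB).
exact: based_scale_head.
Qed.

Lemma dsumR (N : zmodType) (Psi Psi' : K -> seq M -> N) a k : based_balanced Psi ->
  (forall x, Psi (rscale x a) [::] = Psi' x [::]) ->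
  (forall x s y, Psi x (rcons s (rscale y a)) = Psi' x (rcons s y)) ->
  dsum Psi (rscale k a) = dsum Psi' k.
Proof.
move=> PB e1 e2; apply: eq_fsbigr => i _.
rewrite iter_diag_rscale; last exact: based_slot_balanced.
apply: eq_iter_diag => x s; have [_ _ pR] := phi_hom.
elim/last_ind: s => [|s y _]; first by rewrite /based /= e1.
have -> : scale_last (x :: rcons s y) a = x :: rcons s (rscale y a).
  elim: s x => [//|z s IH] x; rewrite rcons_cons.
  by rewrite -[LHS]/(x :: scale_last (z :: rcons s y) a) IH.
by rewrite /based /= !map_rcons pR e2.
Qed.

Lemma dsum_morph (N N' : zmodType) (h : N -> N') (Psi : K -> seq M -> N) k :
  based_balanced Psi -> {morph h : x y / x + y} ->
  h (dsum Psi k) = dsum (fun x s => h (Psi x s)) k.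
Proof.
move=> PB hD; have [n b] := based_bounded k PB.
rewrite (dsumE b) (@dsumE _ _ _ n) => [|i /b e].
  by rewrite (additive_sum _ _ hD); apply: eq_bigr => i _; rewrite (iter_diag_morph _ _ _ hD).
by rewrite -(additive0 hD) -e (iter_diag_morph _ _ _ hD).
Qed.

Lemma dsumDl (N : zmodType) (Psi Psi' : K -> seq M -> N) k :
  based_balanced Psi -> based_balanced Psi' ->
  dsum (fun x s => Psi x s + Psi' x s) k = dsum Psi k + dsum Psi' k.
Proof.
move=> PB PB'; have [n b] := based_bounded k PB; have [n' b'] := based_bounded k PB'.
have iD i : iter_diag dg i (based (fun x s => Psi x s + Psi' x s)) k =
    iter_diag dg i (based Psi) k + iter_diag dg i (based Psi') k.
  by rewrite -iter_diagD; apply: eq_iter_diag.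
rewrite !(@dsumE _ _ _ (maxn n n')) => [|i|i|i]; rewrite ?geq_max.
- by rewrite -big_split; apply: eq_bigr => i _; exact: iD.
- by case/andP => _ /b'.
- by case/andP => /b.
- by case/andP => /b e /b' e'; rewrite iD e e' addr0.
Qed.

(** The bridge from iterated diagonals of chains to sums over cuts of lists: term [i] of [dsum]
    consists of the cuts with [i] pieces after the first. *)
Lemma dsum_kap A (f : family R X A) (N : zmodType) (Psi : K -> seq M -> N) v :
  based_balanced Psi ->
  dsum Psi (kap L f v) = esum (fun u => phi (kap L f u)) v (fun a s => Psi (kap L f a) s).
Proof.
move=> PB; have PB' := based_slot_balanced PB.
(* One term is split off for the uncut list; the other [(size v).+1] are those counted by
   [tsum_upto] with bound [size v]. *)
rewrite (@dsumE _ _ _ (size v).+2) => [|i vi]; last first.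
  by apply: based_short => //; lia.
rewrite big_ord_recl; congr (_ + _).
under eq_bigr => i _ do rewrite iter_diag_kap //.
rewrite -dgs_sum; apply: eq_dgs => a b a0 b0 ab.
have [_ P2 _ _] := PB.
rewrite -(@tsum_upto_tsum _ _ _ _ _ (size v)); first last.
- by lia.
- by apply: multiadditive_vanishing; exact: P2.
- by move=> u; exact: phi_short.
have FB : slot_balanced (fun s => Psi (kap L f a) (map phi s)).
  exact: (slot_balanced_cons (kap L f a) PB').
move: (size v) => n.
rewrite [LHS](_ : _ = \sum_(i < n.+1) iter_diag dg i (fun s => Psi (kap L f a) (map phi s)) (kap L f b)) //.
elim: n b {ab b0} (Psi (kap L f a)) FB => [|n IH] b F FB; first by rewrite tsum_upto0 big_ord1.
rewrite tsum_uptoS big_ord_recl; congr (_ + _).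
under eq_bigr => i _ do rewrite iter_diag_kap //.
rewrite -dgs_sum; apply: eq_dgs => c d _ _ _.
by rewrite (IH d (fun s => F (phi (kap L f c) :: s))) //; exact: (slot_balanced_cons (kap L f c) FB).
Qed.

End DiagonalSum.

(** * Maps defined by iterated diagonals *)

Section TwistedMaps.
Variables (R : realType) (L : pzRingType) (X : topologicalType).
Local Notation K := (chain R L X).

(** The linearity part of [multihom_mod]. Degrees are left out so that it covers module operations,
    morphisms and the gauge map alike. *)
Definition multilinear_mod (M P Q : gbimodType L) (G : seq M -> P -> Q) : Prop :=
  [/\ (forall b, multiadditive (G^~ b)) /\ (forall s, {morph G s : b c / b + c}),
      (forall a x s b, G (a *: x :: s) b = a *: G (x :: s) b) /\
      (forall a b, G [::] (a *: b) = a *: G [::] b),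
      forall s b a, G s (rscale b a) = rscale (G s b) a,
      forall s x a y s' b, G (s ++ rscale x a :: y :: s') b = G (s ++ x :: a *: y :: s') b
    & forall s x a b, G (rcons s (rscale x a)) b = G (rcons s x) (a *: b)].

Lemma multihom_mod_linear (M P Q : gbimodType L) r (G : seq M -> P -> Q) :
  multihom_mod r G -> multilinear_mod G.
Proof. by case=> g1 g2 g3 g4 [g5 g6 _]; split=> //; split=> // b s x y s'; exact: g1. Qed.

Variables (M P Q : gbimodType L) (phi : K -> M) (h : K -> K) (G : seq M -> P -> Q).
Hypothesis phi_hom : is_hom phi.
Hypothesis phi_short : forall A (f : family R X A) v, (size v <= 1)%N -> phi (kap L f v) = 0.
Hypothesis h_hom : is_hom h.
Hypothesis G_lin : multilinear_mod G.

(* k (x) b |-> sum of h k_0 (x) G [:: phi k_1; ...; phi k_r] b over the terms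
   k_0 (x) ... (x) k_r of all the iterated diagonals of k. *)
Definition emap : tensor K P -> tensor K Q :=
  tlift (fun k b => dsum phi (fun x s => tens (h x) (G s b)) k).

Lemma emap_based b : based_balanced (fun x s => tens (h x) (G s b)).
Proof.
have [t1 t2 t3] := tens_balanced K Q; have [hD hZ hR] := h_hom.
have [[g1 _] [g3 _] _ g5 _] := G_lin.
split=> *; rewrite ?hD ?t1 ?hR ?t3 ?g3 ?g5 //.
by move=> s y z s'; rewrite g1 t2.
Qed.

Lemma emap_balanced : balanced (fun k b => dsum phi (fun x s => tens (h x) (G s b)) k).
Proof.
have [t1 t2 t3] := tens_balanced K Q; have [hD hZ hR] := h_hom.
have [[g1 g2] [g3 g3'] _ g5 g6] := G_lin.
split=> [k k' b|k b b'|k a b].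
- exact: (dsumDr phi_hom phi_short _ _ (emap_based b)).
- rewrite -(dsumDl phi_hom phi_short _ (emap_based b) (emap_based b')).
  by congr (dsum _ _ _); apply: funext => x; apply: funext => s; rewrite g2 t2.
- rewrite (dsumR phi_hom (Psi' := fun x s => tens (h x) (G s (a *: b))) k (emap_based b)) // => [x|x s y].
    by rewrite hR t3 g3'.
  by rewrite g6.
Qed.

(** Taken with [h] equal to [hat] this covers the perturbing part of a twisted differential, with
    [h] the identity the comparison maps Theta and [gauge]. *)
Lemma emap_hom : is_hom emap.
Proof.
have [t1 t2 t3] := tens_balanced K Q; have [hD hZ hR] := h_hom.
have [[g1 g2] [g3 g3'] g4 g5 g6] := G_lin.
have eD : {morph emap : t u / t + u} by move=> t u; apply: tliftD emap_balanced.
split=> // [a|t a].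
- apply: tensor_ext => [t u|t u|x y]; rewrite ?scalerDr ?eD ?scalerDr //.
  rewrite [a *: tens x y]tscale_tens /emap !tlift_tens; try exact: emap_balanced.
  rewrite (dsumZ phi_hom _ _ (emap_based y)).
  rewrite (dsum_morph phi_hom phi_short _ (emap_based y) (scalerDr a)).
  by congr (dsum _ _ _); apply: funext => u; apply: funext => s; rewrite hZ [RHS]tscale_tens.
- move: t; apply: tensor_ext => [t u|t u|x y]; rewrite ?rscaleDl ?eD ?rscaleDl //.
  rewrite [rscale (tens x y) a]trscale_tens /emap !tlift_tens; try exact: emap_balanced.
  rewrite (dsum_morph phi_hom phi_short (h := fun t => rscale t a) _ (emap_based y)); last first.
    by move=> t u; rewrite rscaleDl.
  by congr (dsum _ _ _); apply: funext => u; apply: funext => s; rewrite g4 [RHS]trscale_tens.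
Qed.

Lemma emap_kap A (f : family R X A) v b :
  emap (tens (kap L f v) b) =
  esum (fun u => phi (kap L f u)) v (fun a s => tens (h (kap L f a)) (G s b)).
Proof.
rewrite /emap tlift_tens; last exact: emap_balanced.
exact: (dsum_kap phi_hom phi_short f v (emap_based b)).
Qed.

End TwistedMaps.

(** * Degrees of maps out of a tensor product *)

Section TensorDegrees.
Variables (R : realType) (L : pzRingType) (X : topologicalType).
Local Notation K := (chain R L X).

Lemma homogD (N : gbimodType L) z (x y : N) : homog z x -> homog z y -> homog z (x + y).
Proof. by case: z => n /=; [rewrite gradeD => -> -> | move=> -> ->; rewrite addr0]. Qed.

Lemma homog0 (N : gbimodType L) z : homog z (0 : N).
Proof. by case: z => n //=; exact: hom0 (grade_hom N n). Qed.

Lemma homog_sum (N : gbimodType L) z I (r : seq I) (F : I -> N) :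
  (forall i, homog z (F i)) -> homog z (\sum_(i <- r) F i).
Proof.
move=> hF; elim: r => [|i r IH]; first by rewrite big_nil; exact: homog0.
by rewrite big_cons; exact: homogD.
Qed.

Lemma homogZ (N : gbimodType L) z a (x : N) : homog z x -> homog z (a *: x).
Proof. by case: z => n /=; [rewrite gradeZ => -> | move=> ->; rewrite scaler0]. Qed.

Lemma homog_grade (N : gbimodType L) n (x : N) : homog (Posz n) (grade n x).
Proof. by rewrite /homog grade_grade eqxx. Qed.

Lemma homog_tens (M N : gbimodType L) p q (x : M) (y : N) :
  homog (Posz p) x -> homog (Posz q) y -> homog (Posz (p + q)) (tens x y).
Proof.
move=> hx hy; rewrite /homog [LHS]tgrade_tens.
have gx n : grade n x = if n == p then x else 0 by rewrite -{1}hx grade_grade hx.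
have gy n : grade n y = if n == q then y else 0 by rewrite -{1}hy grade_grade hy.
have pq : (p < (p + q).+1)%N by rewrite ltnS leq_addr.
rewrite (bigD1 (Ordinal pq)) //= gx gy addKn !eqxx big1 ?addr0 // => i.
by rewrite -val_eqE /= gx => /negbTE ->; rewrite tens0l.
Qed.

Lemma tensor_hom_ext (P Q : gbimodType L) (f g : tensor K P -> Q) :
  is_hom f -> is_hom g ->
  (forall n (s : sing R X n) b, f (tens (sgen L s) b) = g (tens (sgen L s) b)) -> f =1 g.
Proof.
move=> [fD fZ _] [gD gZ _] fg; apply: tensor_ext => // k b; move: k.
have [t1 _ _] := tens_balanced K P.
apply: (@chain_ext R L X Q (fun k => f (tens k b)) (fun k => g (tens k b))) => [x y|a x|x y|a x|n s] //.
- by rewrite t1 fD.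
- by rewrite -[tens (a *: x) b]tscale_tens; exact: fZ.
- by rewrite t1 gD.
- by rewrite -[tens (a *: x) b]tscale_tens; exact: gZ.
Qed.

Lemma tensor_hom_degree (P Q : gbimodType L) r (T : tensor K P -> Q) :
  is_hom T ->
  (forall n (s : sing R X n) m b, homog (Posz m) b ->
     homog ((n + m)%:Z + r) (T (tens (sgen L s) b))) ->
  hom_of_degree r T.
Proof.
move=> Th Td; split=> // q t tq; have [TD TZ _] := Th.
have [t1 _ _] := tens_balanced K P.
rewrite -[t]tq (tensorE t) (hom_sum _ _ _ (grade_hom _ q)) (additive_sum _ _ TD).
apply: homog_sum => -[x b] /=; rewrite [grade q _]tgrade_tens (additive_sum _ _ TD).
apply: homog_sum => p; set b' := grade (q - p) b; set x' := grade p x.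
have hx : homog (Posz p) x' by exact: homog_grade.
have -> : T (tens x' b') = linext (fun s => T (tens (fgen L s) b')) x'.
  rewrite -[x' in LHS]linext_fgenE.
  rewrite (@linext_morph R L X K Q (@fgen L (sing R X)) (fun k => T (tens k b'))) // => [k k'|a k].
    by rewrite t1 TD.
  by rewrite -[tens (a *: k) _]tscale_tens; exact: TZ.
apply: linext_homog hx => -[n s] /= np.
have := Td n s _ b' (homog_grade (q - p) b); congr (homog _ _).
by rewrite np subnKC // -ltnS.
Qed.

End TensorDegrees.

Section WordDegrees.
Variables (L : pzRingType) (A : Type) (M N : gbimodType L) (phi : seq A -> M).
Variable e : nat.
Hypothesis e1 : (e <= 1)%N.
Hypothesis phi_short : forall v, (size v <= 1)%N -> phi v = 0.
Hypothesis phi_homog : forall v, (1 < size v)%N -> homog (size v - 1 - e)%N (phi v).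

Lemma homog_dgs z v (Phi : seq A -> seq A -> N) :
  (forall a b, (0 < size a)%N -> (0 < size b)%N ->
     (size a + size b = (size v).+1)%N -> homog z (Phi a b)) ->
  homog z (dgs v Phi).
Proof.
move=> hP; have {hP}: forall ab, List.In ab (cuts v) -> homog z (Phi ab.1 ab.2).
  by move=> ab /cuts_size[? [? ?]]; apply: hP.
rewrite /dgs; elim: (cuts v) => [|ab r IH] h; first by rewrite big_nil; exact: homog0.
by rewrite big_cons; apply: homogD; [apply: h; left | apply: IH => u ur; apply: h; right].
Qed.

Lemma homog_seq_cons n q (x : M) s : homog (Posz n) x -> homog_seq q s ->
  homog_seq (n :: q) (x :: s).
Proof. by move=> hx [sq hs]; split=> [|[|j]] //=; [rewrite sq | exact: hs]. Qed.

(** [e] is the drop in degree caused by the cochain: 1 for twisting cochains, 0 for the cochain of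
    an equivalence. The degrees of a word plus [e] for each entry add up to the number of edges of
    [v]. *)
Lemma tsum_homog v (F : seq M -> N) z : vanishing F -> (0 < size v)%N ->
  (forall q s, s <> [::] -> homog_seq q s ->
     homog ((sumn q + e * size s)%:Z + z) (F s)) ->
  homog ((size v).-1%:Z + z) (tsum phi v F).
Proof.
elim: {v}(size v) {-2}v (leqnn (size v)) F z => [|n IH] v vn F z F0 v0 hF.
  by case: v vn v0.
rewrite tsum_rec //; apply: homogD.
  have [v1|v1] := leqP (size v) 1.
    by rewrite phi_short // F0 ?inE //; exact: homog0.
  have := hF [:: (size v - 1 - e)%N] [:: phi v].
  rewrite /= addn0 muln1 (_ : (_ + e)%N = (size v).-1); last by lia.
  by apply=> //; apply: homog_seq_cons => //; exact: phi_homog.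
apply: homog_dgs => a b a0 b0 ab.
have [a1|a1] := leqP (size a) 1.
  by rewrite phi_short // tsum_zero => [|x s]; [exact: homog0 | rewrite F0 ?inE ?eqxx].
rewrite (_ : _ + z = (size b).-1%:Z + ((size a).-1%:Z + z)); last by lia.
apply: IH => //; [by lia | exact: vanishing_cons|].
move=> q s s0 hs; have := hF ((size a - 1 - e)%N :: q) (phi a :: s).
rewrite /= (_ : (_ + e * _)%N = (size a).-1 + (sumn q + e * size s))%N; last by lia.
rewrite (_ : _%:Z + z = (sumn q + e * size s)%:Z + ((size a).-1%:Z + z)); last by lia.
by apply=> //; apply: homog_seq_cons => //; exact: phi_homog.
Qed.

Lemma esum_homog v (F : seq A -> seq M -> N) z : (forall a, vanishing (F a)) ->
  (0 < size v)%N ->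
  (forall a q s, (0 < size a)%N -> homog_seq q s ->
     homog ((size a).-1%:Z + ((sumn q + e * size s)%:Z + z)) (F a s)) ->
  homog ((size v).-1%:Z + z) (esum phi v F).
Proof.
move=> F0 v0 hF; apply: homogD.
  have := hF v [::] [::] v0; rewrite /= muln0 add0r; apply.
  by split.
apply: homog_dgs => a b a0 b0 ab.
rewrite (_ : _ + z = (size b).-1%:Z + ((size a).-1%:Z + z)); last by lia.
apply: tsum_homog => // q s _ hs; have := hF a q s a0 hs.
by congr (homog _ _); lia.
Qed.

End WordDegrees.

(** * Coordinates of tensors and the filtration by dimension *)

Section Coordinates.
Variables (R : realType) (L : pzRingType) (X : topologicalType).
Local Notation K := (chain R L X).
Implicit Types P Q M : gbimodType L.

Definition tcoef P (s : simplex R X) (t : tensor K P) : P :=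
  tlift (fun c b => fcoef c s *: b) t.

Lemma tcoef_balanced P s : balanced (fun (c : K) (b : P) => fcoef c s *: b).
Proof.
split=> [x x' y|x y y'|x a y].
- by rewrite fcoefD scalerDl.
- by rewrite scalerDr.
- by rewrite [fcoef _ _]fcoefR scalerA.
Qed.

Lemma tcoefD P s : {morph @tcoef P s : t u / t + u}.
Proof. by move=> t u; apply: tliftD (tcoef_balanced _ s). Qed.

Lemma tcoefN P s (t : tensor K P) : tcoef s (- t) = - tcoef s t.
Proof. exact: additiveN (tcoefD s). Qed.

Lemma tcoef_tens P s c (b : P) : tcoef s (tens c b) = fcoef c s *: b.
Proof. exact: tlift_tens (tcoef_balanced P s). Qed.

Lemma fcoef_fgen (s t : simplex R X) : fcoef (fgen L s) t = (t == s)%:R.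
Proof. by rewrite /fcoef SubK. Qed.

(** The simplices are a central basis of K, so K (x) P is a direct sum of copies of P indexed by
    simplices. *)
Lemma tensor_coords P (t : tensor K P) : exists r : seq (simplex R X),
  [/\ uniq r, forall s, s \notin r -> tcoef s t = 0
    & t = \sum_(s <- r) tens (fgen L s) (tcoef s t)].
Proof.
have [r [ur hr]] : exists r : seq (simplex R X), uniq r /\
    forall u s, u \in repr t -> fcoef u.1 s != 0 -> s \in r.
  elim: (repr t) => [|[c b] q [r [ur hr]]]; first by exists [::].
  have [r' [ur' cr' _]] := fcoef_supp c c.
  exists (undup (r' ++ r)); split=> [|u s]; first exact: undup_uniq.
  rewrite mem_undup mem_cat inE => /orP[/eqP -> /cr' -> //|uq us].
  by rewrite (hr _ _ uq us) orbT.
have [t1 t2 t3] := tens_balanced K P.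
exists r; split=> // [s sr|].
  rewrite /tcoef /tlift /fsum big_seq big1 // => u uq.
  have [->|us] := eqVneq (fcoef u.1 s) 0; first by rewrite scale0r.
  by rewrite (hr _ _ uq us) in sr.
rewrite {1}[t]tensorE /tcoef /tlift /fsum.
under [RHS]eq_bigr do rewrite tens_sumr.
rewrite exchange_big /= big_seq [RHS]big_seq; apply: eq_bigr => u uq.
rewrite -{1}[u.1]linext_fgenE (linextE _ ur); last by move=> s; exact: hr.
rewrite tens_suml; apply: eq_bigr => s _.
(* Centrality moves the coefficient to the right of the simplex, from where it crosses the tensor
   sign. *)
by rewrite -t3 fgen_central.
Qed.

Definition dim_lt P n (t : tensor K P) : Prop :=
  forall s, (n <= tag s)%N -> tcoef s t = 0.

Lemma dim_lt0 P (t : tensor K P) : dim_lt 0 t -> t = 0.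
Proof.
move=> t0; have [r [_ _ ->]] := tensor_coords t; rewrite big1 // => s _.
by rewrite t0 // tens0r.
Qed.

Lemma dim_lt_exists P (t : tensor K P) : exists n, dim_lt n t.
Proof.
have [r [_ h _]] := tensor_coords t; exists (\max_(s <- r) (tag s).+1)%N => s.
apply: contraTeq => ts; rewrite -ltnNge.
have sr : s \in r by apply: contraR ts => /h ->.
exact: (leq_bigmax_seq (F := fun s : simplex R X => (tag s).+1) _ sr).
Qed.

Lemma dim_ltD P n (t u : tensor K P) : dim_lt n t -> dim_lt n u -> dim_lt n (t + u).
Proof. by move=> ht hu s ns; rewrite tcoefD ht ?hu ?addr0. Qed.

Lemma dim_lt_zero P n : dim_lt n (0 : tensor K P).
Proof. by move=> s _; exact: (additive0 (tcoefD s)). Qed.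

Lemma dim_lt_sum P n I (r : seq I) (F : I -> tensor K P) :
  (forall i, dim_lt n (F i)) -> dim_lt n (\sum_(i <- r) F i).
Proof.
move=> h; elim: r => [|i r IH]; first by rewrite big_nil; exact: dim_lt_zero.
by rewrite big_cons; exact: dim_ltD.
Qed.

Lemma dim_lt_widen P n m (t : tensor K P) : (n <= m)%N -> dim_lt n t -> dim_lt m t.
Proof. by move=> nm ht s ms; apply: ht; exact: leq_trans ms. Qed.

Lemma dim_lt_tens P n m c (b : P) : homog (Posz m) c -> (m < n)%N ->
  dim_lt n (tens c b).
Proof.
move=> cm mn s ns; rewrite tcoef_tens -cm fcoefG ifF ?scale0r //.
by apply/eqP => e; rewrite e leqNgt mn in ns.
Qed.

(* T acts on the highest-dimensional part of a tensor through T1. *)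
Definition leading P Q (T : tensor K P -> tensor K Q) (T1 : nat -> P -> Q) : Prop :=
  [/\ {morph T : t u / t + u}, forall n, {morph T1 n : b c / b + c}
    & forall n (s : sing R X n) b,
        dim_lt n (T (tens (sgen L s) b) - tens (sgen L s) (T1 n b))].

(** The error terms of simplices of dimension at most [n] have dimension less than [n], so they do
    not meet the coefficients at [n]-simplices. *)
Lemma leadingE P Q (T : tensor K P -> tensor K Q) T1 n t : leading T T1 ->
  dim_lt n.+1 t ->
  dim_lt n.+1 (T t) /\ forall s, tag s = n -> tcoef s (T t) = T1 n (tcoef s t).
Proof.
move=> [TD T1D Tl] tn; have [r [ur rt ->]] := tensor_coords t.
pose low s := T (tens (fgen L s) (tcoef s t))
  - tens (fgen L s) (T1 (tag s) (tcoef s t)).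
have lown s : dim_lt n (low s).
  have [sn|ns] := leqP (tag s) n.
    by apply: (dim_lt_widen sn); case: s {sn} => m s; exact: Tl.
  rewrite /low tn // !tens0r (additive0 TD) (additive0 (@T1D _)) tens0r subr0.
  exact: dim_lt_zero.
have topn s : dim_lt n.+1 (tens (fgen L s) (T1 (tag s) (tcoef s t))).
  have [sn|ns] := leqP (tag s) n; first by apply: (@dim_lt_tens _ _ (tag s)) => //; exact: homog_fgen.
  by rewrite tn // (additive0 (@T1D _)) tens0r; exact: dim_lt_zero.
have -> : T (\sum_(s <- r) tens (fgen L s) (tcoef s t)) =
    \sum_(s <- r) low s + \sum_(s <- r) tens (fgen L s) (T1 (tag s) (tcoef s t)).
  rewrite (additive_sum _ _ TD) -big_split; apply: eq_bigr => s _.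
  by rewrite /low /= subrK.
have e P' (c : simplex R X -> P') s : tcoef s (\sum_(u <- r) tens (fgen L u) (c u)) =
    if s \in r then c s else 0.
  rewrite (additive_sum _ _ (tcoefD s)).
  under eq_bigr do rewrite tcoef_tens fcoef_fgen.
  case: ifP => [sr|sr].
    rewrite (big_rem s) //= eqxx scale1r big_seq big1 ?addr0 // => u.
    by rewrite mem_rem_uniq // inE eq_sym => /andP[/negbTE -> _]; rewrite scale0r.
  by rewrite big_seq big1 // => u ur'; case: eqP => [su|_];
     rewrite ?scale0r // su ur' in sr *.
split.
  apply: dim_ltD; last by apply: dim_lt_sum => s; exact: topn.
  by apply: (@dim_lt_widen _ n) => //; apply: dim_lt_sum => s; exact: lown.
move=> s sn; rewrite tcoefD (@dim_lt_sum _ n) ?sn // add0r !e sn.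
by case: ifP => // _; rewrite (additive0 (@T1D _)).
Qed.

End Coordinates.

Section TwistedMapDegrees.
Variables (R : realType) (L : pzRingType) (X : topologicalType).
Local Notation K := (chain R L X).
Variables (M P Q : gbimodType L) (phi : K -> M) (h : K -> K) (G : seq M -> P -> Q).
Variable e : nat.
Hypothesis e1 : (e <= 1)%N.
Hypothesis phi_hom : is_hom phi.
Hypothesis phi_short : forall A (f : family R X A) v, (size v <= 1)%N -> phi (kap L f v) = 0.
Hypothesis phi_homog : forall A (f : family R X A) v, (1 < size v)%N ->
  homog (size v - 1 - e)%N (phi (kap L f v)).
Hypothesis G_lin : multilinear_mod G.

Lemma homog_tensz p z (x : K) (y : Q) : homog (Posz p) x -> homog z y ->
  homog (p%:Z + z) (tens x y).
Proof.
move=> hx; case: z => [q|q] hy; first exact: homog_tens.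
by rewrite hy tens0r; exact: homog0.
Qed.

Lemma emap_degree r : hom_of_degree 0 h ->
  (forall q s n b, homog_seq q s -> homog (Posz n) b ->
     homog ((sumn q + e * size s)%:Z + (n%:Z + r)) (G s b)) ->
  hom_of_degree r (emap phi h G).
Proof.
move=> [hh hd] Gd; have [[g1 g2] _ _ _ _] := G_lin.
apply: tensor_hom_degree => [|n s m b bm].
  exact: (emap_hom phi_hom phi_short hh G_lin).
rewrite -kap_pull_fam (emap_kap phi_hom phi_short hh G_lin).
have -> : (n + m)%:Z + r = (size (iota 0 n.+1)).-1%:Z + (m%:Z + r).
  by rewrite size_iota; lia.
apply: (esum_homog e1 (phi_short _) (phi_homog _)); rewrite ?size_iota //.
- by move=> a u u0; rewrite (multiadditive_vanishing (g1 b)) ?tens0r.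
- move=> a q u a0 hu; apply: homog_tensz; last exact: Gd.
  by have := hd _ _ (kap_homog L (pull_fam s) a); rewrite addr0.
Qed.

(** In every other term the simplex has been cut. Either its first factor has smaller dimension or
    the rest is a single vertex, on which [phi] is 0. *)
Lemma emap_leading (c : nat -> L) : is_hom h ->
  (forall n (s : sing R X n), h (sgen L s) = c n *: sgen L s) ->
  (forall n x, homog (Posz n) x -> homog (Posz n) (h x)) ->
  leading (emap phi h G) (fun n b => c n *: G [::] b).
Proof.
move=> hh hc hd; have [[g1 g2] _ _ _ _] := G_lin.
have [t1 t2 t3] := tens_balanced K Q.
have [eD _ _] := emap_hom phi_hom phi_short hh G_lin.
split=> [//|n b b'|n s b]; first by rewrite g2 scalerDr.
rewrite -kap_pull_fam (emap_kap phi_hom phi_short hh G_lin) /esum kap_pull_fam hc.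
have -> : tens (c n *: sgen L s) (G [::] b) = tens (sgen L s) (c n *: G [::] b).
  by rewrite -t3; congr tens; exact: fgen_central.
rewrite addrC addKr /dgs.
suff : forall ab, List.In ab (cuts (iota 0 n.+1)) ->
    dim_lt n (tsum (fun u => phi (kap L (pull_fam s) u)) ab.2
                (fun u => tens (h (kap L (pull_fam s) ab.1)) (G u b))).
  elim: (cuts _) => [|ab r IH] H; first by rewrite big_nil; exact: dim_lt_zero.
  rewrite big_cons; apply: dim_ltD; first by apply: H; left.
  by apply: IH => u ur; apply: H; right.
move=> [v w] /cuts_size /= []; rewrite size_iota => v0 [w0 vw].
have [w1|w1] := leqP (size w) 1.
  rewrite tsum_short //; first exact: dim_lt_zero.
  - by move=> u; exact: phi_short.
  - by move=> u u0; rewrite (multiadditive_vanishing (g1 b)) ?tens0r.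
rewrite /tsum /tsum_upto; apply: dim_lt_sum => ws.
by apply: (dim_lt_tens _ (hd _ _ (kap_homog L _ v))); clear e1; lia.
Qed.

End TwistedMapDegrees.

(** * Mapping cones *)

Section Cone.
Variables (R : realType) (L : pzRingType) (X : topologicalType).
Local Notation K := (chain R L X).
Variables P Q : gbimodType L.
Variables (d : tensor K P -> tensor K P) (d' : tensor K Q -> tensor K Q).
Variable f : tensor K P -> tensor K Q.
Variables (d1 : nat -> P -> P) (d1' : nat -> Q -> Q) (f1 : nat -> P -> Q).
Hypotheses (dl : leading d d1) (dl' : leading d' d1') (fl : leading f f1).
Hypotheses (dd : forall t, d (d t) = 0) (dd' : forall t, d' (d' t) = 0).
Hypothesis fd : forall t, f (d t) = d' (f t).
Hypothesis exact1 : forall n x y, d1 n x = 0 -> f1 n x + d1' n y = 0 ->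
  exists x' y', x = - d1 n x' /\ y = f1 n x' + d1' n y'.

(* Exactness of the mapping cone of f, with differential
   (t, u) |-> (- d t, f t + d' u), by induction on the dimension in X. *)
Lemma cone_exact t u : d t = 0 -> f t + d' u = 0 ->
  exists t' u', t = - d t' /\ u = f t' + d' u'.
Proof.
have [n0 tn0] := dim_lt_exists t; have [m0 um0] := dim_lt_exists u.
have := dim_lt_widen (leq_maxl n0 m0) tn0; have := dim_lt_widen (leq_maxr n0 m0) um0.
move: (maxn n0 m0) => n {n0 m0 tn0 um0}.
have [dD d1D _] := dl; have [dD' d1D' _] := dl'; have [fD f1D _] := fl.
have dN' x := additiveN x dD'.
elim: n t u => [|n IH] t u un tn dt fdt.
  exists 0, 0; rewrite (dim_lt0 tn) (dim_lt0 un) (additive0 dD) (additive0 fD).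
  by rewrite (additive0 dD') oppr0 addr0.
have [_ dtn] := leadingE dl tn; have [_ ftn] := leadingE fl tn.
have [_ dun] := leadingE dl' un.
(* On each [n]-simplex the coefficients of (t, u) form a cycle of the cone of [f1 n], and [exact1]
   writes it as a boundary; on other simplices the choice is arbitrary. *)
have /choice[xy hxy] : forall s : simplex R X, exists xy : P * Q, tag s = n ->
    tcoef s t = - d1 n xy.1 /\ tcoef s u = f1 n xy.1 + d1' n xy.2.
  move=> s; have [sn|] := eqVneq (tag s) n; last by move=> /eqP ns; exists (0, 0).
  have [||x' [y' [ex ey]]] := exact1 (n := n) (x := tcoef s t) (y := tcoef s u).
  - by rewrite -dtn // dt (additive0 (tcoefD s)).
  - by rewrite -ftn // -dun // -tcoefD fdt (additive0 (tcoefD s)).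
  - by exists (x', y').
have [r [ur rt rE]] := tensor_coords t; have [q [uq qu qE]] := tensor_coords u.
pose l : seq (simplex R X) := [seq s <- undup (r ++ q) | tag s == n].
pose t' := \sum_(s <- l) tens (fgen L s) (xy s).1.
pose u' := \sum_(s <- l) tens (fgen L s) (xy s).2.
have ul : uniq l by rewrite filter_uniq // undup_uniq.
have coefl (P' : gbimodType L) (c : simplex R X -> P') s :
    tcoef s (\sum_(v <- l) tens (fgen L v) (c v)) = if s \in l then c s else 0.
  rewrite (additive_sum _ _ (tcoefD s)).
  under eq_bigr do rewrite tcoef_tens fcoef_fgen.
  case: ifP => [sr|sr].
    rewrite (big_rem s) //= eqxx scale1r big_seq big1 ?addr0 // => v.
    by rewrite mem_rem_uniq // inE eq_sym => /andP[/negbTE -> _]; rewrite scale0r.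
  by rewrite big_seq big1 // => v ur'; case: eqP => [su|_];
     rewrite ?scale0r // su ur' in sr *.
have ltl (P' : gbimodType L) (c : simplex R X -> P') : dim_lt n.+1 (\sum_(v <- l) tens (fgen L v) (c v)).
  move=> s ns; rewrite coefl mem_filter; case: eqP => //= e.
  by rewrite e ltnn in ns.
have t'n : dim_lt n.+1 t' by exact: ltl.
have u'n : dim_lt n.+1 u' by exact: ltl.
have [dt'n dt'E] := leadingE dl t'n; have [ft'n ft'E] := leadingE fl t'n.
have [du'n du'E] := leadingE dl' u'n.
(* The pair (t, u) minus the cone differential of (t', u'): it is again a cycle, and its
   coefficients in dimension [n] cancel. *)
have [||||t2 [u2 [et eu]]] := IH (t + d t') (u - (f t' + d' u')).
- move=> s ns; rewrite tcoefD tcoefN tcoefD.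
  move: ns; rewrite leq_eqVlt => /orP[/eqP sn|ns]; last first.
    by rewrite un ?ft'n ?du'n ?addr0 ?oppr0 ?addr0.
  rewrite ft'E // du'E // !coefl !mem_filter -sn eqxx /= mem_undup mem_cat.
  have [_ eu] := hxy s (esym sn).
  case: ifP => [_|]; first by rewrite eu subrr.
  by move/negbT; rewrite negb_or => /andP[_ /qu ->];
     rewrite (additive0 (@f1D _)) (additive0 (@d1D' _)) addr0 oppr0 addr0.
- move=> s ns; rewrite tcoefD.
  move: ns; rewrite leq_eqVlt => /orP[/eqP sn|ns]; last by rewrite tn ?dt'n ?addr0.
  rewrite dt'E // coefl mem_filter -sn eqxx /= mem_undup mem_cat.
  have [et _] := hxy s (esym sn).
  case: ifP => [_|]; first by rewrite et addNr.
  by move/negbT; rewrite negb_or => /andP[/rt -> _]; rewrite (additive0 (@d1D _)) addr0.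
- by rewrite dD dd dt addr0.
- rewrite fD fd dD' dN' dD' dd' addr0 -[RHS]fdt; zmod.
exists (t' + t2), (u' + u2); split.
  by rewrite dD opprD -et; zmod.
rewrite fD dD' addrACA -eu; zmod.
Qed.

End Cone.

(** * Isomorphisms of graded homology *)

Section HomologyIso.
Variable L : pzRingType.

(** Surjectivity and injectivity in homology are stated on cycles, in the form in which exactness of
    a cone delivers them. *)
Definition quasi_iso (C D : complex L) (f : C -> D) : Prop :=
  [/\ hom_of_degree 0 f, forall x, f (cx_d x) = cx_d (f x),
      forall y, cx_d y = 0 -> exists x z, cx_d x = 0 /\ y = f x + cx_d z
    & forall x z, cx_d x = 0 -> f x = cx_d z -> exists w, x = cx_d w].

Lemma quasi_iso_graded_iso (C D : complex L) (f : C -> D) :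
  quasi_iso f -> graded_iso (homology C) (homology D).
Proof.
move=> [[[fD fZ fR] fd] fc fs fi].
have f0 : f 0 = 0 := additive0 fD.
have fN x := additiveN x fD.
have cyc x : cx_d x = 0 -> cx_d (f x) = 0 by move=> x0; rewrite -fc x0 f0.
pose F (h : homology C) : homology D := hclass (f (hrep h)).
have FE x : cx_d x = 0 -> F (hclass x) = hclass (f x).
  move=> x0; have [c e] := hrep_hclass x0.
  apply/hclass_eqP; [by apply: cyc; exact: d_hrep | exact: cyc |].
  by exists (f c); rewrite e fD fc addrC addKr.
exists F; split.
  split.
    split=> [h k|a h|h a].
    - elim/homology_ind: h => x x0; elim/homology_ind: k => y y0.
      by rewrite -hclassD // !FE ?cx_dD0 // fD hclassD ?cyc.
    - elim/homology_ind: h => x x0.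
      by rewrite -hclassZ // !FE ?cx_dZ0 // fZ hclassZ ?cyc.
    - elim/homology_ind: h => x x0.
      rewrite [rscale _ _]hrscaleE // !FE ?cx_dR0 // fR.
      by rewrite [RHS]hrscaleE ?cyc.
  move=> q h; rewrite addr0 /homog; elim/homology_ind: h => x x0.
  rewrite [grade q _]hgradeE // => e.
  have hq : homog (q%:Z + 0) (f (grade q x)) by apply: fd; exact: homog_grade.
  rewrite addr0 /homog in hq.
  by rewrite -e FE ?cx_dG0 // [LHS]hgradeE ?cyc ?cx_dG0 // hq.
have Fs k : exists h, F h = k.
  elim/homology_ind: k => y y0; have [x [z [x0 e]]] := fs y y0.
  exists (hclass x); rewrite FE //; apply/hclass_eqP; rewrite ?cyc //.
  exists (- z); rewrite e (homN _ (@cx_d_hom L D)); zmod.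
have /choice[g gK] := Fs.
exists g => [h|//]; move: (gK (F h)); elim/homology_ind: h => x x0.
move: (g _) => h; elim/homology_ind: h => y y0; rewrite !FE //.
move/hclass_eqP; rewrite !cyc // => -[//|//|z e].
have [dD _ _] := @cx_d_hom L C.
have yx0 : cx_d (y - x) = 0 by rewrite dD (homN _ (@cx_d_hom L C)) x0 y0 subrr.
have fyx : f (y - x) = cx_d z by rewrite fD fN.
by have [w ew] := fi _ _ yx0 fyx; apply/hclass_eqP => //; exists w.
Qed.

Lemma graded_iso_trans (M N P : gbimodType L) :
  graded_iso M N -> graded_iso N P -> graded_iso M P.
Proof.
move=> [f [[[fD fZ fR] fd] fb]] [g [[[gD gZ gR] gd] gb]]; exists (g \o f); split.
  split; first by split=> * /=; rewrite ?fD ?fZ ?fR ?gD ?gZ ?gR.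
  by move=> q x /fd; rewrite addr0 => /gd; rewrite addr0.
exact: bij_comp.
Qed.

(** Only the degree of the inverse needs an argument: as [f] respects the grading, [y] of degree q
    is the image of the degree q part of [g y], and [f] is injective. *)
Lemma graded_iso_sym (M N : gbimodType L) : graded_iso M N -> graded_iso N M.
Proof.
move=> [f [[[fD fZ fR] fd] [g fK gK]]]; exists g; split; last by exists f.
have fi := can_inj fK.
split; first by split=> *; apply: fi; rewrite ?fD ?fZ ?fR !gK.
move=> q y; rewrite addr0 => yq.
pose x := grade q (g y).
have fx : f x = y.
  have [A gyA] := grade_sum (g y).
  rewrite -[RHS]yq -[y in RHS]gK gyA (additive_sum _ _ fD).
  rewrite (hom_sum _ _ _ (grade_hom _ q)) /x {1}gyA (hom_sum _ _ _ (grade_hom _ q)).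
  rewrite (additive_sum _ _ fD); apply: eq_bigr => p _.
  have hp : homog (p%:Z + 0) (f (grade p (g y))) by apply: fd; exact: homog_grade.
  rewrite addr0 /homog in hp.
  rewrite grade_grade -[in RHS]hp grade_grade.
  by case: eqP => // _; rewrite (additive0 fD).
by rewrite -fx fK /homog /x grade_grade eqxx.
Qed.

Lemma chain_equivalent_graded_iso (C D : complex L) :
  chain_equivalent (@cx_d L C) (@cx_d L D) -> graded_iso (homology C) (homology D).
Proof.
move=> [f [g [s [t [[hf hg hs ht] [fd gd gf fg]]]]]].
have [[fD _ _] _] := hf; have [[gD _ _] _] := hg.
have [[sD _ _] _] := hs; have [[tD _ _] _] := ht.
apply: (@quasi_iso_graded_iso _ _ f); split=> // [y y0|x z x0 fx].
  exists (g y), (- t y); rewrite -gd y0 (additive0 gD); split=> //.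
  have := fg y; rewrite y0 (additive0 tD) addr0 (homN _ (@cx_d_hom L D)) => <-.
  zmod.
(* For a cycle x with f x = d z, the homotopy gives x = g (f x) - d (s x) and g (f x) = d (g z). *)
exists (g z - s x).
have [dD _ _] := @cx_d_hom L C; rewrite dD (homN _ (@cx_d_hom L C)).
have := gf x; rewrite x0 (additive0 sD) addr0 => <-.
rewrite -gd -fx; zmod.
Qed.

End HomologyIso.

(** * Twisted differentials *)

Section TwistedDifferential.
Variables (R : realType) (L : pzRingType) (X : topologicalType).
Local Notation K := (chain R L X).
Local Notation d := (@bdry R L X).
Local Notation dg := (@diag R L X).

Section Cochain.
Variables (M : gbimodType L) (phi : K -> M).
Hypothesis phi_degree : hom_of_degree (-1) phi.

(** A vertex would have an image of degree -1, where there is nothing but 0. *)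
Lemma cochain_short A (f : family R X A) v : (size v <= 1)%N -> phi (kap L f v) = 0.
Proof.
have [ph pd] := phi_degree; case: v => [|x [|//]] _; first exact: hom0 ph.
exact: (pd 0%N _ (kap_homog L f [:: x])).
Qed.

Lemma cochain_homog A (f : family R X A) v : (1 < size v)%N ->
  homog (size v - 1 - 1)%N (phi (kap L f v)).
Proof.
move=> v1; have [_ pd] := phi_degree; have := pd _ _ (kap_homog L f v).
by congr (homog _ _); lia.
Qed.

Lemma cochain_hat A (f : family R X A) v :
  hat (phi (kap L f v)) = (-1) ^+ size v *: phi (kap L f v).
Proof.
have [v1|v1] := leqP (size v) 1; first by rewrite cochain_short // hat0 scaler0.
by rewrite (hat_homog (cochain_homog f v1)); apply: eq_sign_scale; lia.
Qed.

Lemma diag_sum_kap (N : gbimodType L) (m : seq M -> N) A (f : family R X A) v :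
  slot_balanced m ->
  diag_sum dg m phi (kap L f v) = tsum (fun u => phi (kap L f u)) v m.
Proof.
move=> [mD mB]; have [[pD pZ pR] _] := phi_degree.
(* In [diag_sum] the cochain is applied to all factors; absorbing it into the dependence on the
   first one gives the form of [dsum]. *)
transitivity (dsum phi (fun x s => m (phi x :: s)) (kap L f v)).
  by apply: eq_fsbigr => i _; exact: eq_iter_diag.
rewrite (dsum_kap phi_degree.1 cochain_short).
  rewrite /esum [RHS]tsum_rec //; last exact: multiadditive_vanishing.
  exact: cochain_short.
split=> [x y s|x|x a y s|x s y a z s'].
- by rewrite pD; exact: (mD [::]).
- exact: multiadditive_cons.
- by rewrite pR; exact: (mB [::]).
- exact: (mB (phi x :: s)).
Qed.

Lemma bnd_cochain (m : seq M -> M) A (f : family R X A) v :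
  slot_balanced m -> (forall k, phi (d k) = diag_sum dg m phi k) ->
  bnd v (fun u => phi (kap L f u)) = tsum (fun u => phi (kap L f u)) v m.
Proof.
have [[pD _ _] _] := phi_degree.
by move=> mB e; rewrite -diag_sum_kap // -e bdry_kap (bnd_morph _ _ pD).
Qed.

Variables (P : gbimodType L) (p : seq M -> P -> P).
Hypothesis p_lin : multilinear_mod p.

Lemma bdry_tens_balanced : balanced (fun k (b : P) => tens (d k) b).
Proof.
have [t1 t2 t3] := tens_balanced K P; have [dD _ dR] := @bdry_hom R L X.
by split=> *; rewrite ?dD ?dR ?t1 ?t2 ?t3.
Qed.

Lemma twisted_dE t : twisted_d d dg p phi t =
  tlift (fun k b => tens (d k) b) t + emap phi (@hat L K) p t.
Proof. by rewrite /emap /tlift /fsum -big_split. Qed.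

Lemma twisted_d_kap A (f : family R X A) v b :
  twisted_d d dg p phi (tens (kap L f v) b) =
  bnd v (fun u => tens (kap L f u) b) +
  esum (fun u => phi (kap L f u)) v (fun a s => tens (hat (kap L f a)) (p s b)).
Proof.
rewrite twisted_dE (emap_kap phi_degree.1 cochain_short (@hat_hom L K) p_lin).
congr (_ + _); rewrite tlift_tens ?bdry_kap; last exact: bdry_tens_balanced.
have [t1 _ _] := tens_balanced K P.
by rewrite (bnd_morph _ _ (h := fun k => tens k b)) // => x y.
Qed.

Lemma twisted_d_hom : is_hom (twisted_d d dg p phi).
Proof.
have [eD eZ eR] := emap_hom phi_degree.1 cochain_short (@hat_hom L K) p_lin.
have tb := bdry_tens_balanced.
have [dD dZ _] := @bdry_hom R L X.
have ltD t u := @tliftD _ _ _ _ _ t u tb.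
split=> [t u|a t|t a]; rewrite !twisted_dE.
- by rewrite ltD eD; zmod.
- rewrite eZ scalerDr; congr (_ + _); move: t.
  apply: tensor_ext => [t u|t u|x y]; rewrite ?scalerDr ?ltD ?scalerDr //.
  rewrite [a *: tens x y]tscale_tens !tlift_tens // dZ.
  by rewrite -[RHS]/(tscale a _) tscale_tens.
- rewrite eR rscaleDl; congr (_ + _); move: t.
  apply: tensor_ext => [t u|t u|x y]; rewrite ?rscaleDl ?ltD ?rscaleDl //.
  by rewrite [rscale (tens x y) a]trscale_tens !tlift_tens // -[RHS]/(trscale _ a) trscale_tens.
Qed.

Lemma hat_homog_deg n (x : K) : homog (Posz n) x -> homog (Posz n) (hat x).
Proof. by move=> xn; rewrite (hat_homog xn); exact: homogZ. Qed.

Lemma hat_degree : hom_of_degree 0 (@hat L K).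
Proof.
split; first exact: hat_hom.
by move=> q x; rewrite addr0; exact: hat_homog_deg.
Qed.

Lemma twisted_d_degree :
  (forall q s n b, homog_seq q s -> homog (Posz n) b ->
     homog ((sumn q + 1 * size s)%:Z + (n%:Z + -1)) (p s b)) ->
  hom_of_degree (-1) (twisted_d d dg p phi).
Proof.
move=> pd; have [_ ed] := emap_degree (leqnn 1) phi_degree.1 cochain_short cochain_homog
  p_lin hat_degree pd.
apply: tensor_hom_degree => [|n s m b bm]; first exact: twisted_d_hom.
rewrite twisted_dE; apply: homogD; last first.
  by apply: ed; apply: homog_tens bm; exact: sgen_homog.
rewrite tlift_tens; last exact: bdry_tens_balanced.
have [[_ dd] _] := @bdry_differential R L X.
have := dd _ _ (sgen_homog L s); case: n s => [|n] s hd.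
  by rewrite hd tens0l; exact: homog0.
rewrite (_ : _ + -1 = Posz (n + m)); last by lia.
apply: homog_tens bm; move: hd; congr (homog _ _); lia.
Qed.

(** The boundary of a simplex has smaller dimension, so only p_1 remains; the sign is that of [hat]
    on an [n]-simplex. *)
Lemma twisted_d_leading :
  leading (twisted_d d dg p phi) (fun n b => (-1) ^+ n *: p [::] b).
Proof.
have [eD e1 el] := emap_leading phi_degree.1 cochain_short p_lin (@hat_hom L K)
  (fun n s => hat_homog (sgen_homog L s)) hat_homog_deg.
have [tD _ _] := twisted_d_hom.
split=> // n s b; rewrite twisted_dE -addrA; apply: dim_ltD; last exact: el.
rewrite tlift_tens; last exact: bdry_tens_balanced.
have [[_ dd] _] := @bdry_differential R L X.
have := dd _ _ (sgen_homog L s); case: n s => [|n] s hd.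
  by rewrite hd tens0l; exact: dim_lt_zero.
by apply: (@dim_lt_tens _ _ _ _ _ n) => //; move: hd; congr (homog _ _); lia.
Qed.

(** On simplices the cross terms and the square of the perturbing part combine, by
    [esum_mod_insert_sum], into the module relation and terms with a boundary in the first
    factor. *)
Lemma twisted_d_sq m : slot_balanced m ->
  (forall k, phi (d k) = diag_sum dg m phi k) ->
  (forall s b, mod_insert_sum p m p s b = 0) ->
  forall t, twisted_d d dg p phi (twisted_d d dg p phi t) = 0.
Proof.
move=> mB pe rel; set D := twisted_d d dg p phi.
have [DD DZ DR] := twisted_d_hom; rewrite -/D in DD DZ DR.
have [[p1 p2] _ _ _ _] := p_lin.
have [t1 t2 t3] := tens_balanced K P.
apply: (@tensor_hom_ext R L X P _ (fun t => D (D t)) (fun=> 0)).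
- by split=> *; rewrite ?DD ?DZ ?DR.
- by split=> *; rewrite ?addr0 ?scaler0 ?rscale0l.
move=> n s b; rewrite -kap_pull_fam.
set f := pull_fam s; set v := iota 0 n.+1; pose psi u := phi (kap L f u).
pose E u c := esum psi u (fun a s => tens (hat (kap L f a)) (p s c)).
have DE u c : D (tens (kap L f u) c) = bnd u (fun w => tens (kap L f w) c) + E u c.
  exact: twisted_d_kap.
have hat_tens a c : tens (hat (kap L f a)) c = (-1) ^+ (size a).+1 *: tens (kap L f a) c.
  by rewrite hat_kap -[RHS]/(tscale _ _) tscale_tens.
have := @esum_mod_insert_sum L nat M psi (fun u => @cochain_short _ f u)
  (cochain_hat f) P P _ m p p (multiadditive_vanishing mB.1)
  (fun u => bnd_cochain f u mB pe) (fun c => multiadditive_vanishing (p1 c)) p1 p2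
  (fun a c => tens (hat (kap L f a)) c).
move=> /(_ _ _ v b) master.
rewrite DE DD (bnd_morph _ _ DD) (esum_morph _ _ _ DD).
rewrite (eq_bnd (Psi := fun u => bnd u (fun w => tens (kap L f w) b) + E u b)) => [|*];
  last exact: DE.
rewrite bndD bnd_bnd add0r.
rewrite (@eq_esum _ _ _ psi _ v _ (fun a s => (-1) ^+ (size a).+1 *: bnd a (fun w => tens (kap L f w) (p s b))
   + (-1) ^+ (size a).+1 *: E a (p s b))); last first.
  by move=> a u _; rewrite hat_tens (morph_sign _ _ DD) DE scalerDr.
rewrite esumD addrCA /E master => [|c|a c c']; last first.
- by rewrite t2.
- by rewrite hat0 tens0l.
rewrite -esumD (@eq_esum _ _ _ psi _ v _ (fun _ _ => 0)).
  rewrite /esum /dgs big1 ?addr0 // => ab _; exact: tsum_zero.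
(* After the module relation is used, boundary and hat remain. They anticommute, since passing to a
   face lowers the degree by one. *)
move=> a u _; rewrite rel !(tens0r, scaler0) addr0 -bndZ -bndD.
rewrite (eq_bnd (Psi := fun=> 0)) ?bnd0 // => w aw.
by rewrite hat_tens aw exprS mulN1r scaleNr addNr.
Qed.

End Cochain.
End TwistedDifferential.

(** * Differential algebras and modules as A(oo)-structures *)

Section DifferentialAlgebras.
Variable L : pzRingType.

Definition pairing_lin (C D E : gbimodType L) (act : C -> D -> E) : Prop :=
  [/\ forall c c' x, act (c + c') x = act c x + act c' x,
      forall c x x', act c (x + x') = act c x + act c x',
      forall a c x, act (a *: c) x = a *: act c x,
      forall c a x, act (rscale c a) x = act c (a *: x)
    & forall c x a, act c (rscale x a) = rscale (act c x) a].

Lemma pairing_linN (C D E : gbimodType L) (act : C -> D -> E) :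
  pairing_lin act -> pairing_lin (fun c x => - act c x).
Proof.
case=> h1 h2 h3 h4 h5; split=> *; rewrite ?h1 ?h2 ?h3 ?h4 ?h5 ?opprD ?scalerN //.
by rewrite rscaleNl.
Qed.

Lemma mod_Ainf_lin (C D : gbimodType L) (d : D -> D) (act : C -> D -> D) :
  is_hom d -> pairing_lin act -> multilinear_mod (mod_Ainf d act).
Proof.
move=> [dD dZ dR] [a1 a2 a3 a4 a5]; have [hD hZ hR] := @hat_hom L C.
split.
- split=> [b [|z [|z' s]] x y [|t s']|[|x [|y s]] b b'] //=; rewrite ?addr0 //.
  + by rewrite hD a1 opprD.
  + by rewrite a2 opprD.
- split=> [a x [|y s] b|a b] //=; rewrite ?scaler0 //.
  by rewrite hZ a3 scalerN.
- case=> [|x [|y s]] b a //=; rewrite ?rscale0l //.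
  by rewrite a5 rscaleNl.
- by case=> [|x [|y s]].
- case=> [|z [|z' s]] x a b //=.
  by rewrite hR a4.
Qed.

Lemma alg_Ainf_balanced (C : gbimodType L) (d : C -> C) (mul : C -> C -> C) :
  is_hom d -> pairing_lin mul -> slot_balanced (alg_Ainf d mul).
Proof.
move=> [dD dZ dR] [a1 a2 a3 a4 a5]; have [hD hZ hR] := @hat_hom L C.
split.
- case=> [|z [|z' [|z'' s]]] x y [|t [|t' s']] //=; rewrite ?addr0 //.
  + by rewrite hD a1 opprD.
  + by rewrite a2 opprD.
- case=> [|z [|z' [|z'' s]]] x a y [|t s'] //=.
  by rewrite hR a4.
Qed.

Lemma hat_sum (M : gbimodType L) n (F : 'I_n -> M) :
  hat (\sum_(i < n) F i) = \sum_(i < n) hat (F i).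
Proof. by apply: additive_sum; exact: hatD. Qed.

Lemma hatK (M : gbimodType L) (x : M) : hat (hat x) = x.
Proof.
have [n ->] := grade_sum x; rewrite !hat_sum; apply: eq_bigr => i _.
rewrite (hat_homog (homog_grade i x)) (morph_sign _ _ (@hatD _ _)).
by rewrite (hat_homog (homog_grade i x)) sign_scaleK.
Qed.

Lemma hat_pairing (C D E : gbimodType L) (act : C -> D -> E) :
  pairing_lin act ->
  (forall p q c x, homog (Posz p) c -> homog (Posz q) x -> homog (Posz (p + q)) (act c x)) ->
  forall c x, hat (act c x) = act (hat c) (hat x).
Proof.
move=> [a1 a2 _ _ _] hd c x; have [n ->] := grade_sum c; have [m ->] := grade_sum x.
have aDl y : {morph act^~ y : u v / u + v} by move=> u v; exact: a1.
have aDr y : {morph act y : u v / u + v} by move=> u v; exact: a2.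
rewrite !hat_sum (additive_sum _ _ (aDl _)) (additive_sum _ _ (aDl _)) hat_sum.
apply: eq_bigr => i _.
rewrite (additive_sum _ _ (aDr _)) (additive_sum _ _ (aDr _)) hat_sum.
apply: eq_bigr => j _.
rewrite (hat_homog (homog_grade i c)) (hat_homog (homog_grade j x)).
rewrite (hat_homog (hd _ _ _ _ (homog_grade i c) (homog_grade j x))).
by rewrite (morph_sign _ _ (aDl _)) (morph_sign _ _ (aDr _)) sign_scaleD.
Qed.

Lemma hat_differential (C : gbimodType L) (d : C -> C) :
  hom_of_degree (-1) d -> forall c, hat (d c) = - d (hat c).
Proof.
move=> [[dD _ _] dd] c; have [n ->] := grade_sum c.
rewrite (additive_sum _ _ dD) !hat_sum (additive_sum _ _ dD) -sumrN; apply: eq_bigr => i _.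
rewrite (hat_homog (homog_grade i c)) (morph_sign _ _ dD).
have := dd _ _ (homog_grade i c); case: (i : nat) => [|k] hk.
  by rewrite hk hat0 scaler0 oppr0.
have hk' : homog (Posz k) (d (grade k.+1 c)) by move: hk; congr (homog _ _); lia.
by rewrite (hat_homog hk') exprS mulN1r scaleNr opprK.
Qed.

Section Module.
Variables (C D : gbimodType L) (dC : C -> C) (dD : D -> D).
Variables (mul : C -> C -> C) (act : C -> D -> D).
Hypotheses (dC_deg : hom_of_degree (-1) dC) (dD_hom : is_hom dD).
Hypothesis dDdD : forall x, dD (dD x) = 0.
Hypotheses (act_lin : pairing_lin act) (mul_lin : pairing_lin mul).
Hypothesis mul_homog : forall p q c c', homog (Posz p) c -> homog (Posz q) c' ->
  homog (Posz (p + q)) (mul c c').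
Hypothesis act_leibniz : forall c x, dD (act c x) = act (dC c) x + act (hat c) (dD x).
Hypothesis act_assoc : forall c c' x, act (mul c c') x = act c (act c' x).

(** For no, one and two algebra entries the relation is d d = 0, the Leibniz rule and associativity
    of the action; for more entries every term vanishes. *)
Lemma mod_Ainf_relation s b :
  mod_insert_sum (mod_Ainf dD act) (alg_Ainf dC mul) (mod_Ainf dD act) s b = 0.
Proof.
have [a1 a2 _ _ _] := act_lin; have aDl y : {morph act^~ y : u v / u + v} by move=> u v; exact: a1.
have [dDD _ _] := dD_hom; have dDN x := homN x dD_hom.
have act0l y : act 0 y = 0 := additive0 (aDl y).
have act0r c : act c 0 = 0 := additive0 (a2 c).
have actNl c y : act (- c) y = - act c y by exact: (additiveN c (aDl y)).
have actNr c y : act c (- y) = - act c y by exact: (additiveN y (a2 c)).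
have hatN (c : C) : hat (- c) = - hat c := homN c (@hat_hom L C).
rewrite /mod_insert_sum; case: s => [|x [|y [|z s]]].
- by rewrite insert_sum_nil big_ord_recl big_ord0 /= !add0r expr0 scale1r addr0 dDdD.
- rewrite insert_sum_cons split_sum1 insert_sum_nil !big_ord_recl big_ord0 /=.
  rewrite expr0 scale1r expr1 scaleN1r dDN act_leibniz.
  by rewrite (hat_differential dC_deg) hatK actNl; zmod.
- rewrite insert_sum_cons split_sum_cons split_sum1 insert_sum_cons split_sum1 insert_sum_nil.
  rewrite !big_ord_recl big_ord0 /=.
  rewrite !(expr0, scale1r, scaler0, oppr0, addr0) (additive0 dDD) !add0r expr1 scaleN1r.
  rewrite hatN hatK actNl actNr !opprK hat_pairing // hatK act_assoc.
  by zmod.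
rewrite insert_sum_cons /= hat0 act0l oppr0 add0r.
rewrite /split_sum big_nat big1 ?add0r => [|j /andP[_ js]]; last first.
  by have := size_drop j [:: x, y, z & s]; case: drop => //= /eqP; rewrite eq_sym subn_eq0 leqNgt js.
rewrite [X in - X](_ : _ = 0) ?oppr0 ?add0r; last first.
  rewrite /insert_sum big1 // => k _; rewrite big1 // => j _.
  by case: (map _ _) => [|? ?]; rewrite scaler0.
rewrite big1 // => -[[|[|k]] kl] _ /=.
- by rewrite (additive0 dDD) scaler0.
- by rewrite act0r oppr0 scaler0.
- by rewrite scaler0.
Qed.

Lemma mod_Ainf_homog :
  (forall p q c x, homog (Posz p) c -> homog (Posz q) x -> homog (Posz (p + q)) (act c x)) ->
  hom_of_degree (-1) dD ->
  forall q s n b, homog_seq q s -> homog (Posz n) b ->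
  homog ((sumn q + 1 * size s)%:Z + (n%:Z + -1)) (mod_Ainf dD act s b).
Proof.
move=> act_homog [_ dd] q [|x [|y s]] n b [sq hs] bn; last exact: homog0.
  by case: q sq {hs} => //= _; rewrite add0r; exact: dd.
case: q sq hs => [|k [|//]] //= _ hs; have hx := hs 0%N isT; rewrite /= in hx.
rewrite (_ : _ + _ = Posz (k + n)); last by lia.
rewrite -scaleN1r; apply: homogZ; apply: act_homog bn.
by rewrite (hat_homog hx); exact: homogZ.
Qed.

End Module.

(** The target is a differential module, so compositions with more than two parts contribute 0; one
    part gives the differential, two parts the action. *)
Lemma Minf_mod_Ainf_relation (M P C D : gbimodType L) (m : seq M -> M)
    (p : seq M -> P -> P) (dC : C -> C) (mul : C -> C -> C) (dD : D -> D)
    (act : C -> D -> D) (f : seq M -> C) (g : seq M -> P -> D) :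
  is_Minf_morphism m p (alg_Ainf dC mul) (mod_Ainf dD act) f g ->
  forall s b, mod_insert_sum g m p s b =
    dD (g s b) + \sum_(1 <= j < (size s).+1)
      mod_Ainf dD act [:: f (take j s)] (g (drop j s) b).
Proof.
move=> [_ _ rel] s b; rewrite rel; set n := size s.
have t1 : \sum_(k : 1.-tuple 'I_n.+2 | composition k)
    (let ks := take 1.-1 [seq val x | x <- k] in
     mod_Ainf dD act [seq f u | u <- reshape ks s] (g (drop (sumn ks) s) b)) = dD (g s b).
  rewrite (big_pred1 [tuple ord_max]) /= ?take0 //= ?drop0 //.
  move=> k; apply/idP/eqP => [|->]; last by rewrite /composition /= addn0 eqxx.
  case/tupleP: k => i k; rewrite (tuple0 k) /composition /= addn0 => /andP[_ /eqP e].
  by apply: val_inj => /=; congr (_ :: _); apply: val_inj.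
have t3 t : (2 < t)%N -> \sum_(k : t.-tuple 'I_n.+2 | composition k)
    (let ks := take t.-1 [seq val x | x <- k] in
     mod_Ainf dD act [seq f u | u <- reshape ks s] (g (drop (sumn ks) s) b)) = 0.
  move=> t2; rewrite big1 // => k _ /=.
  have : size (take t.-1 [seq val x | x <- k]) = t.-1.
    by rewrite size_takel // size_map size_tuple leq_pred.
  by case: take => [|i [|j l]] //=; move: t2; case: t k => [|[|[|]]].
rewrite big_ltn // t1; congr (_ + _).
case: (posnP n) => [n0|n0]; first by rewrite !big_geq // n0.
rewrite big_ltn // [X in _ + X](_ : _ = 0) ?addr0; last first.
  by rewrite big_nat big1 // => t /andP[t2 _]; exact: t3.
rewrite big_geq_mkord.
(* The second part counts the module entry too, so the two parts add up to [n.+1]. Positivity of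
   both leaves first parts from 1 to [n]. *)
pose h (i : 'I_n.+2) : 2.-tuple 'I_n.+2 := [tuple i; inord (n.+1 - i)].
rewrite (reindex_onto h (fun k => thead k)) /=; last first.
  move=> k; case/tupleP: k => i k; case/tupleP: k => j k.
  rewrite (tuple0 k) /composition /= addn0 => /andP[_ /eqP e].
  apply: val_inj => /=; congr [:: _; _]; apply: val_inj.
  by rewrite /= theadE inordK; lia.
rewrite [RHS]big_mkcond [LHS]big_mkcond [LHS]big_ord_recr ifF ?addr0; last first.
  by rewrite /composition /= subnn inordK // andbF.
apply: etrans (addr0 _) _; apply: eq_bigr => i _; rewrite theadE eqxx andbT /composition /= inordK ?ltnS ?leq_subr //.
have -> : [&& 0 < i, 0 < n.+1 - i & true]%N && (i + (n.+1 - i + 0) == n.+1)%N = (0 < i)%N.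
  by have := ltn_ord i; lia.
by rewrite addn0.
Qed.

End DifferentialAlgebras.

(** * The chain map Theta *)

Section ModuleMorphism.
Variables (R : realType) (L : pzRingType) (X : topologicalType).
Local Notation K := (chain R L X).
Local Notation d := (@bdry R L X).
Local Notation dg := (@diag R L X).
Variables (M P C D : gbimodType L).
Variables (m : seq M -> M) (p : seq M -> P -> P).
Variables (dC : C -> C) (mul : C -> C -> C) (dD : D -> D) (act : C -> D -> D).
Variables (f : seq M -> C) (g : seq M -> P -> D) (phi : K -> M).
Hypotheses (phi_degree : hom_of_degree (-1) phi).
Hypothesis phi_twisting : forall k, phi (d k) = diag_sum dg m phi k.
Hypotheses (m_bal : slot_balanced m) (p_lin : multilinear_mod p).
Hypotheses (f_bal : slot_balanced f) (g_lin : multilinear_mod g).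
Hypotheses (dD_hom : is_hom dD) (act_lin : pairing_lin act).
Hypothesis fg : is_Minf_morphism m p (alg_Ainf dC mul) (mod_Ainf dD act) f g.
Hypothesis psi_degree : hom_of_degree (-1) (diag_sum dg f phi).

(** The left side is evaluated by [esum_mod_insert_sum]. On the right side the image cochain is a
    sum over words, so its action on the values of [g] merges two cuttings into one and gives the
    right side of the morphism relation. *)
Lemma emap_chain_map t :
  emap phi id g (twisted_d d dg p phi t) =
  twisted_d d dg (mod_Ainf dD act) (diag_sum dg f phi) (emap phi id g t).
Proof.
set psi := diag_sum dg f phi; set p' := mod_Ainf dD act.
have id_hom : is_hom (@id K) by [].
have p'_lin : multilinear_mod p' by exact: mod_Ainf_lin.
have [TD TZ TR] := emap_hom phi_degree.1 (cochain_short phi_degree) id_hom g_lin.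
have [DD DZ DR] := twisted_d_hom phi_degree p_lin.
have [D'D D'Z D'R] := twisted_d_hom psi_degree p'_lin.
move: t; apply: tensor_hom_ext => [||n s b].
- by split=> *; rewrite ?DD ?DZ ?DR ?TD ?TZ ?TR.
- by split=> *; rewrite ?TD ?TZ ?TR ?D'D ?D'Z ?D'R.
rewrite -kap_pull_fam.
set F := pull_fam s; set v := iota 0 n.+1; pose ph u := phi (kap L F u).
have ph_short : forall u, (size u <= 1)%N -> ph u = 0 by move=> u; exact: cochain_short.
have [t1 t2 t3] := tens_balanced K D.
have [[g1 g2] _ _ _ _] := g_lin; have [[p1 p2] _ _ _ _] := p_lin.
have [[p'1 p'2] _ _ _ _] := p'_lin.
have TE u c : emap phi id g (tens (kap L F u) c) =
    esum ph u (fun a s => tens (kap L F a) (g s c)).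
  exact: (emap_kap phi_degree.1 (cochain_short phi_degree) id_hom g_lin).
have hat_tens (N : gbimodType L) a (c : N) :
    tens (hat (kap L F a)) c = (-1) ^+ (size a).+1 *: tens (kap L F a) c.
  by rewrite hat_kap -[RHS]/(tscale _ _) tscale_tens.
rewrite (twisted_d_kap phi_degree p_lin) TD (bnd_morph _ _ TD) (esum_morph _ _ _ TD).
rewrite (eq_bnd (Psi := fun u => esum ph u (fun a s => tens (kap L F a) (g s b)))) => [|*];
  last exact: TE.
rewrite (@eq_esum _ _ _ ph _ v _ (fun a s => (-1) ^+ (size a).+1 *:
    esum ph a (fun a' t => tens (kap L F a') (g t (p s b))))); last first.
  by move=> a u _; rewrite hat_tens (morph_sign _ _ TD) TE.
have := @esum_mod_insert_sum L nat M ph ph_short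
  (cochain_hat phi_degree F) P D _ m p g (multiadditive_vanishing m_bal.1)
  (fun u => bnd_cochain phi_degree F u m_bal phi_twisting)
  (fun c => multiadditive_vanishing (p1 c)) g1 g2
  (fun a c => tens (kap L F a) c) (fun c => tens0l _ c) (fun a => t2 (kap L F a)) v b.
move=> ->.
rewrite TE (esum_morph _ _ _ D'D).
rewrite (@eq_esum _ _ _ ph _ v (fun a s => twisted_d _ _ _ _ _) (fun a s =>
   bnd a (fun u => tens (kap L F u) (g s b)) +
   esum (fun u => psi (kap L F u)) a (fun a' t => tens (hat (kap L F a')) (p' t (g s b)))));
  last by move=> a u _; rewrite (twisted_d_kap psi_degree p'_lin).
rewrite [LHS]esumD [RHS]esumD; congr (_ + _).
(* An empty [t] stands for the term with the differential of D, a non-empty one for the action of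
   [f t]; the divisions of one word into [t] and [s] thus list the whole relation. *)
pose Q a t s := tens (hat (kap L F a))
  (if t is [::] then dD (g s b) else p' [:: f t] (g s b)).
have g0 := multiadditive_vanishing (g1 b).
have f0 := multiadditive_vanishing f_bal.1.
have p'0 c : p' [:: 0] c = 0 := multiadditive_vanishing (p'1 c) (s := [:: 0]) (mem_head _ _).
transitivity (esum ph v (fun a s => esum ph a (fun a' t => Q a' t s))).
  rewrite esum_esum //; first last.
  - by move=> a u [|x t] // t0; rewrite /Q f0 // p'0 tens0r.
  - by move=> a [|x t] u u0; rewrite /Q g0 // ?(hom0 dD_hom) ?(additive0 (p'2 _)) tens0r.
  apply: eq_esum => a u _; rewrite -hat_tens (Minf_mod_Ainf_relation fg).
  rewrite t2 -(big_mkord xpredT (fun j => Q a (take j u) (drop j u))) big_ltn //.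
  rewrite take0 drop0 tens_sumr; congr (_ + _).
  apply: eq_big_nat => -[|j] // /andP[_ ju].
  by case: u ju.
apply: eq_esum => a u _; rewrite /esum; congr (_ + _); apply: eq_dgs => a1 a2 _ _ _.
rewrite [RHS]tsum_single; last by move=> x y w; exact: tens0r.
rewrite -[psi _]/(diag_sum dg f phi _) (diag_sum_kap phi_degree F a2 f_bal).
rewrite (tsum_morph _ _ _ (h := fun c => tens (hat (kap L F a1)) (p' [:: c] (g u b)))) //.
  exact: eq_tsum.
by move=> x y; rewrite -t2 (p'1 _ [::]).
Qed.

End ModuleMorphism.

(** * Equivalent twisting cochains *)

Section Equivalence.
Variables (R : realType) (L : pzRingType) (X : topologicalType).
Local Notation K := (chain R L X).
Local Notation d := (@bdry R L X).
Local Notation dg := (@diag R L X).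

Section Cup.
Variables (C : gbimodType L) (mul : C -> C -> C).
Hypothesis mul_lin : pairing_lin mul.

Lemma cup_balanced (al be : K -> C) : is_hom al -> is_hom be ->
  balanced (fun x y => mul (al x) (be y)).
Proof.
move=> [aD aZ aR] [bD bZ bR]; have [m1 m2 m3 m4 m5] := mul_lin.
by split=> *; rewrite ?aD ?bD ?m1 ?m2 // aR m4 bZ.
Qed.

Lemma cup_hom (al be : K -> C) : is_hom al -> is_hom be -> is_hom (cup dg mul al be).
Proof.
move=> ah bh; have bb := cup_balanced ah bh; have [dD dZ dR] := diag_hom R L X.
have [aD aZ aR] := ah; have [bD bZ bR] := bh; have [m1 m2 m3 m4 m5] := mul_lin.
split=> [x y|a x|x a]; rewrite /cup.
- by rewrite dD tliftD.
- rewrite dZ; move: (dg x); apply: tensor_ext => [t u|t u|y z].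
  + by rewrite scalerDr tliftD.
  + by rewrite tliftD // scalerDr.
  + by rewrite [a *: tens _ _]tscale_tens !tlift_tens // aZ m3.
- rewrite dR; move: (dg x); apply: tensor_ext => [t u|t u|y z].
  + by rewrite rscaleDl tliftD.
  + by rewrite tliftD // rscaleDl.
  + by rewrite [rscale (tens _ _) a]trscale_tens !tlift_tens // bR m5.
Qed.

Lemma cup_kap (al be : K -> C) A (f : family R X A) v : is_hom al -> is_hom be ->
  cup dg mul al be (kap L f v) = dgs v (fun a b => mul (al (kap L f a)) (be (kap L f b))).
Proof.
move=> ah bh; have bb := cup_balanced ah bh.
rewrite /cup diag_kap /dgs tlift_sum //.
by apply: eq_bigr => ab _; rewrite tlift_tens.
Qed.

Variables (al c : K -> C).
Hypotheses (al_hom : is_hom al) (c_hom : is_hom c).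
Hypothesis c_short : forall A (f : family R X A) v, (size v <= 1)%N -> c (kap L f v) = 0.

Definition cup_iter n : K -> C := iter n (fun be => cup dg mul be c) al.

Lemma cup_iter_hom n : is_hom (cup_iter n).
Proof. by elim: n => [//|n IH]; exact: cup_hom. Qed.

(** Each of the [n] factors [c] needs an edge, and a list of at most [n] vertices has fewer than [n]
    edges. This makes the series for the inverse of 1 + c finite. *)
Lemma cup_iter_short A (f : family R X A) n v : (size v <= n)%N ->
  cup_iter n (kap L f v) = 0.
Proof.
have [m1 m2 _ _ _] := mul_lin.
elim: n v => [|n IH] v vn.
  by move: vn; rewrite leqn0 => /nilP ->; exact: hom0 al_hom.
rewrite [cup_iter _]/= cup_kap //; last exact: cup_iter_hom.
rewrite (eq_dgs (Psi := fun _ _ => 0)); first by rewrite /dgs big1.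
move=> a b a0 b0 ab; have [b1|b1] := leqP (size b) 1.
  by rewrite c_short // (additive0 (m2 _)).
by rewrite -/(cup_iter n) IH ?(additive0 (fun x y => m1 x y _)) //; lia.
Qed.

Lemma cup_inv1D_kapE A (f : family R X A) n v : (size v <= n)%N ->
  cup_inv1D dg mul al c (kap L f v) = \sum_(i < n) (-1) ^+ i *: cup_iter i (kap L f v).
Proof.
move=> vn; rewrite /cup_inv1D (fsbigE (index_iota 0 n)) ?iota_uniq //.
  by rewrite (eq_bigl xpredT) ?big_mkord // => i; rewrite in_setT.
move=> i _; rewrite mem_index_iota /=; case: (leqP n i) => // ni.
by rewrite -/(cup_iter i) cup_iter_short ?scaler0 // (leq_trans vn).
Qed.

(* (al . (1 + c)^-1) . (1 + c) = al *)
Lemma cup_inv1D_kap A (f : family R X A) v :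
  cup_inv1D dg mul al c (kap L f v) +
  dgs v (fun a b => mul (cup_inv1D dg mul al c (kap L f a)) (c (kap L f b))) =
  al (kap L f v).
Proof.
have [m1 m2 _ _ _] := mul_lin.
have mD y : {morph mul^~ y : u w / u + w} by move=> u w; exact: m1.
rewrite (@cup_inv1D_kapE _ f (size v).+1) // big_ord_recl expr0 scale1r -[RHS]addr0 -addrA.
congr (_ + _).
rewrite (eq_dgs (Psi := fun a b => \sum_(i < size v)
    (-1) ^+ i *: mul (cup_iter i (kap L f a)) (c (kap L f b)))); last first.
  move=> a b a0 b0 ab; rewrite (@cup_inv1D_kapE _ f (size v)); last by lia.
  rewrite (additive_sum _ _ (mD _)); apply: eq_bigr => i _.
  by rewrite (morph_sign _ _ (mD _)).
rewrite dgs_sum -big_split big1 // => i _.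
rewrite -(dgs_morph v (fun a b => mul (cup_iter i (kap L f a)) (c (kap L f b))) (scalerDr _)).
have -> : cup_iter (lift ord0 i) (kap L f v) =
    dgs v (fun a b => mul (cup_iter i (kap L f a)) (c (kap L f b))).
  by rewrite -cup_kap //; exact: cup_iter_hom.
by rewrite lift0 exprS mulN1r scaleNr; exact: addNr.
Qed.

End Cup.

Section Gauge.
Variables (C D : gbimodType L) (dC : C -> C) (dD : D -> D).
Variables (mul : C -> C -> C) (act : C -> D -> D).
Hypotheses (dC_hom : is_hom dC) (dD_hom : is_hom dD).
Hypotheses (act_lin : pairing_lin act) (mul_lin : pairing_lin mul).
Hypothesis act_leibniz : forall c x, dD (act c x) = act (dC c) x + act (hat c) (dD x).
Hypothesis act_assoc : forall c c' x, act (mul c c') x = act c (act c' x).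
Variables (phi psi c : K -> C).
Hypotheses (phi_degree : hom_of_degree (-1) phi) (psi_degree : hom_of_degree (-1) psi).
Hypotheses (c_degree : hom_of_degree 0 c) (c0 : forall k, homog 0 k -> c k = 0).
Hypothesis psiE : forall k, psi k =
  cup_inv1D dg mul (fun x => phi x + cup dg mul (fun y => hat (c y)) phi x) c k
  - cup_inv1D dg mul (fun x => c (d x) + dC (c x)) c k.

Lemma gauge_short A (f : family R X A) v : (size v <= 1)%N -> c (kap L f v) = 0.
Proof.
case: v => [|x [|//]] _; first exact: hom0 c_degree.1.
exact: c0 (kap_homog L f [:: x]).
Qed.

Lemma gauge_homog A (f : family R X A) v : homog (Posz (size v).-1) (c (kap L f v)).
Proof. by have := c_degree.2 _ _ (kap_homog L f v); rewrite addr0. Qed.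

Lemma gauge_hat A (f : family R X A) v :
  hat (c (kap L f v)) = (-1) ^+ (size v).+1 *: c (kap L f v).
Proof.
have [v1|v1] := leqP (size v) 1; first by rewrite gauge_short // hat0 scaler0.
by rewrite (hat_homog (gauge_homog f v)); apply: eq_sign_scale; lia.
Qed.

(** The equivalence multiplied by 1 + c on the right: [cup_inv1D_kap] cancels the inverse in each of
    its two terms. *)
Lemma gauge_kap A (f : family R X A) v :
  psi (kap L f v) + dgs v (fun a b => mul (psi (kap L f a)) (c (kap L f b))) =
  phi (kap L f v) + dgs v (fun a b => mul (hat (c (kap L f a))) (phi (kap L f b)))
  - c (bnd v (kap L f)) - dC (c (kap L f v)).
Proof.
have [m1 m2 _ _ _] := mul_lin.
have mD y : {morph mul^~ y : u w / u + w} by move=> u w; exact: m1.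
have mN x y : mul (- x) y = - mul x y by exact: (additiveN x (mD y)).
have [ch _] := c_degree; have [ph _] := phi_degree.
have [cD cZ cR] := ch; have [pD pZ pR] := ph; have [eD eZ eR] := dC_hom.
have [hD hZ hR] := @hat_hom L C; have [bD bZ bR] := @bdry_hom R L X.
have hch : is_hom (fun y => hat (c y)).
  by split=> *; rewrite ?cD ?cZ ?cR ?hD ?hZ ?hR.
have [uD uZ uR] := cup_hom mul_lin hch ph.
pose al x := phi x + cup dg mul (fun y => hat (c y)) phi x.
pose al' x := c (d x) + dC (c x).
have psiE' k : psi k = cup_inv1D dg mul al c k - cup_inv1D dg mul al' c k.
  exact: psiE.
have ah : is_hom al.
  split=> *; rewrite /al ?pD ?pZ ?pR ?uD ?uZ ?uR ?scalerDr ?rscaleDl //; zmod.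
have ah' : is_hom al'.
  by split=> *; rewrite /al' ?bD ?bZ ?bR ?cD ?cZ ?cR ?eD ?eZ ?eR ?scalerDr ?rscaleDl //; zmod.
have E1 := cup_inv1D_kap mul_lin ah ch gauge_short f v.
have E2 := cup_inv1D_kap mul_lin ah' ch gauge_short f v.
rewrite psiE' (eq_dgs (Psi := fun a b =>
    mul (cup_inv1D dg mul al c (kap L f a)) (c (kap L f b)) +
    - mul (cup_inv1D dg mul al' c (kap L f a)) (c (kap L f b)))); last first.
  by move=> a b _ _ _; rewrite psiE' m1 mN.
rewrite dgsD dgsN.
transitivity (al (kap L f v) - al' (kap L f v)); first by rewrite -E1 -E2; zmod.
by rewrite /al /al' (cup_kap mul_lin) // bdry_kap; zmod.
Qed.

(* k (x) b |-> k (x) b + k' (x) ^c(k'') b *)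
Definition gauge : tensor K D -> tensor K D :=
  emap c id (mod_Ainf id (fun a b => - act a b)).

(** The minus sign of the action cancels the one built into [mod_Ainf]. In this form [gauge] is an
    [emap] and inherits linearity, degree and leading term. *)
Lemma gauge_lin : multilinear_mod (mod_Ainf (@id D) (fun (a : C) b => - act a b)).
Proof. by apply: mod_Ainf_lin => //; exact: pairing_linN. Qed.

Lemma gauge_tens A (f : family R X A) v b :
  gauge (tens (kap L f v) b) =
  tens (kap L f v) b + dgs v (fun a w => tens (kap L f a) (act (hat (c (kap L f w))) b)).
Proof.
rewrite /gauge (emap_kap c_degree.1 gauge_short) //; last exact: gauge_lin.
rewrite /esum; congr (_ + _); apply: eq_dgs => a w _ _ _.
rewrite tsum_single /= ?opprK // => *; exact: tens0r.
Qed.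

(** The signs of ^a and of the operation - ^th(w) b multiply to (-1)^(deg v) for every cut, so a
    single sign stands before the whole sum. *)
Lemma twisted_d_mod_Ainf_kap (th : K -> C) A (f : family R X A) v b :
  hom_of_degree (-1) th ->
  twisted_d d dg (mod_Ainf dD act) th (tens (kap L f v) b) =
  bnd v (fun u => tens (kap L f u) b) + (-1) ^+ (size v).+1 *:
    (tens (kap L f v) (dD b) +
     dgs v (fun a w => tens (kap L f a) (act (th (kap L f w)) b))).
Proof.
move=> thd; have plin := mod_Ainf_lin dD_hom act_lin.
have [a1 _ _ _ _] := act_lin.
have aD y : {morph act^~ y : u w / u + w} by move=> u w; exact: a1.
have [t1 t2 t3] := tens_balanced K D.
have hat_tens a (x : D) :
    tens (hat (kap L f a)) x = (-1) ^+ (size a).+1 *: tens (kap L f a) x.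
  by rewrite hat_kap -[RHS]/(tscale _ _) tscale_tens.
rewrite (twisted_d_kap thd plin) /esum /= hat_tens scalerDr; congr (_ + (_ + _)).
rewrite (dgs_morph _ _ (scalerDr _)); apply: eq_dgs => a w a0 w0 aw.
rewrite tsum_single => [|*]; last exact: tens0r.
rewrite /= (cochain_hat thd) (morph_sign _ _ (aD b)) hat_tens -scalerN.
rewrite -scaleN1r -(expr1 (-1)) !sign_scaleD (morph_sign _ _ (t2 _)) sign_scaleD.
by apply: eq_sign_scale; lia.
Qed.

Lemma gauge_chain_map t :
  gauge (twisted_d d dg (mod_Ainf dD act) phi t) =
  twisted_d d dg (mod_Ainf dD act) psi (gauge t).
Proof.
have id_hom : is_hom (@id K) by [].
have plin := mod_Ainf_lin dD_hom act_lin.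
have [TD TZ TR] := emap_hom c_degree.1 gauge_short id_hom gauge_lin; rewrite -/gauge in TD TZ TR.
have [DD DZ DR] := twisted_d_hom phi_degree plin.
have [D'D D'Z D'R] := twisted_d_hom psi_degree plin.
move: t; apply: tensor_hom_ext => [||n s b].
- by split=> *; rewrite ?DD ?DZ ?DR ?TD ?TZ ?TR.
- by split=> *; rewrite ?TD ?TZ ?TR ?D'D ?D'Z ?D'R.
rewrite -kap_pull_fam.
move: (iota 0 n.+1) => v; set f := pull_fam s; pose k := kap L f.
have [a1 a2 _ _ _] := act_lin.
have aD y : {morph act^~ y : u w / u + w} by move=> u w; exact: a1.
have [t1 t2 t3] := tens_balanced K D.
have [cD _ _] := c_degree.1; have [dDD _ _] := dD_hom.
have D1 u y : twisted_d d dg (mod_Ainf dD act) phi (tens (k u) y) =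
   bnd u (fun w => tens (k w) y) + (-1) ^+ (size u).+1 *:
    (tens (k u) (dD y) + dgs u (fun a w => tens (k a) (act (phi (k w)) y))).
  exact: twisted_d_mod_Ainf_kap.
have D2 u y : twisted_d d dg (mod_Ainf dD act) psi (tens (k u) y) =
   bnd u (fun w => tens (k w) y) + (-1) ^+ (size u).+1 *:
    (tens (k u) (dD y) + dgs u (fun a w => tens (k a) (act (psi (k w)) y))).
  exact: twisted_d_mod_Ainf_kap.
have GT u y : gauge (tens (k u) y) =
    tens (k u) y + dgs u (fun a w => tens (k a) (act (hat (c (k w))) y)).
  exact: gauge_tens.
pose S Phi := dgs v (fun a w => tens (k a) (act (Phi w) b)).
have SD Phi Psi : S (fun w => Phi w + Psi w) = S Phi + S Psi.
  by rewrite /S -dgsD; apply: eq_dgs => a w _ _ _; rewrite a1 t2.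
pose U w := dgs w (fun u u' => mul (hat (c (k u))) (phi (k u'))).
pose V w := dgs w (fun u u' => mul (psi (k u)) (c (k u'))).
(* Two successive actions become the action of a cup product, by coassociativity and associativity
   of the action. *)
have coassocS (h h' : seq nat -> C) :
    dgs v (fun a w => dgs a (fun u u' => tens (k u) (act (h u') (act (h' w) b)))) =
    S (fun w => dgs w (fun u u' => mul (h u) (h' u'))).
  rewrite (dgs_coassoc v (fun u u' w => tens (k u) (act (h u') (act (h' w) b)))).
  apply: eq_dgs => a w _ _ _; rewrite (dgs_morph _ _ (aD b)) (dgs_morph _ _ (t2 _)).
  by apply: eq_dgs => u u' _ _ _; rewrite act_assoc.
(* [gauge_kap] acting on [b], summed over all cuts of [v]. Apart from it, the expansions [EL] and
   [ER] of the two sides agree. *)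
have key : S (fun w => psi (k w)) + S V + S (fun w => dC (c (k w))) + S (fun w => c (bnd w k)) =
    S (fun w => phi (k w)) + S U.
  rewrite -!SD; apply: eq_dgs => a w _ _ _; congr (tens _ (act _ b)).
  by rewrite (gauge_kap f w); zmod.
have EL : gauge (twisted_d d dg (mod_Ainf dD act) phi (tens (k v) b)) =
    bnd v (fun u => tens (k u) b)
    + (dgs v (fun a w => bnd a (fun u => tens (k u) (act (hat (c (k w))) b)))
       - (-1) ^+ (size v).+1 *: S (fun w => c (bnd w k)))
    + (-1) ^+ (size v).+1 *: (tens (k v) (dD b)
        + dgs v (fun a w => tens (k a) (act (hat (c (k w))) (dD b)))
        + (S (fun w => phi (k w)) + S U)).
  rewrite D1 TD (bnd_morph _ _ TD) (morph_sign _ _ TD) TD GT (dgs_morph _ _ TD).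
  rewrite (eq_bnd (Phi := fun u => gauge (tens (k u) b)) (Psi := fun u => tens (k u) b +
    dgs u (fun a w => tens (k a) (act (hat (c (k w))) b)))) => [|*]; last exact: GT.
  rewrite bndD; congr (_ + _ + _ *: (_ + _)).
    (* A boundary falling on the second half of a cut produces the term c d of the equivalence; the
       term with the differential of C arises in [ER] from the Leibniz rule of the action. *)
    have := bnd_dgs v (fun a w => tens (k a) (act (hat (c (k w))) b)).
    rewrite /= tens0l addr0 (hom0 c_degree.1) hat0 (additive0 (aD b)) tens0r scaler0 subr0.
    move=> <-; rewrite dgsD dgsN; congr (_ - _).
    rewrite (dgs_morph _ _ (scalerDr _)); apply: eq_dgs => a w a0 w0 aw.
    rewrite (eq_bnd (Psi := fun u => (-1) ^+ size w *:
        tens (k a) (act (c (k u)) b))); last first.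
      move=> u uw; rewrite (gauge_hat f u) (morph_sign _ _ (aD b)) (morph_sign _ _ (t2 _)).
      by rewrite -uw.
    rewrite bndZ sign_scaleD -(bnd_morph _ _ (h := fun x => tens (k a) (act (c x) b))).
      by apply: eq_sign_scale; lia.
    by move=> x y; rewrite cD a1 t2.
  rewrite -(coassocS (fun u => hat (c (k u))) (fun u => phi (k u))) /S -dgsD.
  by apply: eq_dgs => a w _ _ _; rewrite GT.
have ER : twisted_d d dg (mod_Ainf dD act) psi (gauge (tens (k v) b)) =
    bnd v (fun u => tens (k u) b)
    + (-1) ^+ (size v).+1 *: (tens (k v) (dD b) + S (fun w => psi (k w)))
    + (dgs v (fun a w => bnd a (fun u => tens (k u) (act (hat (c (k w))) b)))
       + (-1) ^+ (size v).+1 *: (S (fun w => dC (c (k w)))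
          + dgs v (fun a w => tens (k a) (act (hat (c (k w))) (dD b))) + S V)).
  rewrite GT D'D D2 (dgs_morph _ _ D'D); congr (_ + _).
  rewrite -(coassocS (fun u => psi (k u)) (fun u => c (k u))) /S -!dgsD.
  rewrite (dgs_morph _ _ (scalerDr _)) -dgsD; apply: eq_dgs => a w a0 w0 aw.
  rewrite D2; congr (_ + _); rewrite (gauge_hat f w) !(morph_sign _ _ (aD _)).
  rewrite (morph_sign _ _ (dDD)) act_leibniz (gauge_hat f w).
  rewrite !(morph_sign _ _ (aD _)) !(morph_sign _ _ (t2 _)) !t2 (morph_sign _ _ (t2 _)).
  rewrite (eq_dgs (Psi := fun u u' => (-1) ^+ (size w).+1 *:
      tens (k u) (act (psi (k u')) (act (c (k w)) b)))); last first.
    by move=> u u' _ _ _; rewrite (morph_sign _ _ (a2 _)) (morph_sign _ _ (t2 _)).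
  rewrite -(dgs_morph _ _ (scalerDr _)) -!scalerDr sign_scaleD.
  by rewrite addSn addnS -addSn; apply: eq_sign_scale; lia.
rewrite -/(k v) EL ER.
have -> : S (fun w => phi (k w)) + S U = S (fun w => psi (k w)) + S V +
  S (fun w => dC (c (k w))) + S (fun w => c (bnd w k)) by rewrite -key.
by rewrite !scalerDr; zmod.
Qed.

End Gauge.
End Equivalence.

(** * The two comparison maps as isomorphisms in homology *)

Section QuasiIsomorphisms.
Variables (R : realType) (L : pzRingType) (X : topologicalType).
Local Notation K := (chain R L X).

Lemma cone_quasi_iso (P Q : gbimodType L) (d : tensor K P -> tensor K P)
    (d' : tensor K Q -> tensor K Q) (f : tensor K P -> tensor K Q)
    (hd : is_differential d) (hd' : is_differential d')
    (d1 : nat -> P -> P) (d1' : nat -> Q -> Q) (f1 : nat -> P -> Q) :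
  leading d d1 -> leading d' d1' -> leading f f1 -> hom_of_degree 0 f ->
  (forall t, f (d t) = d' (f t)) ->
  (forall n x y, d1 n x = 0 -> f1 n x + d1' n y = 0 ->
    exists x' y', x = - d1 n x' /\ y = f1 n x' + d1' n y') ->
  graded_iso (homology (Complex hd)) (homology (Complex hd')).
Proof.
move=> dl dl' fl fdeg fd exact1.
have cone := cone_exact dl dl' fl hd.2 hd'.2 fd exact1.
have [fD _ _] := fdeg.1; have f0 := additive0 fD; have d0 := hom0 hd.1.1.
apply: (@quasi_iso_graded_iso _ (Complex hd) (Complex hd') f); split=> //= [y y0|x z x0 fx].
  (* Surjectivity is exactness at the cone cycle (0, y), injectivity exactness at (x, - z). *)
  have [||t [u [et eu]]] := cone 0 y; rewrite ?d0 ?f0 ?add0r //.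
  exists t, u; split=> //; apply: oppr_inj; rewrite oppr0; exact: esym et.
have [|t [u [et _]]] := cone x (- z) x0; first by rewrite fx (homN _ hd'.1.1) subrr.
by exists (- t); rewrite (homN _ hd.1.1).
Qed.

Lemma multihom_balanced (M N : gbimodType L) r (m : seq M -> N) :
  multihom r m -> slot_balanced m.
Proof. by case. Qed.

(** The operation with [size s] algebra entries has index [size s] + 1, whence the shift of [r] by
    one. *)
Lemma multihom_mod_homog (M P Q : gbimodType L) r (p : seq M -> P -> Q) :
  multihom_mod r p ->
  forall q s n b, homog_seq q s -> homog (Posz n) b ->
  homog ((sumn q + 1 * size s)%:Z + (n%:Z + (r + 1))) (p s b).
Proof.
case=> _ _ _ _ [_ _ pd] q s n b qs bn; have := pd q s n b qs bn.
by congr (homog _ _); lia.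
Qed.

Lemma chain_pairing_lin (A B C : topologicalType) (mu : A * B -> C) (cmu : continuous mu) :
  pairing_lin (chain_pairing (R := R) (L := L) cmu).
Proof.
split=> *; [exact: pairingDl | exact: pairingDr | exact: pairingZl
           | exact: pairing_balanced | exact: pairingR].
Qed.

End QuasiIsomorphisms.

Section ChainModules.
Variables (R : realType) (L : pzRingType) (G : topGroupType) (B : topologicalType).
Variable F : gspace G.
Local Notation mul := (@pontryagin R L G).
Local Notation act := (@gs_chain_act R L G F).
Local Notation modF := (mod_Ainf (@bdry R L F) act).
Local Notation dK := (@bdry R L B).
Local Notation dg := (@diag R L B).

Lemma gs_chain_actM (c c' : chain R L G) (x : chain R L F) :
  act (mul c c') x = act c (act c' x).
Proof. by apply: pairing_assoc => g h y; exact: gs_actM. Qed.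

Lemma gs_chain_act_lin : pairing_lin act.
Proof. exact: chain_pairing_lin. Qed.

Lemma pontryagin_lin : pairing_lin mul.
Proof. exact: chain_pairing_lin. Qed.

Lemma modF_lin : multilinear_mod modF.
Proof. by apply: mod_Ainf_lin; [exact: bdry_hom | exact: gs_chain_act_lin]. Qed.

Lemma twisted_d_modF_differential (phi : chain R L B -> chain R L G) :
  is_twisting dK dg (@bdry R L G) mul phi ->
  is_differential (twisted_d dK dg modF phi).
Proof.
move=> [phid phie]; have [bG bGG] := @bdry_differential R L G.
have [bF bFF] := @bdry_differential R L F.
have al := gs_chain_act_lin; have ml := pontryagin_lin.
split.
  apply: (twisted_d_degree phid modF_lin).
  by apply: mod_Ainf_homog => // p q c x; exact: pairing_homog.
apply: (twisted_d_sq phid modF_lin _ phie).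
  by apply: alg_Ainf_balanced ml; exact: bdry_hom.
apply: mod_Ainf_relation => //.
- exact: bdry_hom.
- by move=> p q c x; exact: pairing_homog.
- by move=> c x; exact: bdry_pairing.
- exact: gs_chain_actM.
Qed.

Lemma gauge_graded_iso (phi psi : chain R L B -> chain R L G)
    (hphi : is_differential (twisted_d dK dg modF phi))
    (hpsi : is_differential (twisted_d dK dg modF psi)) :
  twisting_equivalent dK dg (@bdry R L G) mul phi psi ->
  graded_iso (homology (Complex hphi)) (homology (Complex hpsi)).
Proof.
move=> [[phid phie] [psid psie] [c [cd c0 psiE]]].
have cs := gauge_short cd c0.
have gl := gauge_lin gs_chain_act_lin.
have id_hom : is_hom (@id (chain R L B)) by [].
apply: (@cone_quasi_iso R L B _ _ _ _ (gauge act c) _ _ _ _ (fun n b => 1 *: b)).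
- exact: (twisted_d_leading phid modF_lin).
- exact: (twisted_d_leading psid modF_lin).
- apply: (emap_leading cd.1 cs gl id_hom (c := fun=> 1)) => // n s.
  by rewrite scale1r.
- have ch A (f : family R B A) v : (1 < size v)%N -> homog (size v - 1 - 0)%N (c (kap L f v)).
    by move=> _; have := gauge_homog cd f v; rewrite subn0 subn1.
  apply: (emap_degree (leq0n 1) cd.1 cs ch gl) => [|q [|x [|y s]] n b [sq hs] bn].
  + by split=> // q x; rewrite addr0.
  + by case: q sq {hs} => // _; rewrite (_ : _ + _ = Posz n) //; rewrite /=; lia.
  + case: q sq hs => [|k [|//]] // _ hs; have hx := hs 0%N isT; rewrite /= in hx.
    rewrite (_ : _ + _ = Posz (k + n)); last by rewrite /=; lia.
    rewrite /= opprK; apply: pairing_homog bn.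
    by rewrite (hat_homog hx); exact: homogZ.
  + exact: homog0.
- move=> t; apply: (gauge_chain_map _ _ gs_chain_act_lin pontryagin_lin _ _ phid psid cd c0 psiE).
  + exact: bdry_hom.
  + exact: bdry_hom.
  + by move=> c' x; exact: bdry_pairing.
  + exact: gs_chain_actM.
(* The cone of an identity is contractible: x = - d y is given, and (y, 0) bounds (x, y). *)
move=> n x y _; rewrite scale1r => e; exists y, 0; split.
  by apply: (addIr ((-1) ^+ n *: modF [::] y)); rewrite e addNr.
by rewrite scale1r /= (hom0 (@bdry_hom R L F)) scaler0 addr0.
Qed.

End ChainModules.

Theorem proposition3 (R : realType) (L : pzRingType)
  (G : topGroupType) (B : topologicalType)
  (xi : principal_fibration G B) (F : gspace G)
  (B_paracompact : paracompact B)
  (G_connected : connected [set: G])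
  (HG_free : forall i, free_in_degree (homology (sing_complex R L G)) i)
  (HF_free : forall i, free_in_degree (homology (sing_complex R L F)) i)
  (phi : chain R L B -> chain R L G)
  (phi_brown : is_brown_twisting xi F phi)
  (X : seq (homology (sing_complex R L G)) -> homology (sing_complex R L G))
  (f : seq (homology (sing_complex R L G)) -> chain R L G)
  (Xf_homology :
     is_homology_Ainf_algebra (C := sing_complex R L G) (@pontryagin R L G) X f)
  (Y : seq (homology (sing_complex R L G)) ->
       homology (sing_complex R L F) -> homology (sing_complex R L F))
  (g : seq (homology (sing_complex R L G)) ->
       homology (sing_complex R L F) -> chain R L F)
  (Yg_homology :
     is_homology_Ainf_module (C := sing_complex R L G) (D := sing_complex R L F)
       (@pontryagin R L G) (@gs_chain_act R L G F) X f Y g)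
  (phis : chain R L B -> homology (sing_complex R L G))
  (phis_twisting :
     is_tilde_twisting (@bdry R L B) (@diag R L B) X phis)
  (phis_phi :
     twisting_equivalent (@bdry R L B) (@diag R L B) (@bdry R L G)
       (@pontryagin R L G) phi (diag_sum (@diag R L B) f phis)) :
  exists hD : is_differential
                (twisted_d (@bdry R L B) (@diag R L B) Y phis),
    graded_iso (homology (Complex hD))
      (homology (sing_complex R L (assoc_total xi F))).
Proof.
have [[phi_tw phi_chain] [[Xh Xrel] X1 _ [fh _] _]] := (phi_brown, Xf_homology).
have [[Yh Yrel] Y1 _ fg g1] := Yg_homology.
have [phisd phise] := phis_twisting.
have [_ psi_tw _] := phis_phi; have [psid _] := psi_tw.
have [_ gh _] := fg.
have Xb := multihom_balanced Xh; have fb := multihom_balanced fh.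
have Yl := multihom_mod_linear Yh; have gl := multihom_mod_linear gh.
have hD : is_differential (twisted_d (@bdry R L B) (@diag R L B) Y phis).
  split; last exact: (twisted_d_sq phisd Yl Xb phise Yrel).
  by apply: (twisted_d_degree phisd Yl); exact: (multihom_mod_homog Yh).
have hphi := twisted_d_modF_differential F phi_tw.
have hpsi := twisted_d_modF_differential F psi_tw.
exists hD.
apply: graded_iso_trans (chain_equivalent_graded_iso
  (C := Complex hphi) (D := sing_complex R L (assoc_total xi F)) phi_chain).
(* [gauge] leads from phi to psi, so its isomorphism is used backwards; Theta remains. *)
apply: graded_iso_trans (graded_iso_sym (gauge_graded_iso hphi hpsi phis_phi)).
have id_hom : is_hom (@id (chain R L B)) by [].
have [[_ g_add] _ _ _ _] := gl; have [bD _ _] := @bdry_hom R L F.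
apply: (@cone_quasi_iso R L B _ _ _ _ (emap phis id g) _ _ _ _ (fun n b => 1 *: g [::] b)).
- exact: (twisted_d_leading phisd Yl).
- exact: (twisted_d_leading psid (modF_lin R L F)).
- apply: (emap_leading phisd.1 (cochain_short phisd) gl id_hom (c := fun=> 1)) => // n s.
  by rewrite scale1r.
- apply: (emap_degree (leqnn 1) phisd.1 (cochain_short phisd) (cochain_homog phisd) gl).
    by split=> // q x; rewrite addr0.
  exact: (multihom_mod_homog gh).
- move=> t; apply: (emap_chain_map phisd phise Xb Yl fb gl _ _ fg psid).
    exact: bdry_hom.
  exact: gs_chain_act_lin.
move=> n x y _; rewrite /= scale1r => e.
have bZ k z : bdry ((-1) ^+ k *: z) = (-1) ^+ k *: bdry z :> chain R L F by exact: morph_sign.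
(* The cone of g_1, with zero differential on H(F): if g_1 x is a boundary then the class x, which
   it represents, is 0, and hence y is a cycle. *)
have x0 : x = 0.
  have [gx <-] := g1 x.
  transitivity (hclass (0 : sing_complex R L F)) => //.
  apply/hclass_eqP; rewrite ?cx_d0 //; exists (- ((-1) ^+ n *: y)).
  rewrite subr0 [RHS](homN _ (@bdry_hom R L F)) bZ.
  by apply: (addIr ((-1) ^+ n *: bdry y)); rewrite e addNr.
have y0 : bdry y = 0.
  have e' : (-1) ^+ n *: bdry y = 0.
    by move: e; rewrite x0 (additive0 (g_add [::])) add0r.
  by rewrite -[LHS](sign_scaleK n) e' scaler0.
have [gy gyK] := g1 (hclass (y : sing_complex R L F)).
move/hclass_eqP: gyK => -[//|//|z ez].
(* The cycle g_1 [y] differs from y by the boundary of z; the sign before z undoes that of the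
   leading differential. *)
exists (hclass (y : sing_complex R L F)), (- ((-1) ^+ n *: z)).
rewrite x0 Y1 scaler0 oppr0 scale1r (homN _ (@bdry_hom R L F)) bZ scalerN sign_scaleK.
split=> //; rewrite -[bdry z]ez opprB addrC subrK //.
Qed.
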